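(* In the setting described in the context, there is an algorithm which, in time linear in the size of the formula $\phi_1\wedge\phi_2$, decides whether $\phi_1\wedge\phi_2$ is satisfiable and, if it is, computes a satisfying truth assignment.
   Context: Let $P$ be a partial order on $U=\{u_1,\dots,u_n\}$ and $V=\{v_1,\dots,v_n\}$ a disjoint copy. Let $\widetilde G=(U,V,\widetilde E)$ be the bipartite graph with $u_iv_j\in\widetilde E$ iff NOT $u_i<_P u_j$. Let $H$ be the split graph with vertex set $U\cup V$ and edge set $E_H=\widetilde E\cup\{vv': v,v'\in V, v\ne v'\}$. Two edges $e,e'$ of $H$ are in conflict if there are vertices $w_1,w_2,w_3,w_4$ (not necessarily distinct) with $e=w_2w_3$, $e'=w_4w_1$ and $w_1w_2,w_3w_4\notin E_H$. The conflict graph $H^*$ has vertex set $E_H$, two vertices adjacent iff the corresponding edges are in conflict. Assume $H^*$ is bipartite and fix a proper 2-coloring $\chi_0$ (red/blue) of $H^*$. Let $C_1,\dots,C_k$ be the connected components of $H^*$ with a boolean variable $x_i$ for $C_i$. For an edge $e\in C_i$ of $H$, $\ell_e=x_i$ if $e$ is red in $\chi_0$ and $\ell_e=\overline{x_i}$ otherwise. $\phi_1$: for every set of three edges $e,e',e''$ of $H$ for which there exist vertices $w_1,\dots,w_6$ (not necessarily distinct) with $e=w_2w_3$, $e'=w_4w_5$, $e''=w_6w_1$ and $w_1w_2,w_3w_4,w_5w_6\notin E_H$, and such that $\ell_e\ne\overline{\ell_{e'}}$, $\ell_{e'}\ne\overline{\ell_{e''}}$, $\ell_e\ne\overline{\ell_{e''}}$,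 $\phi_1$ contains the clauses $(\ell_e\vee\ell_{e'}\vee\ell_{e''})$ and $(\overline{\ell_e}\vee\overline{\ell_{e'}}\vee\overline{\ell_{e''}})$ (each such clause included once). $\phi_2$: with $E_0=\{u_iv_i\}$ and $E'=E_H\setminus E_0$, for every ordered pair $(i,j)$ (possibly $i=j$) with $u_iv_j\notin E'$ and every $t$ with $u_iv_t,u_tv_j\in E'$, $\phi_2$ contains the clause $(\ell_{u_iv_t}\vee\ell_{u_tv_j})$. *)

(* Defs.v *)
From mathcomp Require Import all_boot.
Set Implicit Arguments. Unset Strict Implicit. Unset Printing Implicit Defensive.

(* The split graph H.  U = {u_i} is encoded as [inl i], V = {v_j} as [inr j]. *)
(* [lt] is the strict order <_P on U (indexed by 'I_n).                       *)
Definition W (n : nat) : finType := ('I_n + 'I_n)%type.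

Definition adjH (n : nat) (lt : rel 'I_n) (x y : W n) : bool :=
  match x, y with
  | inl i, inr j => ~~ lt i j
  | inr j, inl i => ~~ lt i j
  | inr j, inr j' => j != j'
  | inl _, inl _ => false
  end.

Definition nonadj (n : nat) (lt : rel 'I_n) (x y : W n) : bool :=
  (x != y) && ~~ adjH lt x y.

Definition edge_is (n : nat) (lt : rel 'I_n) (e : {set W n}) (x y : W n) : bool :=
  adjH lt x y && (e == [set x; y]).

Definition is_edge (n : nat) (lt : rel 'I_n) (e : {set W n}) : bool :=
  [exists x, exists y, edge_is lt e x y].

Definition conflict (n : nat) (lt : rel 'I_n) (e e' : {set W n}) : bool :=
  [exists w1, exists w2, exists w3, exists w4,
    [&& edge_is lt e w2 w3, edge_is lt e' w4 w1, nonadj lt w1 w2 & nonadj lt w3 w4]].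

(* Literals and CNF formulas.  A literal (i, b) is x_i if b, ~x_i otherwise. *)
Definition lit := (nat * bool)%type.
Definition negl (l : lit) : lit := (l.1, ~~ l.2).

Definition sat_clause (a : nat -> bool) (c : seq lit) : bool :=
  has (fun l : lit => a l.1 == l.2) c.
Definition sat (f : seq (seq lit)) (a : nat -> bool) : bool := all (sat_clause a) f.
Definition satisfiable (f : seq (seq lit)) : Prop := exists a : nat -> bool, sat f a.

(* l_e : x_{comp e} if e is red (chi0 e = true), its negation otherwise. *)
Definition litE (n : nat) (chi0 : {set W n} -> bool) (comp : {set W n} -> nat)
  (e : {set W n}) : lit := (comp e, chi0 e).

Definition phi1_clause (n : nat) (lt : rel 'I_n) (chi0 : {set W n} -> bool)
  (comp : {set W n} -> nat) (c : seq lit) : Prop :=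
  exists (e e' e'' : {set W n}) (w1 w2 w3 w4 w5 w6 : W n),
    [/\ edge_is lt e w2 w3, edge_is lt e' w4 w5 & edge_is lt e'' w6 w1] /\
        [/\ nonadj lt w1 w2, nonadj lt w3 w4 & nonadj lt w5 w6] /\
        [/\ litE chi0 comp e != negl (litE chi0 comp e'),
            litE chi0 comp e' != negl (litE chi0 comp e'') &
            litE chi0 comp e != negl (litE chi0 comp e'')] /\
        (c = [:: litE chi0 comp e; litE chi0 comp e'; litE chi0 comp e'']
         \/ c = [:: negl (litE chi0 comp e); negl (litE chi0 comp e');
                    negl (litE chi0 comp e'')]).

Definition inE' (n : nat) (lt : rel 'I_n) (i j : 'I_n) : bool :=
  adjH lt (inl i) (inr j) && (i != j).

Definition phi2_clause (n : nat) (lt : rel 'I_n) (chi0 : {set W n} -> bool)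
  (comp : {set W n} -> nat) (c : seq lit) : Prop :=
  exists i j t : 'I_n,
    [/\ ~~ inE' lt i j, inE' lt i t, inE' lt t j &
        c = [:: litE chi0 comp [set (inl i : W n); inr t];
                litE chi0 comp [set (inl t : W n); inr j]]].

Definition phi_clause n lt chi0 comp (c : seq lit) : Prop :=
  @phi1_clause n lt chi0 comp c \/ @phi2_clause n lt chi0 comp c.

(* f is a listing of the clauses of phi1 /\ phi2 (clauses as sets of literals,
   in any order). *)
Definition represents n lt chi0 comp (f : seq (seq lit)) : Prop :=
  (forall c, c \in f -> exists s, @phi_clause n lt chi0 comp s /\ c =i s) /\
  (forall s, @phi_clause n lt chi0 comp s -> exists2 c, c \in f & c =i s).

(* Computation model: unit-cost RAM (nat registers, +, truncated -,          *)
(* indirect addressing, read-only input array), each instruction = 1 step.   *)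
Inductive instr : Type :=
| IConst (d c : nat)
| IAdd (d a b : nat)
| ISub (d a b : nat)
| ILoad (d a : nat)
| IStore (a s : nat)
| IInput (d a : nat)
| IJz (a l : nat)
| IHalt.

Definition upd (m : nat -> nat) (a v : nat) : nat -> nat :=
  fun x => if x == a then v else m x.

Definition state := (nat * (nat -> nat))%type.

Definition step (p : seq instr) (inp : seq nat) (s : state) : option state :=
  let: (pc, m) := s in
  match nth IHalt p pc with
  | IConst d c => Some (pc.+1, upd m d c)
  | IAdd d a b => Some (pc.+1, upd m d (m a + m b))
  | ISub d a b => Some (pc.+1, upd m d (m a - m b))
  | ILoad d a => Some (pc.+1, upd m d (m (m a)))
  | IStore a s => Some (pc.+1, upd m (m a) (m s))
  | IInput d a => Some (pc.+1, upd m d (nth 0 inp (m a)))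
  | IJz a l => Some (if m a == 0 then l else pc.+1, m)
  | IHalt => None
  end.

Fixpoint run (p : seq instr) (inp : seq nat) (fuel : nat) (s : state)
  : option (nat -> nat) :=
  match step p inp s with
  | None => Some s.2
  | Some s' => if fuel is f.+1 then run p inp f s' else None
  end.

Definition init (inp : seq nat) : state := (0, fun x => if x == 0 then size inp else 0).

Definition enc_lit (l : lit) : seq nat := [:: l.1; nat_of_bool l.2].
Definition enc_clause (c : seq lit) : seq nat := size c :: flatten (map enc_lit c).
Definition enc (f : seq (seq lit)) : seq nat := flatten (map enc_clause f).

(* Main.v *)
(** A [phi1] clause on chains x, y, z says that a relation "x before y" is not cyclic on them,
    where the literal of the edge from the bottom of x to the top of y stands for "x before y".
    The key fact is that unit propagation never has to be undone: if A is a consistent set of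
    literals closed under unit propagation, the formula has a model, and this model makes [l0]
    true, then A and [l0] together extend to a consistent set closed under unit propagation.  In
    particular one of [l] and [~l] propagates without conflict unless the formula is
    unsatisfiable.  The algorithm goes through the variables, propagates [l] and [~l] in lockstep,
    and keeps the side that finishes first without conflict: the work on the other side is charged
    to the side kept, whose literals never become unassigned again, so the total is linear. *)
Require Import Defs.
From mathcomp Require Import all_boot zify.
From Stdlib Require Import Classical.
Set Implicit Arguments. Unset Strict Implicit. Unset Printing Implicit Defensive.

(** Let $B$ be the set of consequences of $l_0$ under 2-clauses. The model contains $B$ and
    2-clauses can be read backwards, so $A\cup B$ is consistent; the obstacle is the 3-clauses.
    [cl2_good] overcomes it by a transfer: in a triple x, y, z, a literal that a 2-clause forces
    from x before y is forced just as well from x before z or from z before y, unless it is x before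
    y itself or is pure. Hence $A$ together with the members of $B$ that have a genuine derivation
    step is already closed under 3-clauses. Only $l_0$ may lack such a step; it is then a source,
    whose 2-clause consequences are all present, and closing under 3-clauses adds an explicit
    rectangle of literals u before v. Pure literals, whose negation is the literal of no edge
    $u_iv_j$, are put into $A$ beforehand. On the machine side, a clause may be listed with repeated
    literals, so the parser reduces it to a triple; and variable $v$ must end up in cell $v+1$,
    however large $v$ is, so the working arrays lie above a bound computed from the input. *)

Lemma neglK : involutive negl.
Proof. by case=> i b; rewrite /negl /= negbK. Qed.

Lemma negl_neq l : negl l <> l.
Proof. by case: l => i [] []. Qed.

Lemma negl_inj : injective negl.
Proof. exact: can_inj neglK. Qed.

(** * Edge classes of $H^*$ read as relations between chains of the order *)

Section Poset.

Variables (n : nat) (lt : rel 'I_n).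
Hypothesis lt_tr : transitive lt.
Variables (chi0 : {set W n} -> bool) (comp : {set W n} -> nat).
Hypothesis chi0P : forall e e', is_edge lt e -> is_edge lt e' ->
  conflict lt e e' -> chi0 e != chi0 e'.
Hypothesis compP : forall e e', is_edge lt e -> is_edge lt e' ->
  (comp e == comp e') = connect (conflict lt) e e'.

Definition ug (i j : 'I_n) : {set W n} := [set inl i; inr j].
Definition ell i j : lit := litE chi0 comp (ug i j).

Lemma ug_inj i j k l : ug i j = ug k l -> i = k /\ j = l.
Proof.
move=> e; split.
  have: (inl i : W n) \in ug k l by rewrite -e set21.
  by rewrite !inE orbF => /eqP [].
have: (inr j : W n) \in ug k l by rewrite -e set22.
by rewrite !inE /= => /eqP [].
Qed.

Lemma ug_edge i j : ~~ lt i j -> is_edge lt (ug i j).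
Proof.
by move=> h; apply/existsP; exists (inl i); apply/existsP; exists (inr j);
  rewrite /edge_is /= h eqxx.
Qed.

Definition xconf i j k l := [&& ~~ lt i j, ~~ lt k l, lt i l & lt k j].

Lemma conflict_ug i j k l : xconf i j k l -> conflict lt (ug i j) (ug k l).
Proof.
case/and4P=> h1 h2 h3 h4.
apply/existsP; exists (inr l); apply/existsP; exists (inl i).
apply/existsP; exists (inr j); apply/existsP; exists (inl k).
by rewrite /edge_is /nonadj /= h1 h2 h3 h4 !eqxx.
Qed.

(** Since $U$ is independent, each edge has at least one end in $V$; since $V$ is a clique, each
    non-adjacent pair has at most one. Counting over $w_1,\dots,w_4$ makes both numbers exactly one,
    so the four vertices alternate and edges inside $V$ are never in conflict. *)
Lemma conflict_inv e e' : conflict lt e e' ->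
  exists i j k l, [/\ e = ug i j, e' = ug k l & xconf i j k l].
Proof.
case/existsP=> w1 /existsP [w2] /existsP [w3] /existsP [w4].
rewrite /edge_is /nonadj /xconf.
case/and4P=> /andP [a1 /eqP ->] /andP [a2 /eqP ->] /andP [d1 a3] /andP [d2 a4].
have bad : forall a b : 'I_n, (inr a : W n) != inr b -> ~~ (a != b) -> False.
  by move=> a b /negP h /negPn /eqP ab; apply: h; rewrite ab.
case: w1 w2 w3 w4 a1 a2 d1 a3 d2 a4 => [i|i] [j|j] [k|k] [l|l] //= a1 a2 d1 a3 d2 a4.
all: try by case: (bad _ _ d1 a3).
all: try by case: (bad _ _ d2 a4).
- exists k, j, i, l; split; rewrite /ug 1?setUC //.
  by rewrite /xconf a1 a2 -[lt k l]negbK -[lt i j]negbK a3 a4.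
- exists j, k, l, i; split=> //.
  by rewrite /xconf a1 a2 -[lt j i]negbK -[lt l k]negbK a3 a4.
Qed.

Lemma xconf_chi0 i j k l : xconf i j k l -> chi0 (ug k l) = ~~ chi0 (ug i j).
Proof.
move=> h; case/and4P: (h) => h1 h2 _ _.
have := chi0P (ug_edge h1) (ug_edge h2) (conflict_ug h).
by case: (chi0 _); case: (chi0 _).
Qed.

Lemma xconf_comp i j k l : xconf i j k l -> comp (ug k l) = comp (ug i j).
Proof.
move=> h; case/and4P: (h) => h1 h2 _ _; apply/esym/eqP.
by rewrite compP ?ug_edge // connect1 // conflict_ug.
Qed.

Lemma ell_xconf i j k l : xconf i j k l -> ell k l = negl (ell i j).
Proof. by move=> h; rewrite /ell /litE (xconf_comp h) (xconf_chi0 h). Qed.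

(** The boolean is the parity of the number of conflicts crossed along a path of $H^*$. The proper
    colouring makes it depend on the two ends only. *)
Lemma ell_connect (P : bool -> 'I_n -> 'I_n -> Prop) i j p q :
  (forall b i j k l, xconf i j k l -> P b i j -> P (~~ b) k l) ->
  ~~ lt i j -> ~~ lt p q -> comp (ug i j) = comp (ug p q) -> P true i j ->
  P (chi0 (ug i j) == chi0 (ug p q)) p q.
Proof.
move=> step nij npq ecomp Pij.
have /connectP [s] : connect (conflict lt) (ug i j) (ug p q).
  by rewrite -compP ?ug_edge // ecomp.
suff: forall s i j b, path (conflict lt) (ug i j) s -> P b i j ->
    ug p q = last (ug i j) s -> P (b == (chi0 (ug i j) == chi0 (ug p q))) p q.
  by move=> H hp el; have:= H s i j true hp Pij el.
elim=> [|e s' IH] i' j' b /=.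
  by move=> _ Pb /ug_inj [-> ->]; rewrite eqxx eqb_id.
case/andP=> /conflict_inv [i1 [j1 [k1 [l1]]]] [/ug_inj [-> ->] -> hx] hp Pb hl.
have := IH k1 l1 (~~ b) hp (step _ _ _ _ _ hx Pb) hl.
by rewrite (xconf_chi0 hx); case: b {Pb}; case: (chi0 (ug i1 j1)); case: (chi0 (ug p q)).
Qed.

(* A chain [x.1 < x.2]; [o x y] is read "[x] comes before [y]". *)
Definition arrow := ('I_n * 'I_n)%type.
Implicit Types x y z w u v : arrow.

Definition ch x := lt x.1 x.2.
(** The two crossing edges $u_{x.1}v_{y.2}$ and $u_{y.1}v_{x.2}$ both exist in $H$ and are in
    conflict. *)
Definition ind x y := [&& ch x, ch y, ~~ lt x.1 y.2 & ~~ lt y.1 x.2].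
Definition o x y := ell x.1 y.2.

Lemma ind_sym x y : ind x y = ind y x.
Proof. by rewrite /ind; case: (ch x) (ch y) (lt x.1 y.2) (lt y.1 x.2) => [] [] [] []. Qed.

Lemma o_neg x y : ind x y -> o y x = negl (o x y).
Proof.
by case/and4P=> cx cy h1 h2; apply: ell_xconf; apply/and4P; split.
Qed.

(** By [o_neg], the three inequalities say that no two of [o x y], [o y z], [o z x] are
    complementary, which is the side condition of $\phi_1$. *)
Definition good x y z := [/\ [/\ ind x y, ind y z & ind x z],
  o x y <> o z y, o x y <> o x z & o x z <> o y z].

Lemma good_rot x y z : good x y z -> good y z x.
Proof.
case=> [[xy yz xz] h1 h2 h3].
have [yx zy zx] : [/\ ind y x, ind z y & ind z x] by split; rewrite ind_sym.
split; [by [] | by move/esym | |].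
- by move=> E; apply: h1; rewrite (o_neg yz) (o_neg yx) E.
- by move=> E; apply: h2; rewrite (o_neg yx) (o_neg zx) E.
Qed.

Lemma good_swap x y z : good x y z -> good y x z.
Proof.
case=> [[xy yz xz] h1 h2 h3].
have [yx zy zx] : [/\ ind y x, ind z y & ind z x] by split; rewrite ind_sym.
split; [by [] | | | by move/esym].
- by move=> E; apply: h2; rewrite (o_neg yx) (o_neg zx) E.
- by move=> E; apply: h1; rewrite (o_neg yx) (o_neg yz) E.
Qed.

Lemma good_ind x y z : good x y z -> [/\ ind x y, ind y z & ind x z].
Proof. by case. Qed.

(** A literal [o x y] reads only [x.1] and [y.2], so chains can be recombined. If [z.1] were below
    [q], the chain [(z.1, q)] would be independent of [y'] and give [o z y = o x y], which goodness
    excludes; [p] below [z.2] is excluded in the same way. *)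
Lemma good_move x y z p q : good x y z -> xconf x.1 y.2 p q ->
  let x' := (x.1, q) in let y' := (p, y.2) in
  [/\ good x' y' z, o x' z = o x z & o y' z = o y z].
Proof.
case=> [[xy yz xz] h1 h2 h3] /and4P [n1 n2 l1 l2] x' y'.
case/and4P: (xy) => cx cy x1y2 y1x2; case/and4P: (yz) => _ cz y1z2 z1y2.
case/and4P: (xz) => _ _ x1z2 z1x2.
have x'y' : ind x' y' by apply/and4P.
have oxy : o x' y' = o x y by [].
have z1q : ~~ lt z.1 q.
  apply/negP => zq; apply: h1.
  have ic : ind (z.1, q) y' by apply/and4P.
  by rewrite -[o z y]/(o (z.1, q) y') -[o x y]neglK -oxy -(o_neg x'y') -[RHS]neglK -(o_neg ic).
have pz2 : ~~ lt p z.2.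
  apply/negP => pz; apply: h2.
  have ic : ind x' (p, z.2) by apply/and4P.
  by rewrite -[o x z]/(o x' (p, z.2)) -oxy -[LHS]neglK -[RHS]neglK -(o_neg x'y') -(o_neg ic).
have x'z : ind x' z by apply/and4P.
have y'z : ind y' z by apply/and4P.
have zy : ind z y by rewrite ind_sym.
have zy' : ind z y' by rewrite ind_sym.
have ez : o y' z = o y z by rewrite (o_neg zy) (o_neg zy').
by split; [split; rewrite ?oxy ?ez | | ].
Qed.

(* An edge in the class of [o x y] may replace it without leaving the good triples containing [z]. *)
Lemma good_edge x y z p q : good x y z -> ~~ lt p q -> ell p q = o x y ->
  exists x' y', [/\ x'.1 = p, y'.2 = q, good x' y' z, o x' z = o x z & o y' z = o y z].
Proof.
move=> g npq e; have [xy _ _] := good_ind g; case/and4P: (xy) => _ _ nxy _.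
pose P (b : bool) i j := exists x' y', [/\ x'.1 = i, y'.2 = j, good x' y' z,
   o x' z = (if b then o x z else o y z) & o y' z = (if b then o y z else o x z)].
have: P (chi0 (ug x.1 y.2) == chi0 (ug p q)) p q.
  apply: ell_connect => //; last 2 first.
  - by case: e.
  - by exists x, y.
  move=> b i j k l hx [x' [y' [ei ej g' ex ey]]].
  move: hx; rewrite -ei -ej => /(good_move g') /= [g2 e1 e2].
  exists (k, y'.2), (x'.1, l); split => //=.
  - exact: good_swap.
  - by rewrite e2 ey; case: (b).
  - by rewrite e1 ex; case: (b).
by case: e => _ ->; rewrite eqxx.
Qed.

(** The counterpart of the triangle lemma for implication classes of transitive orientations.
    [good_edge] supplies the bottom of [x'] and the top of [y']; one more conflict, with the edge
    from [y'.1] to [x'.2], supplies the other two ends. *)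
Lemma good_class x y z x' y' : good x y z -> ind x' y' -> o x' y' = o x y ->
  [/\ good x' y' z, o x' z = o x z & o y' z = o y z].
Proof.
move=> g i' e; case/and4P: (i') => cx' cy' n1 n2.
have [x1 [y1 [e1 e2 g1 ex ey]]] := good_edge g n1 e.
have [xy1 _ _] := good_ind g1; case/and4P: (xy1) => cx1 cy1 n3 n4.
have := @good_move _ _ _ y'.1 x'.2 g1.
rewrite e1 e2 -ex -ey -!surjective_pairing; apply.
by apply/and4P.
Qed.

(** If one of [y], [w] has its bottom below the top of the other, [x] and [z] see both alike.
    Otherwise [y] and [w] are independent, and [good_class] makes either equality of the first
    alternative imply the other and turns any failure of goodness in the second into a
    contradiction. *)
Lemma good_share x y z w : good x y z -> good x z w ->
  (o x y = o x w /\ o z y = o z w) \/ (good x y w /\ good z y w).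
Proof.
move=> g1 g2; have [xy yz xz] := good_ind g1; have [_ zw xw] := good_ind g2.
have [[wx wz yx] [zx zy]] : [/\ ind w x, ind w z & ind y x] /\ ind z x /\ ind z y.
  by split; [split|split]; rewrite ind_sym.
(* The chain [(a.1, b.2)] has the bottom of [a] and the top of [b]: seen from [v] it gives the
   literal of [b], and its reversal gives that of [a]. *)
have cmp a b v : ind v a -> ind v b -> lt a.1 b.2 -> o v a = o v b.
  move=> va vb ab; case/and4P: (va) => cv ca n1 n2; case/and4P: (vb) => _ cb n3 n4.
  have vc : ind v (a.1, b.2) by apply/and4P.
  rewrite -[o v b]/(o v (a.1, b.2)) -[RHS]neglK -(o_neg vc).
  by rewrite -[LHS]neglK -(o_neg va).
have [wy|wy] := boolP (lt w.1 y.2).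
  by left; split; symmetry; apply: cmp.
have [yw|yw] := boolP (lt y.1 w.2); first by left; split; apply: cmp.
have iyw : ind y w.
  by case/and4P: xy => ? ? _ _; case/and4P: xw => ? ? _ _; apply/and4P.
have iwy : ind w y by rewrite ind_sym.
have class2 : o x y = o x w \/ o z y = o z w -> o x y = o x w /\ o z y = o z w.
  case=> E; split=> //.
    have [_ _ E1] := good_class g1 xw (esym E).
    have [yz' wz'] : ind y z /\ ind w z by [].
    by rewrite (o_neg yz') (o_neg wz') E1.
  have [_ _ E1] := good_class (good_swap (good_rot g1)) zw (esym E).
  by rewrite (o_neg yx) (o_neg wx) E1.
have [E|E1] := classic (o x y = o x w); first by left; apply: class2; left.
have [E|E2] := classic (o z y = o z w); first by left; apply: class2; right.
right; case: (g1) (g2) => _ h1 h2 h3 [_ k1 k2 k3]; split; split=> //.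
- by move=> E; have [_ /esym] := good_class g1 iwy (esym E).
- move=> E; have [_ E3 _] := good_class (good_swap (good_rot (good_rot g2))) iyw (esym E).
  by apply: h3; rewrite E3.
- move=> E; have [_ E3 _] := good_class (good_swap (good_rot g1)) iwy (esym E).
  by apply: k2; rewrite (o_neg wx) (o_neg zx) E3.
- move=> E; have [_ E3 _] := good_class (good_rot g2) iyw (esym E).
  by apply: h2; rewrite (o_neg yx) (o_neg zx) E3.
Qed.

(** * Forcing by the 2-clauses *)

Definition p2 i t j := [&& ~~ inE' lt i j, inE' lt i t & inE' lt t j].

Definition cl2 a b := exists i t j, p2 i t j /\
  ((a = ell i t /\ b = ell t j) \/ (b = ell i t /\ a = ell t j)).

Lemma cl2_sym a b : cl2 a b -> cl2 b a.
Proof. by case=> i [t [j [h h']]]; exists i, t, j; split=> //; case: h' => [] [-> ->]; [right|left]. Qed.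

Lemma inE'E i j : inE' lt i j = ~~ lt i j && (i != j).
Proof. by []. Qed.

(** The edge is an isolated vertex of $H^*$, so its variable belongs to no other edge. *)
Definition pure p := exists i j, [/\ ~~ lt i j, p = ell i j & forall k l, ~~ xconf i j k l].

Lemma pure_neg p i j : pure p -> ~~ lt i j -> ell i j <> negl p.
Proof.
case=> i0 [j0 [n0 -> h0]] nij e.
have [] := @ell_connect (fun b k l => k = i0 /\ l = j0) i0 j0 i j _ n0 nij _ _ => //.
- by move=> b i1 j1 k l hx [e1 e2]; have := h0 k l; rewrite -e1 -e2 hx.
- by case: e.
by move=> ei ej; move: e; rewrite ei ej => /esym/negl_neq.
Qed.

Lemma npure_xconf i j : ~~ lt i j -> ~ pure (ell i j) -> exists k l, xconf i j k l.
Proof.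
move=> nij np; apply: NNPP => h; apply: np; exists i, j; split=> // k l.
by apply/negP => hx; apply: h; exists k, l.
Qed.

Lemma neq_of_ind x y : ind x y -> y.1 != x.2.
Proof.
case/and4P=> cx cy n1 n2; apply/eqP => e; move/negP: n1; apply.
by apply: lt_tr cx _; rewrite -e.
Qed.

(** Treats the 2-clause through [x.2] from [y.1] to [j]. If [x.1] is below [j], then so is [z.1], as
    otherwise the chains [(x.1, j)] and [(y.1, j)] would give [o x z = o y z]. If not, a conflict of
    the non-pure edge from [x.2] to [j] is also one of the edge from [x.1] to [j], which leads into
    the class of [o x y]. *)
Lemma forced_above x y z j : good x y z -> ~~ lt x.2 j -> (y.1 == j) || lt y.1 j ->
  ~ pure (ell x.2 j) -> ell x.2 j = o x y \/ lt z.1 j /\ lt y.1 j.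
Proof.
move=> g nj yj np; have [xy yz xz] := good_ind g; case: g => _ _ _ h3.
case/and4P: (xy) => cx cy x1y2 y1x2; case/and4P: (yz) => _ cz y1z2 z1y2.
case/and4P: (xz) => _ _ x1z2 z1x2.
have [k [l hx]] := npure_xconf nj np; case/and4P: (hx) => _ nkl x2l kj.
have [x1j|x1j] := boolP (lt x.1 j).
  right; case/orP: yj => [/eqP e|y1j]; first by move/negP: x1y2; case; apply: lt_tr cy; rewrite e.
  split=> //; apply/negPn/negP => z1j; apply: h3.
  have i1 : ind z (x.1, j) by apply/and4P.
  have i2 : ind z (y.1, j) by apply/and4P.
  by rewrite -[o x z]/(o (x.1, j) z) -[o y z]/(o (y.1, j) z) (o_neg i1) (o_neg i2).
left; have h1 : xconf x.1 j k l by apply/and4P; split=> //; apply: lt_tr x2l.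
rewrite -[LHS]neglK -(ell_xconf hx) (ell_xconf h1) neglK.
case/orP: yj => [/eqP e|y1j]; last first.
  have h2 : xconf x.1 j y.1 x.2 by apply/and4P.
  by rewrite -[LHS]neglK -(ell_xconf h2) -/(o y x) (o_neg xy) neglK.
have kx2 : ~~ lt k x.2 by apply: contra nkl => kx; apply: lt_tr kx x2l.
have h2 : xconf x.1 j k x.2 by apply/and4P.
have h3' : xconf x.1 y.2 k x.2 by apply/and4P; split=> //; apply: lt_tr kj _; rewrite -e.
by rewrite -[LHS]neglK -(ell_xconf h2) (ell_xconf h3') neglK.
Qed.

Lemma forced_below x y z i : good x y z -> ~~ lt i y.1 -> (i == x.2) || lt i x.2 ->
  ~ pure (ell i y.1) -> ell i y.1 = o x y \/ lt i z.2 /\ lt i x.2.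
Proof.
move=> g ni ix np; have [xy yz xz] := good_ind g; case: g => _ _ _ h3.
case/and4P: (xy) => cx cy x1y2 y1x2; case/and4P: (yz) => _ cz y1z2 z1y2.
case/and4P: (xz) => _ _ x1z2 z1x2.
have [k [l hx]] := npure_xconf ni np; case/and4P: (hx) => _ nkl il ky1.
have [iy2|iy2] := boolP (lt i y.2).
  right; case/orP: ix => [/eqP e|ix2]; first by move/negP: x1y2; case; apply: lt_tr cx _; rewrite -e.
  split=> //; apply/negPn/negP => iz2; apply: h3.
  have i1 : ind (i, x.2) z by apply/and4P.
  have i2 : ind (i, y.2) z by apply/and4P.
  have [zx zy] : ind z x /\ ind z y by rewrite !(ind_sym z).
  rewrite (o_neg zx) (o_neg zy) -[o z x]/(o z (i, x.2)) -[o z y]/(o z (i, y.2)).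
  by rewrite (o_neg i1) (o_neg i2).
left; have h1 : xconf i y.2 k l by apply/and4P; split=> //; apply: lt_tr ky1 _.
rewrite -[LHS]neglK -(ell_xconf hx) (ell_xconf h1) neglK.
case/orP: ix => [/eqP e|ix2]; last first.
  have h2 : xconf i y.2 y.1 x.2 by apply/and4P.
  by rewrite -[LHS]neglK -(ell_xconf h2) -/(o y x) (o_neg xy) neglK.
have y1l : ~~ lt y.1 l by apply: contra nkl => yl; apply: lt_tr ky1 yl.
have h2 : xconf i y.2 y.1 l by apply/and4P.
have h3' : xconf x.1 y.2 y.1 l by apply/and4P; split=> //; apply: lt_tr cx _; rewrite -e.
by rewrite -[LHS]neglK -(ell_xconf h2) (ell_xconf h3') neglK.
Qed.

Lemma p2_cl2 i t j : p2 i t j -> cl2 (ell i t) (ell t j).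
Proof. by move=> h; exists i, t, j; split=> //; left. Qed.

(* Each literal that a 2-clause forces from [x] before [y] is pure, or already forced from
   [x] before [z] or from [z] before [y]. *)
Lemma cl2_good x y z m : good x y z -> cl2 (o y x) m ->
  [\/ m = o x y, pure m, cl2 (o z x) m /\ m <> o x z | cl2 (o y z) m /\ m <> o z y].
Proof.
move=> g [i [t [j [/and3P [hij hit htj] hc]]]].
have [pm|npm] := classic (pure m); first by constructor 2.
have hij' : (i == j) || lt i j.
  by move: hij; rewrite inE'E negb_and !negbK orbC.
case/andP: (hit) => nit eit; case/andP: (htj) => ntj etj.
have [xy yz xz] := good_ind g.
case: hc => [[e em]|[em e]]; rewrite em in npm *.
(* The clause only shares the class of [o y x]; the triple is moved so that the edge of the clause
   itself runs from [y'.1] to [x'.2]. *)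
- have [y' [x' [ei et g' ey ex]]] := good_edge (good_swap g) nit (esym e).
  have exy : o y' x' = o y x by rewrite e /o ei et.
  have gx : good x' y' z := good_swap g'; have [xy' yz' xz'] := good_ind gx.
  have oxy : o x' y' = o x y by rewrite (o_neg (_ : ind y' x')) 1?ind_sym // exy (o_neg xy) neglK.
  rewrite -et -ei in npm ntj hij' htj etj *.
  have [->|[zj yj]] := forced_above gx ntj hij' npm; first by constructor 1.
  constructor 3; split.
    rewrite (o_neg xz) -ex -(o_neg xz'); apply: p2_cl2; apply/and3P; split=> //.
    + by rewrite inE'E zj.
    + by rewrite inE'E neq_of_ind //; case/and4P: xz' => _ _ _ ->.
  rewrite -ex => E; have [x1 [z1 [_ e2 gz _ _]]] := good_edge (good_swap (good_rot (good_rot gx))) ntj E.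
  have [_ zy' _] := good_ind gz; case/and4P: zy' => _ _ _.
  by rewrite e2 yj.
- have [y' [x' [ei et g' ey ex]]] := good_edge (good_swap g) ntj (esym e).
  have exy : o y' x' = o y x by rewrite e /o ei et.
  have gx : good x' y' z := good_swap g'; have [xy' yz' xz'] := good_ind gx.
  have oxy : o x' y' = o x y by rewrite (o_neg (_ : ind y' x')) 1?ind_sym // exy (o_neg xy) neglK.
  rewrite -et -ei in npm nit hij' hit eit *.
  have [->|[iz ix]] := forced_below gx nit hij' npm; first by constructor 1.
  constructor 4; split.
    rewrite -ey; apply: cl2_sym; apply: p2_cl2; apply/and3P; split=> //.
    + by rewrite inE'E iz.
    + have zy' : ind z y' by rewrite ind_sym.
      by rewrite inE'E neq_of_ind //; case/and4P: yz' => _ _ ->.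
  have zy : ind z y by rewrite ind_sym.
  have zy' : ind z y' by rewrite ind_sym.
  rewrite (o_neg yz) -ey -(o_neg yz') => E.
  have [z1 [y1 [e1 _ gz _ _]]] := good_edge (good_swap (good_rot gx)) nit E.
  have [_ _ zx'] := good_ind gz; case/and4P: zx' => _ _.
  by rewrite e1 ix.
Qed.

Ltac gperm := solve [match goal with g : good _ _ _ |- good _ _ _ =>
  first [exact: g | exact: good_rot g | exact: good_rot (good_rot g) | exact: good_swap g
    | exact: good_rot (good_swap g) | exact: good_rot (good_rot (good_swap g))] end].

Ltac iperm := solve [match goal with
  | h : is_true (ind ?a ?b) |- is_true (ind ?a ?b) => exact: h
  | h : is_true (ind ?a ?b) |- is_true (ind ?b ?a) => by rewrite ind_sym
  | g : good ?a ?b ?c |- is_true (ind _ _) =>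
      have [? ? ?] := good_ind g; first [assumption | rewrite ind_sym; assumption] end].

(** * Closed sets of literals and their extension by one literal *)

Definition consistent (A : lit -> Prop) := forall l, A l -> ~ A (negl l).
Definition closed2 (A : lit -> Prop) := forall a b, cl2 a b -> A (negl a) -> A b.
Definition closed3 (A : lit -> Prop) :=
  forall x y z, good x y z -> A (o x y) -> A (o y z) -> A (o x z).

Section Source.

Variables (A : lit -> Prop) (l0 : lit).
Hypotheses (Acons : consistent A) (A2 : closed2 A) (A3 : closed3 A).
Hypothesis Apure : forall p, pure p -> A p.
Hypotheses (l0A : ~ A l0) (nl0A : ~ A (negl l0)).
Hypothesis l0_out : forall b, cl2 (negl l0) b -> A b \/ b = l0.

Section Triple.

Variables x y : arrow.
Hypotheses (ixy : ind x y) (l0E : l0 = o x y).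

(* Making [x] precede [y] must also place everything before [x] ahead of everything after [y];
   [dset] collects these literals, and together with [A] they already form a closed set. *)
Definition lset u := u = x \/ (good x y u /\ A (o u x)).
Definition rset v := v = y \/ (good x y v /\ A (o y v)).
Definition dset l := exists u v, [/\ lset u, rset v & l = o u v].

Lemma nAyx : ~ A (o y x).
Proof. by rewrite (o_neg ixy) -l0E. Qed.

Lemma A_asym p q : ind p q -> A (o p q) -> ~ A (o q p).
Proof. by move=> h; rewrite (o_neg h); apply: Acons. Qed.

(** If [y] saw [u] and [v] alike, then [y] before [u] and [u] before [x] would put [o y x] into
    [A]. *)
Lemma lr_good u v : good x y u -> A (o u x) -> good x y v -> A (o y v) ->
  good x u v /\ good y u v.
Proof.
move=> gu Au gv Av; have gu' : good x u y by apply/good_rot/good_swap.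
have [[_ E]|//] := good_share gu' gv; case: nAyx.
by apply: (A3 (y := u)) => //; [apply: good_rot | rewrite E].
Qed.

Lemma lr_ind u v : lset u -> rset v -> ind u v.
Proof.
case=> [->|[gu Au]] [->|[gv Av]]; try iperm.
by have [g _] := lr_good gu Au gv Av; iperm.
Qed.

Lemma lr_nA u v : lset u -> rset v -> ~ A (o v u).
Proof.
have xv w : good x y w -> A (o y w) -> ~ A (o w x).
  by move=> gw Aw Aw'; apply: nAyx; apply: (A3 (y := w)) => //; gperm.
case=> [->|[gu Au]] [->|[gv Av]]; first exact: nAyx.
- exact: xv.
- by move=> Ayu; apply: nAyx; apply: (A3 (y := u)) => //; gperm.
- move=> Avu; apply: (xv v) => //; have [g _] := lr_good gu Au gv Av.
  by apply: (A3 (y := u)) => //; gperm.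
Qed.

(** Each use of [good_share] trades [u] for [x] or [v] for [y]. Its other alternative identifies two
    literals, which would put [o y x], or a literal along with its negation, into [A]. *)
Lemma rset_step u v r : lset u -> rset v -> good u v r -> A (o v r) -> rset r.
Proof.
have uy w s : good x y w -> good w y s -> A (o y s) -> rset s.
  move=> gw gs As; have gw' : good w x y by gperm.
  have [[_ E]|[_ g]] := good_share gw' gs; first by case: nAyx; rewrite E.
  by right; split=> //; gperm.
have ux s : good x y s -> A (o y s) -> rset s by right.
case=> [->|[gu Au]] [->|[gv Av]] g Ar; first exact: ux.
- have [[_ E]|[g1 g2]] := good_share gv g.
    by case: (A_asym (p := y) (q := v)) => //; [iperm | rewrite E].
  by apply: ux => //; apply: (A3 (y := v)) => //; gperm.
- exact: uy gu g Ar.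
- have [_ gyuv] := lr_good gu Au gv Av; have g' : good u y v by gperm.
  have [[_ E]|[g1 g2]] := good_share g' g.
    by case: (A_asym (p := y) (q := v)) => //; [iperm | rewrite E].
  by apply: uy gu g1 _; apply: (A3 (y := v)) => //; gperm.
Qed.

Lemma lset_step u v p : lset u -> rset v -> good u v p -> A (o p u) -> lset p.
Proof.
have xv w s : good x y w -> good x w s -> A (o s x) -> lset s.
  move=> gw gs As; have [[E _]|[g _]] := good_share gw gs; last by right.
  by case: nl0A; rewrite l0E E -(o_neg (_ : ind x s)) //; iperm.
have ux s : good x y s -> A (o s x) -> lset s by right.
case=> [->|[gu Au]] [->|[gv Av]] g Ap; first exact: ux.
- exact: xv gv g Ap.
- have g1 : good u x y by gperm.
  have [[E _]|[g2 g3]] := good_share g1 g.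
    by case: (A_asym (p := u) (q := p)) => //; [iperm | rewrite -E].
  by apply: ux; [gperm | apply: (A3 (y := u)) => //; gperm].
- have [gxuv _] := lr_good gu Au gv Av; have g' : good u x v by gperm.
  have [[E _]|[g1 g2]] := good_share g' g.
    by case: (A_asym (p := u) (q := p)) => //; [iperm | rewrite -E].
  by apply: (xv v) => //; [gperm | apply: (A3 (y := u)) => //; gperm].
Qed.

Lemma nind v : ~ ind v v.
Proof. by case/and4P; rewrite /ch => ->. Qed.

(** Serves twice: with [r] in [lset] it shows that [dset] contains no complementary pair, and it
    excludes 3-clauses with both premises in [dset]. *)
Lemma dset_tail v r : rset v -> ind v r -> o v r <> o x y -> ~ dset (o v r).
Proof.
move=> Rv ivr nE [u' [v' [Lu' Rv' E]]].
have ux w : good u' w x -> o v r = o u' w -> A (o u' x) -> False.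
  move=> g E' Au; have [_ E1 _] := good_class g ivr E'.
  by case: (lr_nA (u := x) (v := v)) => //; [left | rewrite E1].
case: Lu' E => [->|[gu Au]]; case: Rv' => [->|[gv Av]] E //; last first.
- by apply: (ux v') => //; have [g _] := lr_good gu Au gv Av; gperm.
- by apply: (ux y) => //; gperm.
have g : good x v' y by gperm.
have [g1 E1 _] := good_class g ivr E.
case: Rv g1 E1 => [-> g1 _|[gv2 Av2] _ E1]; first by case: (good_ind g1) => _ _ /nind.
by case: nl0A; rewrite l0E -E1 -(o_neg (_ : ind v y)) //; iperm.
Qed.

Lemma dset_asym u v : lset u -> rset v -> ~ dset (o v u).
Proof.
move=> Lu Rv; have iuv := lr_ind Lu Rv; apply: dset_tail => //; first by iperm.
have ivu : ind v u by iperm.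
have third w : good x y w -> o v u = o x y -> w = u \/ w = v -> False.
  move=> g E e; have [g' _ _] := good_class g ivu E.
  by case: e g' => -> /good_ind [_ h1 h2]; [move/nind: h1 | move/nind: h2].
case: Lu => [eu|[gu Au]] E; last by apply: (third u) => //; left.
case: Rv => [ev|[gv Av]]; last by apply: (third v) => //; right.
by move: E; rewrite eu ev (o_neg ixy) => /negl_neq.
Qed.

(** The set is [A] together with [dset]. A 2-clause fired by [o u v] is traced by [cl2_good] to one
    fired by a literal of [A], or with [u] replaced by [x] or [v] by [y], and in the end to [l0],
    where [l0_out] applies. *)
Lemma dset_extend : exists A' : lit -> Prop,
  [/\ forall l, A l -> A' l, A' l0, consistent A', closed2 A' & closed3 A'].
Proof.
have Lx : lset x by left.
have Ry : rset y by left.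
have D0 : dset l0 by exists x, y.
have Dn l : dset l -> exists u v, [/\ lset u, rset v, l = o u v & negl l = o v u].
  by move=> [u [v [Lu Rv ->]]]; exists u, v; split=> //; rewrite (o_neg (lr_ind Lu Rv)).
exists (fun l => A l \/ dset l); split; try by [left|right].
- move=> l [Al|Dl] [Al'|Dl'].
  + exact: Acons Al Al'.
  + by have [u [v [Lu Rv _]]] := Dn _ Dl'; rewrite neglK => E; apply: (lr_nA Lu Rv); rewrite -E.
  + by have [u [v [Lu Rv _ E]]] := Dn _ Dl; apply: (lr_nA Lu Rv); rewrite -E.
  + by have [u [v [Lu Rv _ E]]] := Dn _ Dl; apply: (dset_asym Lu Rv); rewrite -E.
- move=> a b hc [Al|Dl]; first by left; apply: A2 hc Al.
  have [u [v [Lu Rv E1]]] := Dn _ Dl; rewrite neglK => E; rewrite E {Dl E1} in hc.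
  have c0 b' : cl2 (o y x) b' -> A b' \/ dset b'.
    by rewrite (o_neg ixy) -l0E => /l0_out [|->]; [left|right].
  have cA b' p q : ind p q -> A (o q p) -> cl2 (o p q) b' -> A b' \/ dset b'.
    by move=> i' Aqp h; left; apply: (A2 h); rewrite -(o_neg i').
  have cxv w b' : good x y w -> A (o y w) -> cl2 (o w x) b' -> A b' \/ dset b'.
    move=> g Aw h; have g' : good x w y by gperm.
    have [->|/Apure|[/c0]|[]] := cl2_good g' h; try by [left|].
      by right; exists x, w; split=> //; right.
    by move=> h' _; apply: cA h' => //; iperm.
  case: (Lu) (Rv) hc => [->|[gu Au]] [->|[gv Av]] hc; first exact: c0.
  + exact: cxv hc.
  + have g' : good u y x by gperm.
    have [->|/Apure|[h _]|[/c0]] := cl2_good g' hc; try by [left|].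
      by right; exists u, y.
    by apply: cA h => //; iperm.
  + have [gx gy] := lr_good gu Au gv Av; have g' : good u v x by gperm.
    have [->|/Apure|[h _]|[/cxv h _]] := cl2_good g' hc; try by [left|apply: h].
      by right; exists u, v.
    by apply: cA h => //; iperm.
- move=> p q r g [Apq|[u [v [Lu Rv E]]]] [Aqr|[u' [v' [Lu' Rv' E']]]].
  + by left; apply: A3 g Apq Aqr.
  + have g1 : good q r p by gperm.
    have [g2 e1 e2] := good_class g1 (lr_ind Lu' Rv') (esym E').
    right; exists p, v'; split=> //; last first.
      have [i1 i2] : ind v' p /\ ind r p by split; iperm.
      by rewrite (o_neg i1) (o_neg i2) e2.
    apply: (lset_step Lu' Rv') => //.
    have [i1 i2] : ind u' p /\ ind q p by split; iperm.
    by rewrite (o_neg i1) e1 -(o_neg i2).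
  + have [g2 e1 e2] := good_class g (lr_ind Lu Rv) (esym E).
    right; exists u, r; split=> //.
    by apply: (rset_step Lu Rv) => //; rewrite e2.
  + have [g2 e1 e2] := good_class g (lr_ind Lu Rv) (esym E).
    have ivr : ind v r by iperm.
    have iur : ind u r by iperm.
    case: (@dset_tail v r Rv ivr); last by rewrite e2; exists u', v'.
    have third w : good x y w -> o v r = o x y -> w = v -> False.
      move=> g0 E0 e; have [g' _ _] := good_class g0 ivr E0.
      by move: g'; rewrite e => /good_ind [_ _ /nind].
    case: (Rv) => [ev|[gv Av]] E0; last by apply: (third v).
    rewrite ev in E0 g2 ivr.
    case: (Lu) => [eu|[gu Au]].
      rewrite eu in g2; have [g' _ _] := good_class g2 ivr E0.
      by case: (good_ind g') => _ /nind.
    have [_ E3 _] := good_class gu ivr E0.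
    by case: gu => _ _ _ h3; apply: h3; rewrite E3.
Qed.

End Triple.

(** A literal that belongs to no good triple occurs in no 3-clause and can be added alone. *)
Lemma source_extend : exists A' : lit -> Prop,
  [/\ forall l, A l -> A' l, A' l0, consistent A', closed2 A' & closed3 A'].
Proof.
have [[x [y [z [g E]]]]|nt] := classic (exists x y z, good x y z /\ l0 = o x y).
  by apply: (@dset_extend x y) => //; iperm.
exists (fun l => A l \/ l = l0); split; try by [left|right].
- move=> l [Al|->] [Al'|E] //.
  + exact: Acons Al Al'.
  + by apply: nl0A; rewrite -E neglK.
  + by case: (negl_neq E).
- move=> a b hc [Al|E]; first by left; apply: A2 hc Al.
  by apply: l0_out; rewrite -E neglK.
- move=> x y z g [A1|E]; last by case: nt; exists x, y, z.
  case=> [A2'|E]; last by case: nt; exists y, z, x; split=> //; gperm.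
  by left; apply: A3 g A1 A2'.
Qed.

End Source.

Lemma unit_extend (A M : lit -> Prop) l0 :
  consistent A -> closed2 A -> closed3 A -> (forall p, pure p -> A p) ->
  consistent M -> closed2 M -> M l0 -> ~ A (negl l0) ->
  exists A' : lit -> Prop,
  [/\ forall l, A l -> A' l, A' l0, consistent A', closed2 A' & closed3 A'].
Proof.
move=> Ac A2 A3 Ap Mc M2 M0 nA0.
have [Al0|nAl0] := classic (A l0); first by exists A.
pose B l := forall S : lit -> Prop, S l0 -> closed2 S -> S l.
have B0 : B l0 by move=> S.
have B2 : closed2 B by move=> a b h Ba S S0 S2; apply: (S2 a b h); apply: Ba.
have BM l : B l -> M l by move=> h; exact: (h M).
(* The inequality rules out deriving a literal from itself. [l0] is then the only member of [B] that
   may lack a derivation. *)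
pose der l := exists a, [/\ B (negl a), cl2 a l & negl a <> l].
have Bder l : B l -> l = l0 \/ B l /\ der l.
  move=> Bl; apply: (Bl (fun l => l = l0 \/ B l /\ der l)); first by left.
  move=> a b h hS; have Ba : B (negl a) by case: hS => [->|[]].
  have Bb := B2 _ _ h Ba.
  have [<-|ne] := classic (negl a = b); first by case: hS => [|[]]; [left|right].
  by right; split=> //; exists a.
have derB l : der l -> B l by move=> [a [Ba h _]]; apply: B2 h Ba.
(* By contraposition, the negation of a consequence would pull [negl l0] into [A]. *)
have BA l : B l -> ~ A (negl l).
  move=> Bl; apply: (Bl (fun l => ~ A (negl l))) => // a b h nAa Ab; apply: nAa; rewrite neglK.
  exact: A2 (cl2_sym h) Ab.
pose S1 l := A l \/ B l.
have S1c : consistent S1.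
  move=> l [h|h] [h'|h'].
  - exact: Ac h h'.
  - by apply: (BA _ h'); rewrite neglK.
  - exact: BA h h'.
  - exact: Mc (BM _ h) (BM _ h').
have S12 : closed2 S1 by move=> a b h [h'|h']; [left; apply: A2 h h'|right; apply: B2 h h'].
have oS x y z : good x y z -> S1 (o x y) -> ~ S1 (o y x).
  by move=> g; rewrite (o_neg (_ : ind x y)); [apply: S1c | iperm].
(* [cl2_good] transfers the last step of the derivation to [o x z]; the transfer to [o z y] would
   contradict [o y z]. *)
have der_l x y z : good x y z -> der (o x y) -> S1 (o y z) -> der (o x z).
  move=> g [a [Ba h ne]] Syz.
  have iyx : ind y x by iperm.
  have Sa : S1 (negl a) by right.
  have [e|pa|[h' _]|[h' ne']] := cl2_good (good_swap g) (cl2_sym h).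
  - by case: ne; rewrite e -o_neg.
  - by case: (S1c a) => //; left; apply: Ap.
  - have gyz : good y z x by gperm.
    by case: (oS _ _ _ gyz Syz); apply: S12 (cl2_sym h') Sa.
  - exists a; split=> //; first exact: cl2_sym.
    move=> E; apply: ne'; apply: negl_inj; rewrite E; apply: o_neg; iperm.
have der_r x y z : good x y z -> S1 (o x y) -> der (o y z) -> der (o x z).
  move=> g Sxy [a [Ba h ne]].
  have iyz : ind y z by iperm.
  have Sa : S1 (negl a) by right.
  have g' : good z y x by gperm.
  have [e|pa|[h' ne']|[h' _]] := cl2_good g' (cl2_sym h).
  - by case: ne; rewrite e (o_neg iyz) neglK.
  - by case: (S1c a) => //; left; apply: Ap.
  - exists a; split=> //; first exact: cl2_sym.
    move=> E; apply: ne'; apply: negl_inj; rewrite E; apply: o_neg; iperm.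
  - by case: (oS _ _ _ g Sxy); apply: S12 (cl2_sym h') Sa.
have S13 x y z : good x y z -> A (o x y) \/ der (o x y) -> A (o y z) \/ der (o y z) ->
    A (o x z) \/ der (o x z).
  move=> g [h|h] [h'|h'].
  - by left; apply: A3 g h h'.
  - by right; apply: der_r g _ h'; left.
  - by right; apply: der_l g h _; left.
  - by right; apply: der_l g h _; right; apply: derB.
have [d0|nd0] := classic (der l0).
  exists S1; split=> //; try by [left|right].
  have red l : S1 l -> A l \/ der l.
    by case=> [|/Bder [->|[]]]; [left|right|right].
  move=> x y z g /red h1 /red h2.
  by case: (S13 _ _ _ g h1 h2) => [|/derB]; [left|right].
have bS1 l : A l \/ der l -> S1 l by case=> [|/derB]; [left|right].
(* Here [l0] has no derivation. The set formed by [A] and [der] is closed, and [l0] is a source over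
   it. *)
have [A' [AA' A'0 c c2 c3]] : exists A' : lit -> Prop,
    [/\ forall l, A l \/ der l -> A' l, A' l0, consistent A', closed2 A' & closed3 A'].
  apply: source_extend => //.
  - by move=> l /bS1 h /bS1; apply: S1c.
  - move=> a b h [ha|[a' [Ba h' ne]]]; first by left; apply: A2 h ha.
    have Bb : B (negl a) := B2 _ _ h' Ba.
    have [E|ne'] := classic (negl a = b); last by right; exists a.
    by right; rewrite -E; exists a'.
  - by move=> p pp; left; apply: Ap.
  - by case=> // /derB/BM; apply: Mc.
  - move=> b h; have [E|ne'] := classic (l0 = b); first by right.
    by left; right; exists (negl l0); rewrite neglK.
by exists A'; split=> // l Al; apply: AA'; left.
Qed.

(** * The clauses of $\phi_1$ and $\phi_2$ in terms of chains *)

Lemma ell_nc i j k l : ell i j <> negl (ell k l) -> ~~ xconf k l i j.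
Proof. by move=> h; apply/negP => /ell_xconf. Qed.

(** Edges in conflict have complementary literals, so each converse comparability would violate one
    of the three inequalities. *)
Lemma six_good (a b c : arrow) : ch a -> ch b -> ch c ->
  ~~ lt a.1 b.2 -> ~~ lt b.1 c.2 -> ~~ lt c.1 a.2 ->
  o a b <> negl (o b c) -> o b c <> negl (o c a) -> o a b <> negl (o c a) -> good a b c.
Proof.
move=> ca cb cc n1 n2 n3 h1 h2 h3.
have nba : ~~ lt b.1 a.2 by apply: contra (ell_nc h2) => h; apply/and4P.
have ncb : ~~ lt c.1 b.2.
  have h3' : o c a <> negl (o a b) by move=> E; apply: h3; rewrite E neglK.
  by apply: contra (ell_nc h3') => h; apply/and4P.
have nac : ~~ lt a.1 c.2 by apply: contra (ell_nc h1) => h; apply/and4P.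
have [ab bc ac] : [/\ ind a b, ind b c & ind a c] by split; apply/and4P.
have [cb' ca'] : ind c b /\ ind c a by split; iperm.
split=> //; first by rewrite (o_neg bc).
  by rewrite (o_neg ca').
by rewrite (o_neg ca') => E; apply: h2; rewrite E.
Qed.

Lemma edge_is_ug e i j : edge_is lt e (inl i) (inr j) -> ~~ lt i j /\ e = ug i j.
Proof. by case/andP=> /= h /eqP ->. Qed.

Lemma edge_is_gu e i j : edge_is lt e (inr j) (inl i) -> ~~ lt i j /\ e = ug i j.
Proof. by case/andP=> /= h /eqP ->; rewrite /ug setUC. Qed.

Lemma edge_is_ll e i j : edge_is lt e (inl i) (inl j) = false.
Proof. by []. Qed.

Lemma nonadj_lr i j : nonadj lt (inl i) (inr j) = lt i j.
Proof. by rewrite /nonadj /= negbK. Qed.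

Lemma nonadj_rl i j : nonadj lt (inr j) (inl i) = lt i j.
Proof. by rewrite /nonadj /= negbK. Qed.

Lemma nonadj_rr i j : nonadj lt (inr i) (inr j) = false.
Proof. by rewrite /nonadj /= negbK (inj_eq inr_inj); case: eqP. Qed.

Lemma phi1_good s : phi1_clause lt chi0 comp s ->
  exists x y z, good x y z /\ s =i [:: o x y; o y z; o z x].
Proof.
have core a b c (s' : seq lit) : ch a -> ch b -> ch c ->
  ~~ lt a.1 b.2 -> ~~ lt b.1 c.2 -> ~~ lt c.1 a.2 ->
  o a b != negl (o b c) -> o b c != negl (o c a) -> o a b != negl (o c a) ->
  s' =i [:: o a b; o b c; o c a] \/ s' =i [:: negl (o a b); negl (o b c); negl (o c a)] ->
  exists x y z, good x y z /\ s' =i [:: o x y; o y z; o z x].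
  move=> ca cb cc n1 n2 n3 /eqP h1 /eqP h2 /eqP h3 hs.
  have g := six_good ca cb cc n1 n2 n3 h1 h2 h3.
  case: hs => hs; first by exists a, b, c.
  exists b, a, c; split; first by gperm.
  move=> l; rewrite hs -!o_neg; try iperm.
  by rewrite !inE; case: eqP => //= _; rewrite orbC.
have neqC (k l : lit) : k != negl l -> l != negl k.
  by apply: contra => /eqP ->; rewrite neglK.
case=> e [e' [e'' [w1 [w2 [w3 [w4 [w5 [w6]]]]]]]] [[E1 E2 E3] [[N1 N2 N3] [[L1 L2 L3] hs]]].
move: E1 E2 E3 N1 N2 N3.
(* As for conflicts, each edge has at least one end in $V$ and each non-adjacent pair at most one,
   so only the two alternating sextuples survive. They traverse the chains in opposite
   directions. *)
case: w1 w2 w3 w4 w5 w6 => [i1|i1] [i2|i2] [i3|i3] [i4|i4] [i5|i5] [i6|i6];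
  rewrite ?edge_is_ll ?nonadj_lr ?nonadj_rl ?nonadj_rr //.
- move=> /edge_is_gu [n1 E1] /edge_is_gu [n2 E2] /edge_is_gu [n3 E3] l1 l2 l3.
  move: L1 L2 L3 hs; rewrite E1 E2 E3 -!/(ell _ _) => L1 L2 L3 hs.
  apply: (@core (i3, i4) (i1, i2) (i5, i6)) => //=; try exact: neqC.
  case: hs => ->; [left|right] => l; rewrite !inE /=; case: eqP => //= _; exact: orbC.
- move=> /edge_is_ug [n1 E1] /edge_is_ug [n2 E2] /edge_is_ug [n3 E3] l1 l2 l3.
  move: L1 L2 L3 hs; rewrite E1 E2 E3 -!/(ell _ _) => L1 L2 L3 hs.
  by apply: (@core (i2, i1) (i4, i3) (i6, i5)) => //=; case: hs => ->; [left|right].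
Qed.

Lemma good_phi1 x y z : good x y z -> exists2 s, phi1_clause lt chi0 comp s &
  s =i [:: o x y; o y z; o z x].
Proof.
move=> g; have [xy yz xz] := good_ind g; have zx : ind z x by iperm.
exists [:: o x y; o y z; o z x] => //.
case/and4P: (xy) => cx cy n1 _; case/and4P: (yz) => _ cz n2 _; case/and4P: (zx) => _ _ n3 _.
exists (ug x.1 y.2), (ug y.1 z.2), (ug z.1 x.2), (inr x.2), (inl x.1), (inr y.2), (inl y.1),
  (inr z.2), (inl z.1).
split; first by split; rewrite /edge_is /= ?n1 ?n2 ?n3 eqxx.
split; first by split; rewrite nonadj_rl.
split; last by left.
case: (g) => _ h1 h2 h3; split; apply/eqP; rewrite -!/(ell _ _) -!/(o _ _) -?o_neg //; try iperm.
by move=> E; apply: h3; rewrite E.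
Qed.

(** Otherwise [good_class] would make [y], [z] and again [z] a good triple. With rotations, this
    shows that a 3-clause has three distinct literals. *)
Lemma good_neq x y z : good x y z -> o x y <> o y z.
Proof.
move=> g E; have yz : ind y z by iperm.
by have [/good_ind [_ /nind]] := good_class g yz (esym E).
Qed.

Variable f : seq (seq lit).
Hypothesis frep : represents lt chi0 comp f.

Lemma clause_cases c : c \in f ->
  (exists x y z, good x y z /\ c =i [:: o x y; o y z; o z x]) \/
  (exists i t j, p2 i t j /\ c =i [:: ell i t; ell t j]).
Proof.
case/frep.1=> s [[/phi1_good [x [y [z [g e]]]]|[i [j [t [h1 h2 h3 ->]]]]] cs].
  by left; exists x, y, z; split=> // l; rewrite cs e.
by right; exists i, t, j; split; [rewrite /p2 h1 h2 h3|].
Qed.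

Lemma good_clause x y z : good x y z -> exists2 c, c \in f & c =i [:: o x y; o y z; o z x].
Proof.
case/good_phi1=> s hs e; have [c cf cs] := frep.2 s (or_introl hs).
by exists c => // l; rewrite cs e.
Qed.

Lemma p2_clause i t j : p2 i t j -> exists2 c, c \in f & c =i [:: ell i t; ell t j].
Proof.
case/and3P=> h1 h2 h3; apply: frep.2; right; exists i, j, t; split=> //.
Qed.

End Poset.

(* The premise on [k] exempts clauses with a single literal, which only act once it is false;
   a falsified clause forces every literal, hence contradicts consistency. *)
Definition up_closed (f : seq (seq lit)) (A : lit -> Prop) := forall c l, c \in f ->
  (exists2 k, k \in c & A (negl k)) -> (forall k, k \in c -> k <> l -> A (negl k)) -> A l.

(** * Closure under unit propagation matches closure in terms of chains *)

Section Extension.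

Variables (n : nat) (lt : rel 'I_n).
Hypothesis lt_tr : transitive lt.
Variables (chi0 : {set W n} -> bool) (comp : {set W n} -> nat).
Hypothesis chi0P : forall e e', is_edge lt e -> is_edge lt e' ->
  conflict lt e e' -> chi0 e != chi0 e'.
Hypothesis compP : forall e e', is_edge lt e -> is_edge lt e' ->
  (comp e == comp e') = connect (conflict lt) e e'.
Variable f : seq (seq lit).
Hypothesis frep : represents lt chi0 comp f.

Local Notation closed2' := (closed2 lt chi0 comp).
Local Notation closed3' := (closed3 lt chi0 comp).

Lemma up_closed_closed A : consistent A -> up_closed f A -> closed2' A /\ closed3' A.
Proof.
move=> Ac Au; split.
  move=> a b [i [t [j [h e]]]] Aa.
  have [c cf hc] := p2_clause frep h.
  have hc' : c =i [:: a; b].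
    by move=> l; rewrite hc !inE; case: e => [] [-> ->] //; rewrite orbC.
  apply: (Au c b cf); first by exists a; rewrite // hc' mem_head.
  by move=> k; rewrite hc' !inE => /orP [] /eqP -> //.
move=> x y z g Axy Ayz.
have [xy yz xz] := good_ind g.
have [c cf hc] := good_clause chi0P compP frep (good_swap chi0P compP g).
have yx : ind lt y x by rewrite ind_sym.
have zy : ind lt z y by rewrite ind_sym.
apply: (Au c _ cf).
  by exists (o chi0 comp y x); rewrite ?hc ?mem_head // -(o_neg chi0P compP).
move=> k; rewrite hc !inE => /or3P [] /eqP -> // _; rewrite -(o_neg chi0P compP) //.
Qed.

Lemma closed_up_closed A : consistent A -> closed2' A -> closed3' A -> up_closed f A.
Proof.
move=> Ac A2 A3 c l cf [k kc Ak] hA.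
case: (clause_cases chi0P compP frep cf) => [[x [y [z [g hc]]]]|[i [t [j [h hc]]]]].
  have T a b d : good lt chi0 comp a b d -> k = o chi0 comp a b ->
      (forall m, m = o chi0 comp b d \/ m = o chi0 comp d a -> m <> l -> A (negl m)) -> A l.
    move=> g0 e hm; have [ab bd ad] := good_ind g0.
    have [ba db da] : [/\ ind lt b a, ind lt d b & ind lt d a] by split; rewrite ind_sym.
    have oN := o_neg chi0P compP.
    have g1 : good lt chi0 comp d b a by apply/(good_swap chi0P compP)/(good_rot chi0P compP).
    have g2 : good lt chi0 comp b a d by apply: (good_swap chi0P compP).
    have Aba : A (o chi0 comp b a) by rewrite (oN _ _ ab) -e.
    have [el|nl1] := classic (o chi0 comp b d = l).
      rewrite -el; apply: (A3 _ _ _ g2) => //; rewrite (oN _ _ da); apply: hm; first by right.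
      rewrite -el => E; apply: (good_neq chi0P compP (good_rot chi0P compP g0)).
      by rewrite E.
    have Adb : A (o chi0 comp d b) by rewrite (oN _ _ bd); apply: hm => //; left.
    have Ada : A (o chi0 comp d a) := A3 _ _ _ g1 Adb Aba.
    have [<- //|nl2] := classic (o chi0 comp d a = l).
    by case: (Ac _ Ada); apply: hm => //; right.
  have in1 : o chi0 comp x y \in c by rewrite hc mem_head.
  have in2 : o chi0 comp y z \in c by rewrite hc !inE eqxx orbT.
  have in3 : o chi0 comp z x \in c by rewrite hc !inE eqxx !orbT.
  move: (kc); rewrite hc !inE => /or3P [] /eqP ek.
  - by apply: (T x y z) => // m [] ->; apply: hA.
  - by apply: (T y z x) => //; [apply: good_rot|move=> m [] ->; apply: hA].
  - by apply: (T z x y) => //; [do 2!apply: good_rot => //|move=> m [] ->; apply: hA].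
have T a b : cl2 lt chi0 comp a b -> a = k -> b \in c -> A l.
  move=> hab e bc; have Ab : A b by apply: (A2 _ _ hab); rewrite e.
  by have [<- //|ne] := classic (b = l); case: (Ac _ Ab); apply: hA.
have ha : ell chi0 comp i t \in c by rewrite hc mem_head.
have hb : ell chi0 comp t j \in c by rewrite hc !inE eqxx orbT.
have hab := p2_cl2 chi0 comp h.
move: (kc); rewrite hc !inE => /orP [] /eqP ek; first exact: (T _ _ hab).
exact: (T _ _ (cl2_sym hab)).
Qed.

Lemma pure_nocc p c : pure lt chi0 comp p -> c \in f -> negl p \notin c.
Proof.
move=> pp cf; apply/negP => pc.
case: (clause_cases chi0P compP frep cf) => [[x [y [z [g hc]]]]|[i [t [j [/and3P [_ h1 h2] hc]]]]].
  have no x' y' : ind lt x' y' -> negl p <> o chi0 comp x' y'.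
    by case/and4P=> _ _ h _ /esym; apply: (pure_neg chi0P compP pp h).
  have [xy yz xz] := good_ind g; have zx : ind lt z x by rewrite ind_sym.
  by move: pc; rewrite hc !inE => /or3P [] /eqP; apply: no.
case/andP: h1 h2 => h1 _ /andP [h2 _].
by move: pc; rewrite hc !inE => /orP [] /eqP /esym; apply: (pure_neg chi0P compP pp).
Qed.

(** [unit_extend] requires the pure literals to be present. Adding them is harmless: their negations
    occur in no clause, whereas the literals of [A] and [l0] do occur. *)
Lemma up_closed_extend A a l0 : consistent A -> up_closed f A ->
  (forall l, A l -> exists2 c, c \in f & l \in c) -> (exists2 c, c \in f & l0 \in c) ->
  ~ A (negl l0) -> sat f a -> a l0.1 = l0.2 ->
  exists A' : lit -> Prop, [/\ forall l, A l -> A' l, A' l0, consistent A' & up_closed f A'].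
Proof.
move=> Ac Au Aocc [c0 c0f l0c] nA0 sa al0.
have [A2 A3] := up_closed_closed Ac Au.
have oN := o_neg chi0P compP.
have Apn l : A l -> ~ pure lt chi0 comp (negl l).
  by move=> /Aocc [c cf lc] /pure_nocc /(_ cf); rewrite neglK lc.
pose A1 l := A l \/ pure lt chi0 comp l.
have [] := @unit_extend _ _ lt_tr chi0 comp chi0P compP A1 (fun l => a l.1 = l.2) l0.
- move=> l [Al|pl] [Al'|pl'].
  + exact: Ac Al Al'.
  + exact: Apn Al pl'.
  + by apply: (Apn _ Al'); rewrite neglK.
  + by case: pl' => i [j [nij E _]]; apply: (pure_neg chi0P compP pl nij).
- move=> p q h [Ap|pp]; first by left; apply: A2 h Ap.
  case: h => i [t [j [/and3P [_ /andP [h1 _] /andP [h2 _]]]]] [] [E1 E2].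
    by case: (pure_neg chi0P compP pp h1); rewrite neglK E1.
  by case: (pure_neg chi0P compP pp h2); rewrite neglK E2.
- have np x y : ind lt x y -> ~ pure lt chi0 comp (o chi0 comp x y).
    move=> xy pp; case/and4P: (xy) => _ _ _ h.
    by apply: (pure_neg chi0P compP pp h); rewrite -(oN _ _ xy).
  move=> x y z g; have [xy yz xz] := good_ind g.
  case=> [Axy|/np //]; case=> [Ayz|/np //].
  by left; apply: A3 g Axy Ayz.
- by right.
- move=> l /= ->; case: (l.2) => //.
- move=> p q [i [t [j [h e]]]]; have [c cf hc] := p2_clause frep h.
  have hc' : c =i [:: p; q].
    by move=> l; rewrite hc !inE; case: e => [] [-> ->] //; rewrite orbC.
  case/hasP: (allP sa c cf) => l; rewrite hc' !inE => /orP [] /eqP -> /eqP //= ->.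
  by case: (p.2).
- by [].
- case=> [//|/pure_nocc /(_ c0f)]; by rewrite neglK l0c.
move=> A' [AA' A'0 Ac' A2' A3']; exists A'; split=> //.
  by move=> l Al; apply: AA'; left.
exact: closed_up_closed.
Qed.

End Extension.

(** * Execution of RAM code, and a structured language above it *)

Section Steps.

Variables (p : seq instr) (inp : seq nat).

Fixpoint nsteps k (s : state) : option state :=
  if k is k'.+1 then obind (nsteps k') (step p inp s) else Some s.

Lemma nsteps_add k1 k2 s s1 s2 :
  nsteps k1 s = Some s1 -> nsteps k2 s1 = Some s2 -> nsteps (k1 + k2) s = Some s2.
Proof.
elim: k1 s => [|k IH] s /=; first by case=> ->.
by case: (step p inp s) => //= s' h1 h2; apply: IH h1 h2.
Qed.

Lemma run_nsteps k t s s' : nsteps k s = Some s' -> step p inp s' = None -> k <= t ->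
  run p inp t s = Some s'.2.
Proof.
elim: k t s => [|k IH] t s /=; first by case: t => [|t] /= [->] ->.
case E: (step p inp s) => [s1|] //= h1 h2; case: t => // t; rewrite ltnS => le /=.
by rewrite E; apply: IH.
Qed.

Definition code_at pc (c : seq instr) :=
  forall i, i < size c -> nth IHalt p (pc + i) = nth IHalt c i.

Lemma code_at_cat pc c1 c2 :
  code_at pc (c1 ++ c2) -> code_at pc c1 /\ code_at (pc + size c1) c2.
Proof.
move=> h; split=> i hi.
  by rewrite h ?size_cat ?ltn_addr // nth_cat hi.
by rewrite -addnA h ?size_cat ?ltn_add2l // nth_cat ltnNge leq_addr /= addKn.
Qed.

Lemma code_at_cons pc i c :
  code_at pc (i :: c) -> nth IHalt p pc = i /\ code_at pc.+1 c.
Proof.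
move=> h; split; first by rewrite -[pc]addn0 h.
by move=> j hj; rewrite addSnnS h.
Qed.

End Steps.

(* Programs over registers, arrays (a field number and an index) and a bank of output cells;
   [tm] is a ghost clock. *)
Record st := St { rg : nat -> nat; ar : nat -> nat -> nat; ou : nat -> nat; tm : nat }.

Definition aupd (A : nat -> nat -> nat) f i v : nat -> nat -> nat :=
  fun f' i' => if (f' == f) && (i' == i) then v else A f' i'.

(** The charge 10 covers every compiled primitive (8 instructions for an array access) and every
    test together with its closing jump (3 instructions). *)
Definition setr d v s := St (upd (rg s) d v) (ar s) (ou s) (tm s + 10).
Definition seta f i v s := St (rg s) (aupd (ar s) f i v) (ou s) (tm s + 10).
Definition seto a v s := St (rg s) (ar s) (upd (ou s) a v) (tm s + 10).
Definition tick s := St (rg s) (ar s) (ou s) (tm s + 10).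

Inductive cmd :=
| Set_ (d c : nat) | Add (d a b : nat) | Sub (d a b : nat) | Inp (d a : nat)
| Get (d f a : nat) | Put (f a v : nat) | Out (a v : nat)
| Seq (c1 c2 : cmd) | Ifz (a : nat) (c1 c2 : cmd) | While (a : nat) (c : cmd).

(** * Weakest preconditions and the correctness of the compiler *)

Section Compile.

Variables (R : nat) (inp : seq nat) (D : nat).

(** Registers 0 to 2 are reserved for address computations and jumps. *)
Definition okr r := (2 < r) && (r < R).

(** With [arr] false, array and output commands are barred: this is the phase that still has to
    compute [D]. The bound 16 on fields is the stride of the interleaved arrays. *)
Fixpoint wf (arr : bool) c := match c with
| Set_ d _ => okr d
| Add d a b | Sub d a b => [&& okr d, okr a & okr b]
| Inp d a => okr d && okr a
| Get d f a => [&& arr, okr d, okr a & f < 16]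
| Put f a v => [&& arr, okr a, okr v & f < 16]
| Out a v => [&& arr, okr a & okr v]
| Seq c1 c2 => wf arr c1 && wf arr c2
| Ifz a c1 c2 => [&& okr a, wf arr c1 & wf arr c2]
| While a c => okr a && wf arr c
end.

(* Weakest precondition; a loop takes the impredicative least fixed point. *)
Fixpoint wp c (Q : st -> Prop) (s : st) : Prop := match c with
| Set_ d k => Q (setr d k s)
| Add d a b => Q (setr d (rg s a + rg s b) s)
| Sub d a b => Q (setr d (rg s a - rg s b) s)
| Inp d a => Q (setr d (nth 0 inp (rg s a)) s)
| Get d f a => Q (setr d (ar s f (rg s a)) s)
| Put f a v => Q (seta f (rg s a) (rg s v) s)
| Out a v => R <= rg s a < D /\ Q (seto (rg s a) (rg s v) s)
| Seq c1 c2 => wp c1 (wp c2 Q) s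
| Ifz a c1 c2 => if rg s a == 0 then wp c1 Q (tick s) else wp c2 Q (tick s)
| While a c => forall I : st -> Prop,
    (forall s', (if rg s' a == 0 then Q (tick s') else wp c I (tick s')) -> I s') -> I s
end.

Lemma wp_mono c (P Q : st -> Prop) s : (forall s', P s' -> Q s') -> wp c P s -> wp c Q s.
Proof.
elim: c P Q s => //=; try by move=> *; auto.
- by move=> a v P Q s h [hr hP]; split; auto.
- by move=> c1 IH1 c2 IH2 P Q s h; apply: IH1 => s'; apply: IH2.
- by move=> a c1 IH1 c2 IH2 P Q s h; case: eqP => _; [apply: IH1|apply: IH2].
- move=> a c IH P Q s h H I hI; apply: H => s' hs; apply: hI.
  by case: eqP hs => _ // /h.
Qed.

Fixpoint mods c := match c with
| Set_ d _ | Add d _ _ | Sub d _ _ | Inp d _ | Get d _ _ => [:: d]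
| Put _ _ _ | Out _ _ => [::]
| Seq c1 c2 | Ifz _ c1 c2 => mods c1 ++ mods c2
| While _ c => mods c
end.

Fixpoint fmods c := match c with
| Put f _ _ => [:: f]
| Seq c1 c2 | Ifz _ c1 c2 => fmods c1 ++ fmods c2
| While _ c => fmods c
| _ => [::]
end.

Definition frame (rs fs : seq nat) s s' :=
  (forall r, r \notin rs -> rg s' r = rg s r) /\ (forall f, f \notin fs -> ar s' f =1 ar s f).

Lemma frame_trans rs fs s1 s2 s3 : frame rs fs s1 s2 -> frame rs fs s2 s3 -> frame rs fs s1 s3.
Proof. by move=> [h1 k1] [h2 k2]; split=> [r h|f h i]; rewrite ?h2 ?k2 ?h1 ?k1. Qed.

Lemma frame_sub rs fs rs' fs' s1 s2 : {subset rs <= rs'} -> {subset fs <= fs'} ->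
  frame rs fs s1 s2 -> frame rs' fs' s1 s2.
Proof.
by move=> hr hf [h k]; split=> [r h'|f h' i]; [apply: h; apply: contra h'; apply: hr|apply: k; apply: contra h'; apply: hf].
Qed.

Lemma wp_frame c Q s :
  wp c (fun s' => frame (mods c) (fmods c) s s' -> Q s') s -> wp c Q s.
Proof.
have fr d v s' : frame [:: d] [::] s' (setr d v s').
  by split=> // r; rewrite inE /= /upd => /negbTE ->.
have cl c1 c2 s1 s2 : frame (mods c1) (fmods c1) s1 s2 ->
    frame (mods c1 ++ mods c2) (fmods c1 ++ fmods c2) s1 s2.
  by apply: frame_sub => i hi; rewrite mem_cat hi.
have cr c1 c2 s1 s2 : frame (mods c2) (fmods c2) s1 s2 ->
    frame (mods c1 ++ mods c2) (fmods c1 ++ fmods c2) s1 s2.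
  by apply: frame_sub => i hi; rewrite mem_cat hi orbT.
elim: c Q s => /=; try by move=> *; auto.
- move=> f a v Q s; apply; split=> // f' hf i.
  by move: hf; rewrite inE /= /aupd => /negbTE ->.
- by move=> a v Q s [h1 h2]; split=> //; apply: h2; split.
- move=> c1 IH1 c2 IH2 Q s h; apply: IH1; apply: wp_mono h => s1 h f1.
  apply: IH2; apply: wp_mono h => s2 h f2; apply: h.
  by apply: frame_trans (cl _ _ _ _ f1) (cr _ _ _ _ f2).
- move=> a c1 IH1 c2 IH2 Q s; case: eqP => _ h.
    by apply: IH1; apply: wp_mono h => s1 h f1; apply: h; apply: cl.
  by apply: IH2; apply: wp_mono h => s1 h f1; apply: h; apply: cr.
- move=> a c IH Q s H I hI.
  have : frame (mods c) (fmods c) s s by split.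
  apply: (H (fun s1 => frame (mods c) (fmods c) s s1 -> I s1)).
  move=> s1 h f1; apply: hI; case: eqP h => _ h; first exact: h.
  apply: IH; apply: wp_mono h => s2 h f2; apply: h.
  exact: frame_trans f1 f2.
Qed.

Lemma wp_while a c (I : nat -> st -> Prop) Q n s : I n s ->
  (forall n s, I n s -> rg s a = 0 -> Q (tick s)) ->
  (forall n s, I n s -> rg s a <> 0 ->
     wp c (fun s' => exists2 n', n' < n & I n' s') (tick s)) ->
  wp (While a c) Q s.
Proof.
move=> hI hQ hc J hJ; elim/ltn_ind: n s hI => n IH s hI.
apply: hJ; case: eqP => [z|nz]; first exact: hQ hI z.
by apply: wp_mono (hc _ _ hI nz) => s' [n' lt' hI']; apply: IH lt' _ hI'.
Qed.

Fixpoint len c := match c with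
| Set_ _ _ | Add _ _ _ | Sub _ _ _ | Inp _ _ | Out _ _ => 1
| Get _ _ _ | Put _ _ _ => 8
| Seq c1 c2 => len c1 + len c2
| Ifz _ c1 c2 => len c1 + len c2 + 3
| While _ c => len c + 3
end.

(* Register 0 receives the address D + 16 a + f of entry [a] of field [f]; register 1 holds D. *)
Definition addr f a := [:: IAdd 0 a a; IAdd 0 0 0; IAdd 0 0 0; IAdd 0 0 0; IAdd 0 0 1;
  IConst 2 f; IAdd 0 0 2].

(** An unconditional jump is obtained by clearing register 0 and testing it. *)
Fixpoint comp pc c : seq instr := match c with
| Set_ d k => [:: IConst d k]
| Add d a b => [:: IAdd d a b]
| Sub d a b => [:: ISub d a b]
| Inp d a => [:: IInput d a]
| Get d f a => addr f a ++ [:: ILoad d 0]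
| Put f a v => addr f a ++ [:: IStore 0 v]
| Out a v => [:: IStore a v]
| Seq c1 c2 => comp pc c1 ++ comp (pc + len c1) c2
| Ifz a c1 c2 => IJz a (pc + len c2 + 3) :: comp pc.+1 c2 ++
    [:: IConst 0 0; IJz 0 (pc + len c1 + len c2 + 3)] ++ comp (pc + len c2 + 3) c1
| While a c => IJz a (pc + len c + 3) :: comp pc.+1 c ++ [:: IConst 0 0; IJz 0 pc]
end.

Lemma size_comp c pc : size (comp pc c) = len c.
Proof.
elim: c pc => //=.
- by move=> c1 IH1 c2 IH2 pc; rewrite size_cat IH1 IH2.
- by move=> a c1 IH1 c2 IH2 pc; rewrite size_cat /= IH1 IH2; lia.
- by move=> a c IH pc; rewrite size_cat /= IH; lia.
Qed.

(** In the phase without arrays, all cells from [R] on stay zero, so that they can later be read as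
    empty arrays and output cells. *)
Definition sim (arr : bool) (m : nat -> nat) s :=
  (forall r, okr r -> m r = rg s r) /\
  (arr -> [/\ m 1 = D, R <= D, forall f i, f < 16 -> m (D + 16 * i + f) = ar s f i
    & forall a, R <= a < D -> m a = ou s a]) /\
  (~~ arr -> forall a, R <= a -> m a = 0).

Variables (p : seq instr) (arr : bool).
Hypothesis R2 : 2 < R.

Lemma sim_low m m' s : sim arr m s -> (forall x, 2 < x \/ x = 1 -> m' x = m x) -> sim arr m' s.
Proof.
move=> [h1 [h2 h3]] h; split; last split.
- by move=> r hr; rewrite h ?h1 //; move: hr; rewrite /okr; lia.
- move=> /h2 [e1 e2 e3 e4]; split=> //.
  + by rewrite h ?e1 //; lia.
  + by move=> f i hf; rewrite h ?e3 //; lia.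
  + by move=> a ha; rewrite h ?e4 //; lia.
- by move=> /h3 e a ha; rewrite h ?e //; lia.
Qed.

Definition reaches pc m s pc' Q := exists k m' s',
  [/\ nsteps p inp k (pc, m) = Some (pc', m'), sim arr m' s', Q s' & k + tm s <= tm s'].

Lemma reaches_step pc m s pc1 m1 s1 pc' Q k :
  nsteps p inp k (pc, m) = Some (pc1, m1) -> k + tm s <= tm s1 ->
  reaches pc1 m1 s1 pc' Q -> reaches pc m s pc' Q.
Proof.
move=> h hk [k' [m' [s' [h1 h2 h3 h4]]]]; exists (k + k'), m', s'; split=> //.
  exact: nsteps_add h h1.
by lia.
Qed.

Lemma reaches_refl pc m s Q : sim arr m s -> Q s -> reaches pc m s pc Q.
Proof. by move=> h q; exists 0, m, s. Qed.

Lemma nsteps1 pc m pc' m' : step p inp (pc, m) = Some (pc', m') ->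
  nsteps p inp 1 (pc, m) = Some (pc', m').
Proof. by move=> /= ->. Qed.

Lemma sim_setr m s d v : sim arr m s -> okr d -> sim arr (upd m d v) (setr d v s).
Proof.
move=> [h1 [h2 h3]] hd; split; last split.
- by move=> r hr; rewrite /= /upd; case: eqP => // _; apply: h1.
- move=> /h2 [e1 e2 e3 e4]; move: hd; rewrite /okr => hd; split=> //.
  + by rewrite /upd; case: eqP => // ed; lia.
  + by move=> f i hf; rewrite /upd; case: eqP => [ed|_]; [lia|apply: e3].
  + by move=> a ha; rewrite /upd; case: eqP => [ed|_]; [lia|apply: e4].
- move=> /h3 e a ha; rewrite /upd; case: eqP => [ed|_]; last exact: e.
  by move: hd; rewrite /okr; lia.
Qed.

Lemma nsteps_addr pc m s f a : code_at p pc (addr f a) -> sim arr m s -> arr -> okr a ->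
  exists m', [/\ nsteps p inp 7 (pc, m) = Some (pc + 7, m'), sim arr m' s
     & m' 0 = D + 16 * rg s a + f].
Proof.
move=> /code_at_cons [n1] /code_at_cons [n2] /code_at_cons [n3] /code_at_cons [n4].
move=> /code_at_cons [n5] /code_at_cons [n6] /code_at_cons [n7] _ hs ha ra.
have [hr [/(_ ha) [m1 _ _ _] _]] := hs.
have e : m a = rg s a := hr _ ra.
rewrite /= n1 /= n2 /= n3 /= n4 /= n5 /= n6 /= n7 /=.
eexists; split; first by do 2 f_equal; rewrite ?addnS ?addn0.
  by apply: (sim_low hs) => x hx; rewrite /upd; do !case: eqP => ? //; lia.
by rewrite /upd /= e m1; lia.
Qed.

Lemma sim_tick m s : sim arr m s -> sim arr m (tick s).
Proof. by []. Qed.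

Lemma sim_zero m s : sim arr m s -> sim arr (upd m 0 0) s.
Proof. by move=> h; apply: (sim_low h) => x hx; rewrite /upd; case: eqP => // ?; lia. Qed.

Lemma reaches_setr pc m s d v Q : okr d -> sim arr m s -> Q (setr d v s) ->
  step p inp (pc, m) = Some (pc.+1, upd m d v) -> reaches pc m s (pc + 1) Q.
Proof.
move=> rd hs q h; apply: (reaches_step (nsteps1 h) (s1 := setr d v s)); first by rewrite /=; lia.
by rewrite addn1; apply: reaches_refl => //; apply: sim_setr.
Qed.

Lemma jump_back pc m l : code_at p pc [:: IConst 0 0; IJz 0 l] ->
  nsteps p inp 2 (pc, m) = Some (l, upd m 0 0).
Proof. by move=> /code_at_cons [n1] /code_at_cons [n2] _; rewrite /= n1 /= n2. Qed.

Lemma comp_correct c pc Q s m : code_at p pc (comp pc c) -> wf arr c -> wp c Q s ->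
  sim arr m s -> reaches pc m s (pc + len c) Q.
Proof.
elim: c pc Q s m => /=.
- move=> d k pc Q s m /code_at_cons [n1 _] hd q hs.
  by apply: (reaches_setr hd hs q); rewrite /= n1.
- move=> d a b pc Q s m /code_at_cons [n1 _] /and3P [hd ha hb] q hs.
  by apply: (reaches_setr hd hs q); rewrite /= n1 !(hs.1).
- move=> d a b pc Q s m /code_at_cons [n1 _] /and3P [hd ha hb] q hs.
  by apply: (reaches_setr hd hs q); rewrite /= n1 !(hs.1).
- move=> d a pc Q s m /code_at_cons [n1 _] /andP [hd ha] q hs.
  by apply: (reaches_setr hd hs q); rewrite /= n1 !(hs.1).
- move=> d f a pc Q s m /(@code_at_cat _ _ (addr f a) [:: ILoad d 0]) [h /code_at_cons [n1 _]].
  case/and4P=> harr hd ha hf q hs.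
  have [m' [h1 h2 h3]] := nsteps_addr h hs harr ha.
  apply: (reaches_step (nsteps_add h1 (nsteps1 (m' := upd m' d (ar s f (rg s a))) _))
    (s1 := setr d (ar s f (rg s a)) s)).
  + by rewrite /= n1 /= h3; case: (h2.2.1 harr) => _ _ -> //.
  + by rewrite /=; lia.
  + by rewrite -addnS; apply: reaches_refl => //; apply: sim_setr.
- move=> f a v pc Q s m /(@code_at_cat _ _ (addr f a) [:: IStore 0 v]) [h /code_at_cons [n1 _]].
  case/and4P=> harr ha hv hf q hs.
  have [m' [h1 h2 h3]] := nsteps_addr h hs harr ha.
  apply: (reaches_step (nsteps_add h1 (nsteps1 (m' := upd m' (D + 16 * rg s a + f) (rg s v)) _))
    (s1 := seta f (rg s a) (rg s v) s)).
  + by rewrite /= n1 /= h3 h2.1.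
  + by rewrite /=; lia.
  + rewrite -addnS; apply: reaches_refl => //.
    have [e1 e2 e3 e4] := h2.2.1 harr; split; last split; last by rewrite harr.
      move=> r hr; rewrite /= /upd; case: eqP => [|_]; last exact: h2.1.
      by move: hr; rewrite /okr; lia.
    move=> _; split=> //.
    * by rewrite /upd; case: eqP => //; lia.
    * move=> f' i' hf'; rewrite /= /upd /aupd.
      case: (eqVneq f' f) => [->|nf]; last first.
        by case: eqP => [E|_]; [move/eqP: nf; lia|apply: e3].
      rewrite eqn_add2r eqn_add2l eqn_mul2l /=.
      by case: (i' == rg s a) => //; apply: e3.
    * by move=> x hx; rewrite /upd; case: eqP => [|_]; [lia|apply: e4].
- move=> a v pc Q s m /code_at_cons [n1 _] /and3P [harr ha hv] [hr q] hs.
  apply: (reaches_step (nsteps1 (m' := upd m (rg s a) (rg s v)) _) (s1 := seto (rg s a) (rg s v) s)).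
  + by rewrite /= n1 !(hs.1).
  + by rewrite /=; lia.
  + rewrite addn1; apply: reaches_refl => //.
    have [e1 e2 e3 e4] := hs.2.1 harr; split; last split; last by rewrite harr.
      move=> r hr'; rewrite /= /upd; case: eqP => [|_]; last exact: hs.1.
      by move: hr'; rewrite /okr; lia.
    move=> _; split=> //.
    * by rewrite /upd; case: eqP => //; lia.
    * by move=> f i hf; rewrite /upd; case: eqP => [|_]; [lia|apply: e3].
    * by move=> x hx; rewrite /= /upd; case: eqP => // _; apply: e4.
- move=> c1 IH1 c2 IH2 pc Q s m /code_at_cat []; rewrite size_comp => h1 h2 /andP [w1 w2] q hs.
  have [k [m1 [s1 [n1 hs1 q1 t1]]]] := IH1 _ _ _ _ h1 w1 q hs.
  by rewrite addnA; apply: (reaches_step n1 t1); apply: IH2.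
- move=> a c1 IH1 c2 IH2 pc Q s m /code_at_cons [n0] /code_at_cat []; rewrite size_comp => h2.
  move=> /(@code_at_cat _ _ [:: IConst 0 0; IJz 0 (pc + len c1 + len c2 + 3)]) [hj h1].
  case/and3P=> ha w1 w2 q hs; have ea := hs.1 _ ha.
  case: (eqVneq (rg s a) 0) q => [z|nz] q.
    apply: (reaches_step (k := 1) (pc1 := pc + len c2 + 3) (m1 := m) (s1 := tick s)).
    + by rewrite /= n0 ea z.
    + by rewrite /=; lia.
    rewrite (_ : pc + (len c1 + len c2 + 3) = pc + len c2 + 3 + len c1); last by lia.
    apply: IH1 => //; move: h1; rewrite /= (_ : pc.+1 + len c2 + 2 = pc + len c2 + 3) //; lia.
  have [k [m1 [s1 [n1 hs1 q1 t1]]]] := IH2 _ _ _ _ h2 w2 q (sim_tick hs).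
  exists (1 + (k + 2)), (upd m1 0 0), s1; split=> //.
  + apply: nsteps_add; first by rewrite /= n0 ea (negbTE nz).
    apply: nsteps_add n1 _; rewrite (jump_back _ hj); congr (Some (_, _)); lia.
  + exact: sim_zero.
  + by move: t1; rewrite /=; lia.
- move=> a c IH pc Q s m /code_at_cons [n0] /code_at_cat []; rewrite size_comp => h1 hj.
  case/andP=> ha w q; move: m.
  (* The least fixed point is applied to the claim itself, which serves as induction on the
     iterations. *)
  apply: (q (fun s => forall m, sim arr m s -> reaches pc m s (pc + (len c + 3)) Q)).
  move=> {}s {}q m hs; have ea := hs.1 _ ha.
  case: (eqVneq (rg s a) 0) q => [z|nz] q.
    apply: (reaches_step (k := 1) (pc1 := pc + len c + 3) (m1 := m) (s1 := tick s)).
    + by rewrite /= n0 ea z.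
    + by rewrite /=; lia.
    by rewrite addnA; apply: reaches_refl.
  have [k [m1 [s1 [n1 hs1 q1 t1]]]] := IH _ _ _ _ h1 w q (sim_tick hs).
  apply: (reaches_step (k := 1 + (k + 2)) (pc1 := pc) (m1 := upd m1 0 0) (s1 := s1)).
  + apply: nsteps_add; first by rewrite /= n0 ea (negbTE nz).
    by apply: nsteps_add n1 _; rewrite (jump_back _ hj).
  + by move: t1; rewrite /=; lia.
  + by apply: q1; apply: sim_zero.
Qed.

End Compile.

(** * Numbered literals and clause records *)

(* Literals are numbered from 2; the numbers 0 and 1 stand for the constants false and true. *)
Definition ix (l : lit) : nat := l.1 + l.1 + l.2 + 2.
Definition nx (x : nat) : nat := if odd x then x.-1 else x.+1.

Lemma nx_ix l : nx (ix l) = ix (negl l).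
Proof.
case: l => v b; have e : odd (v + v + b + 2) = b by rewrite !oddD addbb /=; case: (b).
by rewrite /nx /ix /= e {e}; case: b => /=; lia.
Qed.

Lemma nxK : involutive nx.
Proof.
move=> x; rewrite /nx; case E: (odd x) => /=; last by rewrite E.
by case: x E => // x /=; case: (odd x).
Qed.

Lemma ix_inj : injective ix.
Proof. by case=> v b [w d]; rewrite /ix /=; case: b d => [] [] ?; congr (_, _); lia. Qed.

Lemma ix_neq0 l : ix l <> 0. Proof. by rewrite /ix; lia. Qed.
Lemma ix_neq1 l : ix l <> 1. Proof. by rewrite /ix; lia. Qed.
Lemma nx_eq1 x : nx x = 1 -> x = 0.
Proof. by move=> e; rewrite -[x]nxK e. Qed.
Lemma nx_neq x : nx x <> x.
Proof. by rewrite /nx; case E: (odd x) => /=; lia. Qed.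

(* A clause with at most three distinct elements as a triple, padded with 0 (the constant false). *)
Definition dstep (t : nat * nat * nat) (x : nat) :=
  let: (a, b, c) := t in if [|| x == a, x == b | x == c] then t else (x, a, b).
Definition dd (s : seq nat) := foldl dstep (0, 0, 0) s.
Definition tseq (t : nat * nat * nat) := let: (a, b, c) := t in [:: a; b; c].

(** [dstep] drops the oldest entry of a full triple, but with at most three distinct values only
    padding zeros are dropped. In [u] the latest new value comes first. *)
Lemma dd_spec s : 0 \notin s -> size (undup s) <= 3 ->
  exists u, [/\ uniq u, u =i s & tseq (dd s) = take 3 (u ++ [:: 0; 0; 0])].
Proof.
elim/last_ind: s => [|s x IH]; first by exists [::].
rewrite mem_rcons inE negb_or => /andP [x0 s0] hs.
have sub : size (undup s) <= size (undup (rcons s x)).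
  apply: uniq_leq_size; first exact: undup_uniq.
  by move=> y; rewrite !mem_undup mem_rcons inE => ->; rewrite orbT.
have [u [uu us E]] := IH s0 (leq_trans sub hs).
rewrite /dd foldl_rcons -/(dd s).
have u0 : 0 \notin u by rewrite us.
have sz v : uniq v -> v =i rcons s x -> size v <= 3.
  move=> uv vs; apply: leq_trans hs; apply: uniq_leq_size uv _ => y.
  by rewrite vs mem_undup.
move: E; case: (dd s) => [[a b] c] E /=.
case: ifP => hx.
  exists u; split=> // y; rewrite us mem_rcons inE; case: (eqVneq y x) => //= ->.
  have: x \in tseq (a, b, c) by rewrite !inE.
  rewrite E => /mem_take; rewrite mem_cat us => /orP [] //.
  by rewrite !inE (eq_sym x) (negbTE x0).
have xu : x \notin u.
  apply/negP => xu; have hu : size u <= 3.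
    apply: leq_trans hs; apply: uniq_leq_size uu _ => y; rewrite us mem_undup mem_rcons inE => ->.
    by rewrite orbT.
  have: x \in tseq (a, b, c) by rewrite E take_cat ltnNge hu /= mem_cat xu.
  by rewrite !inE hx.
have su : size (x :: u) <= 3.
  by apply: sz; rewrite /= ?xu // => y; rewrite mem_rcons !inE us.
exists (x :: u); split; first by rewrite /= xu.
  by move=> y; rewrite mem_rcons !inE us.
by move: su E; case: u {uu us u0 xu} => [|y [|z [|]]] //= _ [-> -> _].
Qed.

(* A record [(x, (a, b))] is the implication "if [x] holds then [a] or [b]": it is inspected when
   [x] becomes true. *)
Definition rc (t : nat * nat * nat) : seq (nat * (nat * nat)) :=
  let: (a, b, c) := t in [:: (nx c, (a, b)); (nx b, (a, c)); (nx a, (b, c))].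

Lemma rcP t x a b : (x, (a, b)) \in rc t -> [:: nx x; a; b] =i tseq t.
Proof.
case: t => [[p q] r]; rewrite !inE => /or3P [] /eqP [-> -> ->] y; rewrite nxK !inE.
- by rewrite orbC -orbA.
- by rewrite orbCA.
- by [].
Qed.

Lemma mem_rc t x : x \in tseq t -> exists a b, (nx x, (a, b)) \in rc t.
Proof.
case: t => [[a b] c]; rewrite !inE => /or3P [] /eqP ->.
- by exists b, c; rewrite !inE eqxx !orbT.
- by exists a, c; rewrite !inE eqxx !orbT.
- by exists a, b; rewrite !inE eqxx.
Qed.

Definition records (f : seq (seq lit)) :=
  flatten [seq rc (dd [seq ix l | l <- c]) | c <- rev f].

Lemma recordsP f r : reflect (exists2 c, c \in f & r \in rc (dd [seq ix l | l <- c]))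
  (r \in records f).
Proof.
apply: (iffP flatten_mapP) => [[c cf h]|[c cf h]]; exists c => //.
  by rewrite -mem_rev.
by rewrite mem_rev.
Qed.

(** The constant 0 counts as false by a test of its own, since its negation 1 need not belong to
    [S]. *)
Definition rclosed (rl : seq (nat * (nat * nat))) (S : nat -> Prop) :=
  forall x a b, (x, (a, b)) \in rl -> S x ->
    ((a = 0 \/ S (nx a)) -> S b) /\ ((b = 0 \/ S (nx b)) -> S a).

Definition nxfree (S : nat -> Prop) := ~ S 0 /\ forall x, S x -> ~ S (nx x).

Section Formula.

Variable f : seq (seq lit).
Hypothesis fsz : forall c, c \in f -> c != [::] /\ size (undup c) <= 3.

Lemma clause_idx c : c \in f -> let t := tseq (dd [seq ix l | l <- c]) in
  (forall x, x \in t -> x <> 0 -> exists2 l, l \in c & x = ix l) /\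
  (forall l, l \in c -> ix l \in t).
Proof.
move=> cf t; have [_ hs] := fsz cf.
have n0 : 0 \notin [seq ix l | l <- c] by apply/mapP => [[l _ /esym/ix_neq0]].
have hs' : size (undup [seq ix l | l <- c]) <= 3 by rewrite undup_map_inj ?size_map //; exact: ix_inj.
have [u [uu us E]] := dd_spec n0 hs'.
have su : size u <= 3.
  by apply: leq_trans hs'; apply: uniq_leq_size uu _ => y; rewrite us mem_undup.
have tE : t = u ++ take (3 - size u) [:: 0; 0; 0] by rewrite /t E take_cat ltnNge su.
split=> [x|l lc].
  rewrite tE mem_cat => /orP [|/mem_take]; first by rewrite us => /mapP [l lc ->]; exists l.
  by rewrite !inE => /or3P [] /eqP ->.
by rewrite tE mem_cat us map_f.
Qed.

(** Ensures that a literal to be forced does not also fill the other place of the record, where it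
    would have to be false already. *)
Lemma record_uniq x a b : (x, (a, b)) \in records f -> a <> 0 -> a <> b.
Proof.
case/recordsP => c cf; have [_ hs] := fsz cf.
have n0 : 0 \notin [seq ix l | l <- c] by apply/mapP => [[l _ /esym/ix_neq0]].
have hs' : size (undup [seq ix l | l <- c]) <= 3 by rewrite undup_map_inj ?size_map //; exact: ix_inj.
have [u [uu us E]] := dd_spec n0 hs'.
move: E; case: (dd _) => [[p q] r] E.
have u0 : 0 \notin u by rewrite us.
have [n12 n13 n23] : [/\ p != 0 -> p != q, p != 0 -> p != r & q != 0 -> q != r].
  case: u uu u0 E {us} => [|u1 [|u2 [|u3 u]]] /= hu h0 [-> -> ->] //; move: hu h0; rewrite !inE !negb_or.
  - by rewrite andbT => -> /andP [h1 h2]; split=> //; rewrite eq_sym ?h1 ?h2.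
  - by move=> /and4P [/and3P [-> -> _] /andP [-> _] _ _].
rewrite !inE => /or3P [] /eqP [_ -> ->] /eqP n0'; apply/eqP; auto.
Qed.

Lemma records_clause x a b : (x, (a, b)) \in records f -> exists2 c, c \in f &
  (forall y, y \in [:: nx x; a; b] -> y <> 0 -> exists2 l, l \in c & y = ix l) /\
  (forall l, l \in c -> ix l \in [:: nx x; a; b]).
Proof.
case/recordsP => c cf /rcP h; exists c => //.
have [h1 h2] := clause_idx cf.
by split=> [y|l lc]; rewrite h; [apply: h1|apply: h2].
Qed.

Lemma rclosed_of_up_closed A : consistent A -> up_closed f A ->
  rclosed (records f) (fun x => exists2 l, x = ix l & A l) /\
  nxfree (fun x => exists2 l, x = ix l & A l).
Proof.
move=> Ac Au; pose S x := exists2 l, x = ix l & A l.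
have Sneg k : S (nx (ix k)) -> A (negl k).
  by rewrite nx_ix => [[l /ix_inj -> Al]].
have S0 y : S y -> y <> 0 by move=> [l -> _]; apply: ix_neq0.
have main x a b c : c \in f ->
  (forall y, y \in [:: nx x; a; b] -> y <> 0 -> exists2 l, l \in c & y = ix l) ->
  (forall l, l \in c -> ix l \in [:: nx x; a; b]) -> S x -> a = 0 \/ S (nx a) -> S b.
  move=> cf h1 h2 Sx Sa.
  have [k kc ek] : exists2 k, k \in c & nx x = ix k.
    apply: h1; rewrite ?mem_head // => e.
    by case: Sx => l e' _; apply: (@ix_neq1 l); rewrite -e' -[x]nxK e.
  have Ak : A (negl k) by apply: Sneg; rewrite -ek nxK.
  have oth l : l \in c -> ix l <> b -> A (negl l).
    move=> /h2; rewrite !inE => /or3P [] /eqP e ne //.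
    - by apply: Sneg; rewrite e nxK.
    - by apply: Sneg; rewrite e; case: Sa => // e'; case: (@ix_neq0 l); rewrite e.
  have [b0|/eqP nb] := eqVneq b 0.
    have Akk : A k.
      by apply: (Au c) => //; [exists k|move=> l lc _; apply: oth => //; rewrite b0; apply: ix_neq0].
    by case: (Ac _ Akk Ak).
  have [m mc em] : exists2 m, m \in c & b = ix m by apply: h1; rewrite ?inE ?eqxx ?orbT.
  exists m => //; apply: (Au c) => //; first by exists k.
  by move=> l lc ne; apply: oth => //; rewrite em => /ix_inj.
split.
  move=> x a b /records_clause [c cf [h1 h2]] Sx; split.
    exact: main cf h1 h2 Sx.
  apply: main cf _ _ Sx => [y|l /h2]; last by rewrite !inE (orbC (_ == a)).
  by rewrite !inE (orbC (_ == b)) => hy; apply: h1; rewrite !inE.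
split; first by case=> l /esym /ix_neq0.
by move=> x [l -> Al]; move/Sneg; apply: Ac.
Qed.

Lemma up_closed_of_rclosed (M : nat -> Prop) : rclosed (records f) M -> nxfree M ->
  consistent (fun l => M (ix l)) /\ up_closed f (fun l => M (ix l)).
Proof.
move=> Mr [M0 Mn]; split; first by move=> l Ml; rewrite -nx_ix; apply: Mn.
move=> c l cf [k kc]; rewrite -nx_ix => Mk hl.
have [h1 h2] := clause_idx cf.
have [a [b hr]] := mem_rc (h2 _ kc).
have hR : (nx (ix k), (a, b)) \in records f by apply/recordsP; exists c.
have mem y : y \in [:: a; b] -> y = 0 \/ y = ix l \/ M (nx y).
  move=> yab; have [|/eqP ny] := eqVneq y 0; first by left.
  have yt : y \in tseq (dd [seq ix l | l <- c]).
    by rewrite -(rcP hr) inE yab orbT.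
  have [m mc ->] := h1 y yt ny.
  have [-> |/eqP ne] := eqVneq m l; first by right; left.
  by right; right; rewrite nx_ix; apply: hl.
have [H1 H2] := Mr _ _ _ hR Mk.
have ma := mem a (mem_head _ _).
have mb : b = 0 \/ b = ix l \/ M (nx b) by apply: mem; rewrite !inE eqxx orbT.
have [ea|/eqP na] := eqVneq a (ix l).
  rewrite -ea; apply: H2; case: mb => [|[eb|]]; [by left| |by right].
  by case: (record_uniq hR (a := a) (b := b)); rewrite ea ?eb //; apply: ix_neq0.
have Mb : M b by apply: H1; case: ma => [|[]]; [left| |right].
case: mb => [eb|[<- //|Mnb]]; first by case: M0; rewrite -eb.
by case: (Mn _ Mb).
Qed.

(** A clause with all its literals false would, by closure, force its own first literal. The number
    [v + v + 3] is [ix (v, true)]. *)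
Lemma sat_of_rclosed (M : pred nat) : rclosed (records f) M -> nxfree M ->
  (forall c l, c \in f -> l \in c -> M (ix l) || M (nx (ix l))) ->
  sat f (fun v => M (v + v + 3)).
Proof.
move=> Mr Mn Mt; have [Ac Au] := up_closed_of_rclosed Mr Mn.
apply/allP => c cf; have [c0 _] := fsz cf.
have [/hasP [l lc Ml]|/hasPn nM] := boolP (has (fun l => M (ix l)) c).
  apply/hasP; exists l => //; case: l lc Ml => v [] lc Ml /=.
    by rewrite (_ : v + v + 3 = ix (v, true)) ?Ml // /ix /=; lia.
  have := Mn.2 _ Ml; rewrite (_ : v + v + 3 = nx (ix (v, false))); last by rewrite nx_ix /ix /=; lia.
  by case: (M _).
case: c cf c0 nM => // k c cf _ nM.
have An m : m \in k :: c -> M (ix (negl m)).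
  by move=> mc; have := Mt _ _ cf mc; rewrite nx_ix (negbTE (nM _ mc)).
have : M (ix k) by apply: (Au _ k cf) => [|m mc _]; [exists k; rewrite ?mem_head //; apply: An; apply: mem_head|apply: An].
by rewrite (negbTE (nM _ (mem_head _ _))).
Qed.

End Formula.

Definition no_ext (f : seq (seq lit)) (M : pred nat) x := forall S : nat -> Prop,
  (forall y, M y -> S y) -> S x -> nxfree S -> rclosed (records f) S -> False.

Definition occ (f : seq (seq lit)) (x : nat) := x \in [seq ix l | l <- flatten f].

Lemma occP (f : seq (seq lit)) x : reflect (exists2 l, (exists2 c, c \in f & l \in c) & x = ix l) (occ f x).
Proof.
apply: (iffP mapP) => [[l /flattenP h ->]|[l /flattenP h ->]]; exists l => //.
Qed.

(** * Refuting both values of a variable *)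

Section Refute.

Variables (n : nat) (lt : rel 'I_n).
Hypothesis lt_tr : transitive lt.
Variables (chi0 : {set W n} -> bool) (comp : {set W n} -> nat).
Hypothesis chi0P : forall e e', is_edge lt e -> is_edge lt e' ->
  conflict lt e e' -> chi0 e != chi0 e'.
Hypothesis compP : forall e e', is_edge lt e -> is_edge lt e' ->
  (comp e == comp e') = connect (conflict lt) e e'.
Variable f : seq (seq lit).
Hypothesis frep : represents lt chi0 comp f.

Lemma clause_size c : c \in f -> c != [::] /\ size (undup c) <= 3.
Proof.
move=> cf; have key (s : seq lit) : c =i s -> s != [::] -> size s <= 3 -> c != [::] /\ size (undup c) <= 3.
  move=> e s0 s3; split.
    by apply: contra s0 => /eqP c0; case: s e {s3} => // k s /(_ k); rewrite c0 mem_head.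
  apply: leq_trans s3; apply: uniq_leq_size; first exact: undup_uniq.
  by move=> k; rewrite mem_undup e.
by case: (clause_cases chi0P compP frep cf) => [[x [y [z [_ e]]]]|[i [t [j [_ e]]]]]; apply: key e _ _.
Qed.

(** A model makes one of the two literals true, and [up_closed_extend] would extend [M] by that
    one. *)
Lemma both_refuted (M : pred nat) x : rclosed (records f) M -> nxfree M ->
  (forall y, M y -> occ f y) -> occ f x -> occ f (nx x) -> ~~ M x -> ~~ M (nx x) ->
  no_ext f M x -> no_ext f M (nx x) -> ~ satisfiable f.
Proof.
move=> Mr Mn Mo ox onx nMx nMnx E1 E2 [a sa].
have [Ac Au] := up_closed_of_rclosed clause_size Mr Mn.
case/occP: (ox) => l0 hl0 e0; case/occP: (onx) => l1 hl1 e1.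
have el1 : l1 = negl l0 by apply: ix_inj; rewrite -e1 e0 nx_ix.
have main l : (exists2 c, c \in f & l \in c) -> ~~ M (ix (negl l)) -> a l.1 = l.2 ->
    no_ext f M (ix l) -> False.
  move=> hl nM al ne.
  have [||A' [AA A0 Ac' Au']] := up_closed_extend lt_tr chi0P compP frep Ac Au _ hl _ sa al.
  - by move=> k /Mo /occP [m hm /ix_inj ->].
  - by apply/negP.
  have [r1 r2] := rclosed_of_up_closed clause_size Ac' Au'.
  apply: (ne _ _ _ r2 r1); last by exists l.
  by move=> y My; case/occP: (Mo _ My) => k _ e; exists k => //; apply: AA; rewrite -e.
have [al|/negP al] := boolP (a l0.1 == l0.2).
  apply: (main l0) => //; last by rewrite -e0.
  - by rewrite -nx_ix -e0.
  - exact/eqP.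
apply: (main l1) => //; last by rewrite -e1.
- by rewrite el1 neglK -e0.
- by rewrite el1 /negl /=; case: (a _) (l0.2) al => [] [] // [].
Qed.

End Refute.

(** * Record lists of literals and the potential *)

Definition lst (rl : seq (nat * (nat * nat))) x := [seq r.2 | r <- rl & r.1 == x].

Lemma mem_lst rl x p : (p \in lst rl x) = ((x, p) \in rl).
Proof.
apply/mapP/idP => [[[y q]]|h].
  by rewrite mem_filter /= => /andP [/eqP -> h ->].
by exists (x, p) => //; rewrite mem_filter /= eqxx.
Qed.

Definition weight rl x := (size (lst rl x)).+1.
(* The work still to be done: setting an unset literal pays for itself and its records. *)
Definition pot rl (U : seq nat) (M : pred nat) := \sum_(x <- U | ~~ M x) weight rl x.

Lemma pot_mark rl U M x : uniq U -> x \in U -> ~~ M x ->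
  pot rl U M = weight rl x + pot rl U (fun y => M y || (y == x)).
Proof.
move=> uU xU nM; rewrite /pot big_mkcond [in RHS]big_mkcond /= !(bigD1_seq x) //= nM eqxx orbT add0n.
by congr (_ + _); apply: eq_bigr => y /negbTE ->; rewrite orbF.
Qed.

Lemma pot_le rl U M : uniq U -> pot rl U M <= size U + size rl.
Proof.
move=> uU; apply: (@leq_trans (\sum_(x <- U) weight rl x)).
  by rewrite /pot big_mkcond; apply: leq_sum => x _; case: ifP.
rewrite /weight; under eq_bigr do rewrite -addn1.
rewrite big_split /= addnC sum1_size leq_add2l.
elim: rl => [|r rl IH]; first by rewrite big1.
apply: leq_trans (_ : \sum_(x <- U) (r.1 == x) + \sum_(x <- U) size (lst rl x) <= _).
  by rewrite -big_split leq_sum // => x _; rewrite /lst /=; case: eqP.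
rewrite /= -add1n leq_add //.
have := count_uniq_mem r.1 uU; rewrite -sum1_count big_mkcond /= => e.
rewrite (eq_bigr (fun x => if x == r.1 then 1 else 0)).
  by rewrite e leq_b1.
by move=> x _; rewrite eq_sym; case: eqP.
Qed.

Lemma pot_mono rl U (M N : pred nat) : (forall x, M x -> N x) -> pot rl U N <= pot rl U M.
Proof.
move=> h; rewrite /pot big_mkcond [X in _ <= X]big_mkcond /=; apply: leq_sum => x _.
by case: ifPn => // nN; rewrite (contra (h x) nN).
Qed.

Lemma eq_pot rl U (M N : pred nat) : M =1 N -> pot rl U M = pot rl U N.
Proof. by move=> h; apply: eq_bigl => x; rewrite h. Qed.

(** * Parsing the input into record lists *)

Notation "a ;; b" := (Seq a b) (at level 90, right associativity).

(* Fields: head of the record list of a literal, its negation, the records themselves (two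
   literals and the next record), and the literal and variable at each position of the input. *)
Notation fHD := 0. Notation fNG := 1. Notation fOA := 6. Notation fOB := 7. Notation fNX := 8.
Notation fLST := 9. Notation fLSV := 10.
Notation rN := 3. Notation rI := 4. Notation rOne := 5. Notation rT := 6. Notation rS := 7.
Notation rV := 8. Notation rB := 9. Notation rX := 10. Notation rY := 11.
Notation rL1 := 12. Notation rL2 := 13. Notation rL3 := 14. Notation rC := 15. Notation rR := 16.
Notation rE := 17. Notation rF := 18. Notation rH := 19. Notation rJ := 20. Notation rOK := 21.
Notation rTwo := 23. Notation rD := 22. Notation rZ := 34.

Definition differ a b := Sub rE a b ;; Sub rF b a ;; Add rE rE rF.
Definition move d a := Add d a rZ.

(** [rX] receives [ix (v, b)] and [rY] the index [2v + (1 - b) + 2] of the negation. The nested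
    tests carry out [dstep] on [rL1], [rL2], [rL3], with [Set_ rE 0] as a command without effect. *)
Definition literal :=
  Inp rV rI ;; Add rI rI rOne ;; Inp rB rI ;; Add rI rI rOne ;;
  Add rX rV rV ;; Add rY rX rOne ;; Sub rY rY rB ;; Add rY rY rTwo ;;
  Add rX rX rB ;; Add rX rX rTwo ;;
  Put fNG rX rY ;; Put fLST rC rX ;; Put fLSV rC rV ;; Add rC rC rOne ;; Sub rS rS rOne ;;
  differ rX rL1 ;; Ifz rE (Set_ rE 0)
  (differ rX rL2 ;; Ifz rE (Set_ rE 0)
  (differ rX rL3 ;; Ifz rE (Set_ rE 0)
  (move rL3 rL2 ;; move rL2 rL1 ;; move rL1 rX))).

Section Steps.

Variables (R : nat) (inp : seq nat) (D : nat).

Lemma step_seq c1 c2 (Q : st -> Prop) s :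
  wp R inp D c1 (wp R inp D c2 Q) s -> wp R inp D (Seq c1 c2) Q s.
Proof. by []. Qed.
Lemma step_set d k (Q : st -> Prop) s : Q (setr d k s) -> wp R inp D (Set_ d k) Q s.
Proof. by []. Qed.
Lemma step_add d a b (Q : st -> Prop) s x y : rg s a = x -> rg s b = y ->
  Q (setr d (x + y) s) -> wp R inp D (Add d a b) Q s.
Proof. by move=> <- <-. Qed.
Lemma step_sub d a b (Q : st -> Prop) s x y : rg s a = x -> rg s b = y ->
  Q (setr d (x - y) s) -> wp R inp D (Sub d a b) Q s.
Proof. by move=> <- <-. Qed.
Lemma step_inp d a (Q : st -> Prop) s i x : rg s a = i -> nth 0 inp i = x ->
  Q (setr d x s) -> wp R inp D (Inp d a) Q s.
Proof. by move=> <- <-. Qed.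
Lemma step_get d f a (Q : st -> Prop) s i x : rg s a = i -> ar s f i = x ->
  Q (setr d x s) -> wp R inp D (Get d f a) Q s.
Proof. by move=> <- <-. Qed.
Lemma step_put f a v (Q : st -> Prop) s i x : rg s a = i -> rg s v = x ->
  Q (seta f i x s) -> wp R inp D (Put f a v) Q s.
Proof. by move=> <- <-. Qed.
Lemma step_out a v (Q : st -> Prop) s i x : rg s a = i -> rg s v = x -> R <= i < D ->
  Q (seto i x s) -> wp R inp D (Out a v) Q s.
Proof. by move=> <- <-. Qed.
Lemma step_if a c1 c2 (Q : st -> Prop) s x : rg s a = x ->
  (x = 0 -> wp R inp D c1 Q (tick s)) -> (x <> 0 -> wp R inp D c2 Q (tick s)) ->
  wp R inp D (Ifz a c1 c2) Q s.
Proof. by move=> <- /= h1 h2; case: eqP. Qed.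

Lemma rg_eq d v s : rg (setr d v s) d = v.
Proof. by rewrite /= /upd eqxx. Qed.
Lemma rg_ne d v s a x : (a == d) = false -> rg s a = x -> rg (setr d v s) a = x.
Proof. by rewrite /= /upd => ->. Qed.
Lemma rg_seta f i v s a x : rg s a = x -> rg (seta f i v s) a = x.
Proof. by []. Qed.
Lemma rg_seto i v s a x : rg s a = x -> rg (seto i v s) a = x.
Proof. by []. Qed.
Lemma rg_tick s a x : rg s a = x -> rg (tick s) a = x.
Proof. by []. Qed.
Lemma ar_setr d v s f i x : ar s f i = x -> ar (setr d v s) f i = x.
Proof. by []. Qed.
Lemma ar_tick s f i x : ar s f i = x -> ar (tick s) f i = x.
Proof. by []. Qed.
Lemma ar_ne g j v s f i x : (f == g) = false -> ar s f i = x -> ar (seta g j v s) f i = x.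
Proof. by rewrite /= /aupd => ->. Qed.

End Steps.

(** Evaluates a lookup by peeling off one update at a time, so that symbolic states stay folded. *)
Ltac rd := lazymatch goal with
  | |- rg (setr ?d _ _) ?d = _ => apply rg_eq
  | |- rg (setr _ _ _) _ = _ => apply rg_ne; [reflexivity | rd]
  | |- rg (seta _ _ _ _) _ = _ => apply rg_seta; rd
  | |- rg (seto _ _ _) _ = _ => apply rg_seto; rd
  | |- rg (tick _) _ = _ => apply rg_tick; rd
  | |- ar (setr _ _ _) _ _ = _ => apply ar_setr; rd
  | |- ar (tick _) _ _ = _ => apply ar_tick; rd
  | |- ar (seta _ _ _ _) _ _ = _ => first [apply ar_ne; [reflexivity | rd] | eassumption | reflexivity]
  | |- _ => first [eassumption | reflexivity]
  end.

Ltac wseq := repeat lazymatch goal with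
  |- wp _ _ _ (Seq _ _) _ _ => refine (@step_seq _ _ _ _ _ _ _ _) end.

Ltac wstep := wseq; lazymatch goal with
  | |- wp _ _ _ (Set_ _ _) _ _ => eapply step_set
  | |- wp _ _ _ (Add _ _ _) _ _ => eapply step_add; [rd|rd|]
  | |- wp _ _ _ (Sub _ _ _) _ _ => eapply step_sub; [rd|rd|]
  | |- wp _ _ _ (Inp _ _) _ _ => eapply step_inp; [rd|rd|]
  | |- wp _ _ _ (Get _ _ _) _ _ => eapply step_get; [rd|rd|]
  | |- wp _ _ _ (Put _ _ _) _ _ => eapply step_put; [rd|rd|]
  | |- wp _ _ _ (Ifz _ _ _) _ _ => eapply step_if; [rd| |]
  end.

Lemma wp_frame_gen R inp D c (Q : st -> Prop) s :
  (forall F : st -> Prop, F = frame (mods c) (fmods c) s ->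
     wp R inp D c (fun s' => F s' -> Q s') s) -> wp R inp D c Q s.
Proof. by move=> h; apply: wp_frame; apply: h. Qed.

Section Verify.

Variables (R : nat) (inp : seq nat) (D : nat).
Local Notation wp := (wp R inp D).

Definition consts s := [/\ rg s rOne = 1, rg s rTwo = 2 & rg s rZ = 0].
Definition regs3 s := (rg s rL1, rg s rL2, rg s rL3).

Lemma literal_wp (Q : st -> Prop) s v (b : bool) : consts s ->
  nth 0 inp (rg s rI) = v -> nth 0 inp (rg s rI).+1 = b ->
  (forall s', rg s' rI = (rg s rI).+2 -> rg s' rS = (rg s rS).-1 -> rg s' rC = (rg s rC).+1 ->
    regs3 s' = dstep (regs3 s) (ix (v, b)) ->
    ar s' = aupd (aupd (aupd (ar s) fNG (ix (v, b)) (nx (ix (v, b)))) fLST (rg s rC) (ix (v, b)))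
      fLSV (rg s rC) v -> tm s' <= tm s + 400 -> 
    frame (mods literal) (fmods literal) s s' -> Q s') ->
  wp literal Q s.
Proof.
move=> [c1 c2 c0] hv hb hQ; refine (wp_frame_gen _) => F eF.
have eX : v + v + b + 2 = ix (v, b) by [].
have eY : v + v + 1 - b + 2 = nx (ix (v, b)).
  by rewrite nx_ix /ix /=; case: (b); rewrite /=; lia.
rewrite -addn1 in hb.
rewrite /literal /differ /move.
do 8 wstep. rewrite eY. do 2 wstep. rewrite eX; do 8 wstep.
have fin s' : regs3 s' = dstep (regs3 s) (ix (v, b)) -> rg s' rI = rg s rI + 1 + 1 ->
   rg s' rS = rg s rS - 1 -> rg s' rC = rg s rC + 1 -> 
   ar s' = aupd (aupd (aupd (ar s) fNG (ix (v, b)) (nx (ix (v, b)))) fLST (rg s rC) (ix (v, b)))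
      fLSV (rg s rC) v -> tm s' <= tm s + 400 -> F s' -> Q s'.
  move=> h1 h2 h3 h4 h5 h6; rewrite eF; apply: hQ => //; lia.
have tri (a b' : nat) : a - b' + (b' - a) = 0 -> a == b' by lia.
have tri' (a b' : nat) : a - b' + (b' - a) <> 0 -> (a == b') = false by lia.
wstep => [/tri e1|/tri' e1].
  by wstep; apply: fin; try rd; rewrite /=; [rewrite /regs3 /dstep e1|lia].
do 3 wstep; wstep => [/tri e2|/tri' e2].
  by wstep; apply: fin; try rd; rewrite /=; [rewrite /regs3 /dstep e2 orbT|lia].
do 3 wstep; wstep => [/tri e3|/tri' e3].
  by wstep; apply: fin; try rd; rewrite /=; [rewrite /regs3 /dstep e3 !orbT|lia].
do 3 wstep; apply: fin; try rd; rewrite /=; last by lia.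
rewrite /regs3 /dstep e1 e2 e3 /= /upd /= !addn0.
by [].
Qed.

(** The record is linked under the negation of the literal in [a], as it must be inspected when that
    literal becomes false. *)
Definition add_record a b c :=
  Get rY fNG a ;; Add rR rR rOne ;; Put fOA rR b ;; Put fOB rR c ;;
  Get rH fHD rY ;; Put fNX rR rH ;; Put fHD rY rR.

Lemma add_record_wp (Q : st -> Prop) s a b c x : consts s ->
  a \in [:: rL1; rL2; rL3] -> b \in [:: rL1; rL2; rL3] -> c \in [:: rL1; rL2; rL3] ->
  ar s fNG (rg s a) = x ->
  (forall s', rg s' rR = (rg s rR).+1 ->
    ar s' = aupd (aupd (aupd (aupd (ar s) fOA (rg s rR).+1 (rg s b)) fOB (rg s rR).+1 (rg s c))
      fNX (rg s rR).+1 (ar s fHD x)) fHD x (rg s rR).+1 -> tm s' <= tm s + 100 ->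
    frame (mods (add_record a b c)) (fmods (add_record a b c)) s s' -> Q s') ->
  wp (add_record a b c) Q s.
Proof.
move=> [c1 _ _] ha hb hc hx hQ; refine (wp_frame_gen _) => F eF.
have ne r r' : r' \in [:: rL1; rL2; rL3] -> r \in [:: rY; rR; rH] -> (r' == r) = false.
  by rewrite !inE => /or3P [] /eqP -> /or3P [] /eqP ->.
rewrite /add_record; wstep; wstep; wseq.
eapply step_put; [rd| |].
  by do 2?(apply rg_ne; [exact: ne|]); reflexivity.
wseq; eapply step_put; [rd| |].
  by apply rg_seta; do 2?(apply rg_ne; [exact: ne|]); reflexivity.
do 3 wstep; rewrite eF addn1; apply: hQ => //=; lia.
Qed.

(** A linked list with null pointer 0. The bound [bd] on its addresses guarantees that writing
    record [bd.+1] leaves it intact. *)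
Inductive chain (A : nat -> nat -> nat) (bd : nat) : nat -> seq (nat * nat) -> Prop :=
| chain_nil : chain A bd 0 [::]
| chain_cons h a b l : 0 < h <= bd -> A fOA h = a -> A fOB h = b -> chain A bd (A fNX h) l ->
    chain A bd h ((a, b) :: l).

Lemma chain_ext A A' bd bd' h l : chain A bd h l -> bd <= bd' ->
  (forall f i, f \in [:: fOA; fOB; fNX] -> i <= bd -> A' f i = A f i) -> chain A' bd' h l.
Proof.
move=> hc le e; elim: hc => [|{}h a b {}l hh ea eb hc IH]; first by constructor.
by constructor; rewrite ?e //; lia.
Qed.

Definition chains A bd rl := forall x, chain A bd (A fHD x) (lst rl x).

Lemma chains_add A bd rl y b c : chains A bd rl ->
  chains (aupd (aupd (aupd (aupd A fOA bd.+1 b) fOB bd.+1 c) fNX bd.+1 (A fHD y)) fHD y bd.+1)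
    bd.+1 ((y, (b, c)) :: rl).
Proof.
move=> h; set A' := (X in chains X).
have eHD x : A' fHD x = if x == y then bd.+1 else A fHD x by [].
have old f i : f \in [:: fOA; fOB; fNX] -> i <= bd -> A' f i = A f i.
  by rewrite !inE /A' /aupd => /or3P [] /eqP -> /= hi; rewrite (_ : (i == bd.+1) = false) //; lia.
have [e1 e2 e3] : [/\ A' fOA bd.+1 = b, A' fOB bd.+1 = c & A' fNX bd.+1 = A fHD y].
  by rewrite /A' /aupd /= eqxx.
move=> x; rewrite eHD /lst /= eq_sym.
case: eqP => [<-|_]; last exact: (chain_ext (h x) (leqnSn _) old).
by constructor; rewrite ?ltnSn // e3; apply: (chain_ext (h y) (leqnSn _) old).
Qed.

(** Fields 2 and 3 in [p_val] are the truth tables of the two sides; after parsing only index 1, the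
    constant true, is marked. *)
Record parsed (ls : seq lit) (rl : seq (nat * (nat * nat))) (A : nat -> nat -> nat) : Prop := {
  p_chains : chains A (size rl) rl;
  p_neg0 : A fNG 0 = 1;
  p_neg : forall l, l \in ls -> A fNG (ix l) = nx (ix l);
  p_lst : forall j, j < size ls -> A fLST j = nth 0 [seq ix l | l <- ls] j;
  p_lsv : forall j, j < size ls -> A fLSV j = nth 0 [seq l.1 | l <- ls] j;
  p_val : forall (b : bool) x, A (2 + b) x = (x == 1) }.

Lemma parsed_literal ls rl A l : parsed ls rl A ->
  parsed (rcons ls l) rl (aupd (aupd (aupd A fNG (ix l) (nx (ix l))) fLST (size ls) (ix l))
      fLSV (size ls) l.1).
Proof.
case=> h1 h2 h3 h4 h5 h6; split.
- move=> x; apply: chain_ext (h1 x) _ _ => // f i hf hi.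
  by move: hf; rewrite !inE => /or3P [] /eqP ->.
- by rewrite /aupd /=; case: eqP => // e; case: (@ix_neq0 l).
- move=> k; rewrite /aupd /= mem_rcons inE; case: (eqVneq k l) => [-> _|ne /= kl].
    by rewrite eqxx.
  by rewrite (inj_eq ix_inj) (negbTE ne); apply: h3.
- move=> j; rewrite size_rcons ltnS /aupd /= map_rcons nth_rcons size_map.
  by case: ltngtP => //= hj _; apply: h4.
- move=> j; rewrite size_rcons ltnS /aupd /= map_rcons nth_rcons size_map.
  by case: ltngtP => //= hj _; apply: h5.
- by case=> x; [exact: (h6 true x)|exact: (h6 false x)].
Qed.

Lemma parsed_record ls rl A y b c : parsed ls rl A ->
  parsed ls ((y, (b, c)) :: rl)
    (aupd (aupd (aupd (aupd A fOA (size rl).+1 b) fOB (size rl).+1 c) fNX (size rl).+1 (A fHD y))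
      fHD y (size rl).+1).
Proof.
case=> h1 h2 h3 h4 h5 h6; split=> //; first exact: chains_add.
by case=> x; [exact: (h6 true x)|exact: (h6 false x)].
Qed.

Definition tables ls rl s :=
  [/\ parsed ls rl (ar s), consts s, rg s rC = size ls & rg s rR = size rl].

Definition literals := While rS literal.

Lemma literals_wp (Q : st -> Prop) s f1 c f2 ls rl : inp = enc (f1 ++ c :: f2) ->
  tables ls rl s -> rg s rI = (size (enc f1)).+1 -> rg s rS = size c -> regs3 s = (0, 0, 0) ->
  (forall s', tables (ls ++ c) rl s' -> rg s' rI = size (enc (rcons f1 c)) ->
    rg s' rN = rg s rN -> regs3 s' = dd [seq ix l | l <- c] ->
    tm s' <= tm s + 500 * size c + 10 -> Q s') ->
  wp literals Q s.
Proof.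
move=> einp ht eI eS e3 hQ.
pose I n s' := exists c1 c2, [/\ c = c1 ++ c2, n = size c2, rg s' rS = size c2 &
  [/\ tables (ls ++ c1) rl s', rg s' rI = (size (enc f1)).+1 + 2 * size c1, rg s' rN = rg s rN,
    regs3 s' = dd [seq ix l | l <- c1] & tm s' + 500 * size c2 <= tm s + 500 * size c]].
apply: (@wp_while _ _ _ _ _ I _ (size c)).
- by exists [::], c; split=> //; split; rewrite ?cats0 // eI muln0 addn0.
- move=> n s' [c1 [c2 [ec _ eS' [h1 h2 h3 h4 h5]]]] z.
  have c20 : c2 = [::] by apply/nilP; rewrite /nilp -eS' z.
  rewrite c20 cats0 in ec; rewrite -ec in h1 h2 h4; apply: hQ => //=.
    rewrite h2 /enc -cats1 map_cat flatten_cat size_cat /= cats0 /enc_clause /=.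
    suff -> : size (flatten (map enc_lit c)) = 2 * size c by lia.
    by elim: (c) => //= l k ->; lia.
  by move: h5; rewrite c20 /=; lia.
move=> n s' [c1 [c2 [ec en eS' [[hp hc hC hR] h2 h3 h4 h5]]]] nz.
case: c2 => [|l c2] in ec en eS' h5; first by case: nz.
have enth k : k < 2 -> nth 0 inp (rg s' rI + k) = nth 0 (enc_lit l) k.
  move=> hk; rewrite einp h2 /enc map_cat flatten_cat nth_cat -/(enc f1).
  rewrite (_ : (size (enc f1)).+1 + 2 * size c1 + k - size (enc f1) = (2 * size c1 + k).+1); last by lia.
  rewrite ifF; last by lia.
  rewrite /= ec map_cat flatten_cat -catA nth_cat.
  have -> : size (flatten (map enc_lit c1)) = 2 * size c1 by elim: (c1) => //= m c' ->; lia.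
  by rewrite ifF ?addKn; [case: k hk => [|[]]|lia].
case: l => v b in ec en eS' h5 enth *.
have e0 : nth 0 inp (rg (tick s') rI) = v by have := enth 0 isT; rewrite addn0.
have e1 : nth 0 inp (rg (tick s') rI).+1 = b by have := enth 1 isT; rewrite addn1.
refine (literal_wp _ e0 e1 _); first by []. move=> s2 eI2 eS2 eC2 e32 eA2 et2 [fr _].
exists (size c2); first by rewrite en.
exists (rcons c1 (v, b)), c2; split.
- by rewrite cat_rcons.
- by [].
- by rewrite eS2 /= eS'.
split.
- split.
  + by rewrite eA2 -rcons_cat hC; apply: (parsed_literal (v, b)).
  + by case: hc => a1 a2 a3; split; rewrite fr.
  + by rewrite eC2 /= hC -rcons_cat size_rcons.
  + by rewrite fr.
- by rewrite eI2 /= h2 size_rcons; lia.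
- by rewrite fr // h3.
- by rewrite e32 map_rcons /dd foldl_rcons -/(dd _) -h4.
- by move: et2 h5; rewrite /=; lia.
Qed.

End Verify.

Definition clause :=
  Inp rS rI ;; Add rI rI rOne ;; Set_ rL1 0 ;; Set_ rL2 0 ;; Set_ rL3 0 ;; literals ;;
  add_record rL1 rL2 rL3 ;; add_record rL2 rL1 rL3 ;; add_record rL3 rL1 rL2 ;;
  Sub rT rN rI.

Definition parse :=
  Set_ rOne 1 ;; Set_ rTwo 2 ;; Set_ rZ 0 ;; Set_ rI 0 ;; Set_ rC 0 ;; Set_ rR 0 ;;
  Put fNG rZ rOne ;; Put 2 rOne rOne ;; Put 3 rOne rOne ;; Sub rT rN rI ;;
  While rT clause.

Lemma dd_sub s x : x \in tseq (dd s) -> x \in 0 :: s.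
Proof.
elim/last_ind: s => [|s y IH]; first by rewrite !inE => /or3P [].
rewrite /dd foldl_rcons -/(dd s); move: IH; case: (dd s) => [[a b] c] IH /=.
have up : x \in tseq (a, b, c) -> x \in 0 :: rcons s y.
  by move=> /IH; rewrite !inE mem_rcons inE => /orP [->|->] //; rewrite !orbT.
case: ifP => _ //; rewrite !inE => /or3P [] h.
- by rewrite mem_rcons inE h orbT.
- by rewrite -in_cons up // !inE h.
- by rewrite -in_cons up // !inE h orbT.
Qed.

Lemma records_rcons f c : records (rcons f c) = rc (dd [seq ix l | l <- c]) ++ records f.
Proof. by rewrite /records rev_rcons. Qed.

Section Verify.

Variables (R : nat) (inp : seq nat) (D : nat).
Local Notation wp := (wp R inp D).

Lemma add_record_tables (Q : st -> Prop) s ls rl a b c :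
  a \in [:: rL1; rL2; rL3] -> b \in [:: rL1; rL2; rL3] -> c \in [:: rL1; rL2; rL3] ->
  tables ls rl s -> rg s a \in 0 :: [seq ix l | l <- ls] ->
  (forall s', tables ls ((nx (rg s a), (rg s b, rg s c)) :: rl) s' -> regs3 s' = regs3 s ->
     rg s' rI = rg s rI -> rg s' rN = rg s rN -> tm s' <= tm s + 100 -> Q s') ->
  wp (add_record a b c) Q s.
Proof.
move=> ha hb hc [hp hcs hC hR] hal hQ.
have ex : ar s fNG (rg s a) = nx (rg s a).
  move: hal; rewrite inE => /orP [/eqP ->|/mapP [l hl ->]]; first exact: (p_neg0 hp).
  exact: (p_neg hp).
refine (add_record_wp _ _ _ hcs ha hb hc ex _) => s' eR eA et [fr _].
have fr' r : r \notin [:: rY; rR; rH] -> rg s' r = rg s r by move=> hr; apply: fr.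
apply: hQ => //; try exact: fr'.
- split; last by rewrite eR hR.
  + by rewrite eA hR; apply: parsed_record.
  + by case: hcs => *; split; rewrite fr'.
  + by rewrite fr'.
- by rewrite /regs3 !fr'.
Qed.

Lemma clause_wp (Q : st -> Prop) s f1 c f2 : inp = enc (f1 ++ c :: f2) ->
  tables (flatten f1) (records f1) s -> rg s rI = size (enc f1) ->
  (forall s', tables (flatten (rcons f1 c)) (records (rcons f1 c)) s' ->
    rg s' rI = size (enc (rcons f1 c)) -> rg s' rN = rg s rN -> rg s' rT = rg s' rN - rg s' rI ->
    tm s' <= tm s + 500 * size c + 400 -> Q s') ->
  wp clause Q s.
Proof.
move=> einp ht eI hQ; have [hp hcs hC hR] := ht; have [c1 c2 c0] := hcs.
have ei : nth 0 inp (size (enc f1)) = size c.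
  by rewrite einp /enc map_cat flatten_cat nth_cat ltnn subnn.
rewrite /clause; do 5 wstep; wseq.
refine (literals_wp einp (ls := flatten f1) (rl := records f1) _ _ _ _ _).
- by split=> //=; rewrite /upd.
- by rewrite /= /upd /= addn1.
- by rewrite /= /upd.
- by rewrite /regs3 /= /upd.
move=> s1 ht1 eI1 eN1 e31 et1.
have mem3 x : x \in tseq (regs3 s1) -> x \in 0 :: [seq ix l | l <- flatten f1 ++ c].
  rewrite e31 => /dd_sub; rewrite !inE map_cat mem_cat => /orP [->|->] //; by rewrite !orbT.
wseq; refine (@add_record_tables _ _ _ _ rL1 rL2 rL3 isT isT isT ht1 _ _).
  by apply: mem3; rewrite !inE eqxx.
move=> s2 ht2 e32 eI2 eN2 et2.
have [q1 q2 q3] : [/\ rg s2 rL1 = rg s1 rL1, rg s2 rL2 = rg s1 rL2 & rg s2 rL3 = rg s1 rL3].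
  by case: e32.
wseq; refine (@add_record_tables _ _ _ _ rL2 rL1 rL3 isT isT isT ht2 _ _).
  by apply: mem3; rewrite q2 !inE eqxx orbT.
move=> s3 ht3 e33 eI3 eN3 et3.
have [r1 r2 r3] : [/\ rg s3 rL1 = rg s2 rL1, rg s3 rL2 = rg s2 rL2 & rg s3 rL3 = rg s2 rL3].
  by case: e33.
wseq; refine (@add_record_tables _ _ _ _ rL3 rL1 rL2 isT isT isT ht3 _ _).
  by apply: mem3; rewrite r3 q3 !inE eqxx !orbT.
move=> s4 ht4 e34 eI4 eN4 et4.
wstep; apply: hQ.
- have [hp4 [d1 d2 d3] hC4 hR4] := ht4.
  rewrite flatten_rcons records_rcons -e31 /regs3 /rc.
  by rewrite r3 r1 r2 q1 q2 q3 in hp4 hR4; split=> //=; rewrite /upd.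
- by rewrite /= /upd /= eI4 eI3 eI2.
- by rewrite /= /upd /= eN4 eN3 eN2.
- by rewrite /= /upd /= eN4 eI4.
- by move: et1 et2 et3 et4; rewrite /=; lia.
Qed.

Lemma size_enc_rcons f c : size (enc (rcons f c)) = size (enc f) + 1 + 2 * size c.
Proof.
rewrite /enc -cats1 map_cat flatten_cat size_cat /= cats0 /enc_clause /=.
suff -> : size (flatten (map enc_lit c)) = 2 * size c by lia.
by elim: (c) => //= l k ->; lia.
Qed.

Lemma parse_wp (Q : st -> Prop) s f : inp = enc f -> (forall i j, ar s i j = 0) ->
  rg s rN = size inp ->
  (forall s', tables (flatten f) (records f) s' -> rg s' rN = size inp ->
     tm s' <= tm s + 500 * size inp + 200 -> Q s') ->
  wp parse Q s.
Proof.
move=> einp ar0 eN hQ; rewrite /parse; do 10 wstep.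
set s0 := setr rT _ _.
pose I n s' := exists f1 f2, [/\ f = f1 ++ f2, n = size f2, rg s' rI = size (enc f1) &
  [/\ tables (flatten f1) (records f1) s', rg s' rN = size inp, rg s' rT = rg s' rN - rg s' rI &
    tm s' <= tm s + 500 * size (enc f1) + 110]].
refine (@wp_while _ _ _ _ _ I _ (size f) _ _ _ _).
- exists [::], f; split=> //; split.
  + split=> //; split=> //=.
    * by move=> x; rewrite /s0 /aupd /= ar0; constructor.
    * by case=> x; rewrite /s0 /aupd /= !ar0; case: eqP.
  + by rewrite /s0 /= /upd.
  + by rewrite /s0 /= /upd /= eN.
  + by rewrite /s0 /=; lia.
- move=> n s' [f1 [f2 [ef en eI [ht eN' eT et]]]] z.
  have ef2 : f2 = [::].
    case: f2 ef {en} => // c f2 ef; move: eT; rewrite z eN' einp ef eI.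
    rewrite /enc map_cat flatten_cat size_cat /=; lia.
  rewrite ef2 cats0 in ef; rewrite -ef in ht et; apply: hQ => //=.
  by move: et; rewrite -einp; lia.
move=> n s' [f1 [f2 [ef en eI [ht eN' eT et]]]] nz.
case: f2 => [|c f2] in ef en.
  by case: nz; rewrite eT eN' eI einp ef cats0 subnn.
have einp' : inp = enc (f1 ++ c :: f2) by rewrite -ef.
have ht' : tables (flatten f1) (records f1) (tick s') by [].
refine (clause_wp einp' ht' eI _) => s2 ht2 eI2 eN2 eT2 et2.
exists (size f2); first by rewrite en.
exists (rcons f1 c), f2; split; rewrite ?cat_rcons //; split=> //; first by rewrite eN2.
by move: et et2; rewrite size_enc_rcons /=; lia.
Qed.

End Verify.

(** * Propagation from one literal *)

(* One copy per side of the lockstep: current record, read and write ends of the queue, conflict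
   and finished flags; the fields are the truth values and the queue. *)
Notation rP d := (35 + nat_of_bool d). Notation rG := 38.
Notation cur b := (24 + nat_of_bool b). Notation qr b := (26 + nat_of_bool b).
Notation qw b := (28 + nat_of_bool b). Notation cf b := (30 + nat_of_bool b).
Notation fin b := (32 + nat_of_bool b).
Notation fV b := (2 + nat_of_bool b). Notation fQ b := (4 + nat_of_bool b).

(** Forcing the padding literal 0 ends in the conflict branch, because its negation 1 is always
    marked true. *)
Definition force b d :=
  Get rY fNG (rP d) ;; Get rE (fV b) rY ;;
  Ifz rE (Get rF (fV b) (rP d) ;;
          Ifz rF (Put (fV b) (rP d) rOne ;; Put (fQ b) (qw b) (rP d) ;; Add (qw b) (qw b) rOne)
            (Set_ rE 0))
         (Set_ (cf b) 1).

Definition force_if b d :=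
  Get rY fNG (rP d) ;; Get rE (fV b) rY ;; Ifz rE (Set_ rE 0) (force b (~~ d)).

Definition visit b :=
  Get (rP false) fOA (cur b) ;; Get (rP true) fOB (cur b) ;; Get (cur b) fNX (cur b) ;;
  force_if b false ;; force_if b true.

Definition pop b := Get rS (fQ b) (qr b) ;; Add (qr b) (qr b) rOne ;; Get (cur b) fHD rS.

Definition advance b :=
  Add rE (cf b) (fin b) ;;
  Ifz rE (Ifz (cur b) (Sub rE (qw b) (qr b) ;; Ifz rE (Set_ (fin b) 1) (pop b)) (visit b))
    (Set_ rE 0).

(* Of the three records of a clause, the second to be visited triggers the propagation, so
   closure is stated for pairs of visited records. *)
Definition pairclosed (Sn : nat * (nat * nat) -> Prop) (M : nat -> bool) := forall x a b,
  Sn (x, (a, b)) ->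
  ((a = 0 \/ Sn (nx a, (nx x, b)) \/ Sn (nx a, (b, nx x))) -> M b) /\
  ((b = 0 \/ Sn (nx b, (nx x, a)) \/ Sn (nx b, (a, nx x))) -> M a).

(** In a pair containing the new record, the partner is already visited or is the new record itself,
    so its trigger lies in [M] and the checks made during the visit cover the pair. *)
Lemma pairclosed_visit (Sn : nat * (nat * nat) -> Prop) (M M' : pred nat) x a b :
  pairclosed Sn M -> (forall r, Sn r -> M r.1) -> M x -> (forall y, M y -> M' y) ->
  (a = 0 \/ M (nx a) -> M' b) -> (b = 0 \/ M (nx b) -> M' a) ->
  pairclosed (fun r => Sn r \/ r = (x, (a, b))) M'.
Proof.
move=> pc SM Mx MM' ha hb.
have SM' r : Sn r \/ r = (x, (a, b)) -> M r.1 by case=> [/SM|->].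
move=> x' a' b' [h|[-> -> ->]]; last first.
  split; [case=> [e|hs]; apply: ha|case=> [e|hs]; apply: hb]; try by left.
    by right; case: hs => /SM'.
  by right; case: hs => /SM'.
have [h1 h2] := pc _ _ _ h; have Mx' : M x' := SM _ h.
have new y z : (nx y, (nx x', z)) = (x, (a, b)) \/ (nx y, (z, nx x')) = (x, (a, b)) -> M' z.
  by case=> [[_ e1 e2]|[_ e1 e2]]; [rewrite e2; apply: ha|rewrite e1; apply: hb];
     right; rewrite -?e1 -?e2 nxK.
split=> [[e|[[hs|hs]|[hs|hs]]]|[e|[[hs|hs]|[hs|hs]]]].
- by apply: MM'; apply: h1; left.
- by apply: MM'; apply: h1; right; left.
- by apply: (new a'); left.
- by apply: MM'; apply: h1; right; right.
- by apply: (new a'); right.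
- by apply: MM'; apply: h2; left.
- by apply: MM'; apply: h2; right; left.
- by apply: (new b'); left.
- by apply: MM'; apply: h2; right; right.
- by apply: (new b'); right.
Qed.

Lemma records_sym f x a b : (x, (a, b)) \in records f ->
  ((nx a, (nx x, b)) \in records f \/ (nx a, (b, nx x)) \in records f) /\
  ((nx b, (nx x, a)) \in records f \/ (nx b, (a, nx x)) \in records f).
Proof.
case/recordsP=> c cf h.
have key r : r \in rc (dd [seq ix l | l <- c]) -> r \in records f by move=> hr; apply/recordsP; exists c.
move: h key; case: (dd _) => [[p q] r]; rewrite !inE => /or3P [] /eqP [-> -> ->] key; rewrite !nxK.
- by split; right; apply: key; rewrite /rc !inE eqxx ?orbT.
- by split; [left|right]; apply: key; rewrite /rc !inE eqxx ?orbT.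
- by split; left; apply: key; rewrite /rc !inE eqxx ?orbT.
Qed.

Lemma pairclosed_rclosed f (Sn : nat * (nat * nat) -> Prop) (M : pred nat) :
  pairclosed Sn M -> (forall x p, (x, p) \in records f -> M x -> Sn (x, p)) ->
  rclosed (records f) M.
Proof.
move=> pc cov x a b hr Mx; have [h1 h2] := pc _ _ _ (cov _ _ hr Mx).
have [s1 s2] := records_sym hr; split=> [[e|h]|[e|h]].
- by apply: h1; left.
- by apply: h1; right; case: s1 => /cov; [left|right]; auto.
- by apply: h2; left.
- by apply: h2; right; case: s2 => /cov; [left|right]; auto.
Qed.

Ltac nb := first [reflexivity | solve [match goal with b : bool |- _ => destruct b; reflexivity end]].

Ltac rd ::= lazymatch goal with
  | |- rg (setr ?d _ _) ?d = _ => apply rg_eq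
  | |- rg (setr _ _ _) _ = _ => first [apply rg_ne; [nb | rd] | apply rg_eq]
  | |- rg (seta _ _ _ _) _ = _ => apply rg_seta; rd
  | |- rg (seto _ _ _) _ = _ => apply rg_seto; rd
  | |- rg (tick _) _ = _ => apply rg_tick; rd
  | |- ar (setr _ _ _) _ _ = _ => apply ar_setr; rd
  | |- ar (tick _) _ _ = _ => apply ar_tick; rd
  | |- ar (seta _ _ _ _) _ _ = _ => first [apply ar_ne; [nb | rd] | eassumption | reflexivity]
  | |- _ => first [eassumption | reflexivity]
  end.

Section Verify.

Variables (R : nat) (inp : seq nat) (D : nat).
Local Notation wp := (wp R inp D).
Variable f : seq (seq lit).
Hypothesis fsz : forall c, c \in f -> c != [::] /\ size (undup c) <= 3.
Local Notation rl := (records f).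

Record based (A : nat -> nat -> nat) : Prop := {
  b_chains : chains A (size rl) rl;
  b_neg : forall x, x = 0 \/ occ f x -> A fNG x = nx x;
  b_lst : forall j, j < size (flatten f) -> A fLST j = nth 0 [seq ix l | l <- flatten f] j;
  b_lsv : forall j, j < size (flatten f) -> A fLSV j = nth 0 [seq l.1 | l <- flatten f] j }.

Lemma based_ext A A' : based A -> (forall g, g \notin [:: 2; 3; 4; 5] -> A' g =1 A g) -> based A'.
Proof.
case=> h1 h2 h3 h4 e; split; try by [move=> x h; rewrite e // h2|move=> j h; rewrite e // (h3, h4)].
move=> x; rewrite e //; apply: (chain_ext (h1 x)) => // g i hg _; rewrite e //.
by move: hg; rewrite !inE => /or3P [] /eqP ->.
Qed.

Variable (A0 : pred nat).

Definition ext_of root (S : nat -> Prop) :=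
  [/\ forall y, A0 y -> S y, S root, nxfree S & rclosed rl S].

(** [q_sound] puts every queued literal into each consistent closed extension that contains the
    root, so a conflict refutes the root. *)
Record queued (b : bool) root (qs : seq nat) s : Prop := {
  q_base : based (ar s);
  q_one : rg s rOne = 1;
  q_size : rg s (qw b) = size qs;
  q_nth : forall i, i < size qs -> ar s (fQ b) i = nth 0 qs i;
  q_val : forall x, ar s (fV b) x = [|| A0 x, x \in qs | x == 1];
  q_uniq : uniq qs;
  q_occ : forall x, x \in qs -> occ f x && ~~ A0 x;
  q_free : nxfree (fun x => A0 x || (x \in qs));
  q_sound : forall S, ext_of root S -> forall x, x \in qs -> S x;
  q_root : root \in qs }.

Lemma occ_ge2 x : occ f x -> 1 < x.
Proof. by case/occP=> l _ ->; rewrite /ix; lia. Qed.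

Lemma queued_push b root qs s s' v : queued b root qs s -> occ f v -> ~~ A0 v -> v \notin qs ->
  ~~ A0 (nx v) -> nx v \notin qs -> (forall S, ext_of root S -> S v) ->
  based (ar s') -> rg s' rOne = 1 -> rg s' (qw b) = (size qs).+1 ->
  ar s' (fQ b) = aupd (ar s) (fQ b) (size qs) v (fQ b) ->
  ar s' (fV b) = aupd (ar s) (fV b) v 1 (fV b) -> queued b root (rcons qs v) s'.
Proof.
case=> h1 h2 h3 h4 h5 h6 h7 [h8 h8'] h9 h10 ov nv vq nnv nvq Sv e1 e2 e3 e4 e5.
have v2 := occ_ge2 ov; split=> //.
- by rewrite e3 size_rcons.
- move=> i; rewrite size_rcons ltnS e4 /aupd eqxx /= nth_rcons.
  by case: ltngtP => // hi _; apply: h4.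
- move=> x; rewrite e5 /aupd eqxx /= mem_rcons inE h5.
  by case: eqP => // ->; rewrite orbT.
- by rewrite rcons_uniq vq.
- by move=> x; rewrite mem_rcons inE => /orP [/eqP ->|/h7 //]; rewrite ov.
- split=> [|x].
    by rewrite mem_rcons inE; move: h8; case: (A0 0) (0 \in qs) => [] [] //= _; case: eqP => // e; lia.
  rewrite !mem_rcons !inE; case: (eqVneq x v) => [->|xv] /=.
    by rewrite (negbTE nnv) (negbTE nvq) orbF => _ /eqP; apply: nx_neq.
  case: (eqVneq (nx x) v) => [e|_] /=; last exact: h8'.
  by rewrite -e nxK in nnv nvq; rewrite (negbTE nnv) (negbTE nvq).
- by move=> S hS x; rewrite mem_rcons inE => /orP [/eqP ->|]; [apply: Sv|apply: h9].
- by rewrite mem_rcons inE h10 orbT.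
Qed.

Definition pushed (qs qs' : seq nat) v :=
  qs' = qs \/ [/\ qs' = rcons qs v, v \notin qs, ~~ A0 v & occ f v].

Lemma pushed_size qs qs' v : pushed qs qs' v -> size qs' <= (size qs).+1.
Proof. by case=> [->|[-> _ _ _]]; rewrite ?size_rcons. Qed.

Lemma pushed_sub qs qs' v x : pushed qs qs' v -> x \in qs -> x \in qs'.
Proof. by case=> [->|[-> _ _ _]] // h; rewrite mem_rcons inE h orbT. Qed.

Lemma queued_frame b root qs s s' : queued b root qs s -> ar s' = ar s ->
  rg s' rOne = rg s rOne -> rg s' (qw b) = rg s (qw b) -> queued b root qs s'.
Proof. by case=> h1 h2 h3 h4 h5 h6 h7 h8 h9 h10 eA e1 e2; split; rewrite ?eA ?e1 ?e2. Qed.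

Lemma force_wp b d (Q : st -> Prop) s root qs v : queued b root qs s ->
  rg s (rP d) = v -> (v = 0 \/ occ f v) -> (forall S, ext_of root S -> S v) ->
  (forall s' qs', queued b root qs' s' -> tm s' <= tm s + 100 ->
     (rg s' (cf b) = 1 /\ no_ext f A0 root) /\ qs' = qs \/
     [/\ rg s' (cf b) = rg s (cf b), A0 v || (v \in qs') & pushed qs qs' v] -> Q s') ->
  wp (force b d) Q s.
Proof.
move=> hq ev hv Sv hQ; have [hb e1 eqw hn hval hu ho hf hs _] := hq.
have eN : ar s fNG v = nx v := b_neg hb hv.
rewrite /force; do 2 wstep; rewrite hval.
wstep => [z|nz]; last first.
  wstep; apply: (hQ _ qs); first by apply: queued_frame hq _ _ _ => //; rd.
    by rewrite /=; lia.
  left; split=> //; split; first by rd.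
  move=> S h1 h2 h3 h4; have SS : ext_of root S by [].
  have [n0 nf] := h3; have := Sv _ SS.
  case: (v =P 0) => [-> //|/eqP v0] /nf; apply.
  move: nz; case: (boolP (A0 (nx v))) => [/h1 //|_].
  case: (boolP (nx v \in qs)) => [/(hs _ SS) //|_].
  by case: eqP => // /nx_eq1 e; rewrite e in v0.
have [nA nq n1] : [/\ ~~ A0 (nx v), nx v \notin qs & nx v != 1].
  by move: z; case: (A0 _) (nx v \in qs) (nx v == 1) => [] [] [].
have ov : occ f v by case: hv => // v0; rewrite v0 in n1.
have v2 := occ_ge2 ov.
wstep; rewrite hval (_ : (v == 1) = false) ?orbF; last by lia.
wstep => [z'|nz'].
  have [nAv nqv] : ~~ A0 v /\ v \notin qs by move: z'; case: (A0 v) (v \in qs) => [] [].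
  do 3 wstep.
  apply: (hQ _ (rcons qs v)).
  - apply: (queued_push hq ov nAv nqv nA nq Sv); try rd.
    + by apply: (based_ext hb) => g hg i /=; rewrite /aupd; case: (b) hg => hg;
        case: eqP hg => [->|_ hg] //=; case: eqP hg => [->|].
    + by rewrite rg_eq addn1.
    + by rewrite /= /aupd; case: (b).
    + by rewrite /= /aupd; case: (b).
  - by rewrite /=; lia.
  - right; split; [by rd|by rewrite mem_rcons inE eqxx orbT|by right].
wstep; apply: (hQ _ qs); first by apply: queued_frame hq _ _ _ => //; rd.
  by rewrite /=; lia.
by right; split; [rd| |left]; move: nz'; case: (A0 v) (v \in qs) => [] [].
Qed.

Definition marks (qs : seq nat) : pred nat := fun x => A0 x || (x \in qs).

Lemma force_if_wp b d (Q : st -> Prop) s root qs u v : queued b root qs s ->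
  rg s (rP d) = u -> rg s (rP (~~ d)) = v -> (u = 0 \/ occ f u) -> (v = 0 \/ occ f v) ->
  (forall S, ext_of root S -> u = 0 \/ S (nx u) -> S v) ->
  (forall s' qs', queued b root qs' s' -> tm s' <= tm s + 150 ->
     frame (mods (force_if b d)) (fmods (force_if b d)) s s' ->
     (rg s' (cf b) = 1 /\ no_ext f A0 root) /\ qs' = qs \/
     [/\ rg s' (cf b) = rg s (cf b), u = 0 \/ marks qs (nx u) -> marks qs' v
       & pushed qs qs' v] -> Q s') ->
  wp (force_if b d) Q s.
Proof.
move=> hq eu ev hu hv Sv hQ; have [hb e1 eqw hn hval huq ho hf hs _] := hq.
refine (wp_frame_gen _) => F eF.
have eN : ar s fNG u = nx u := b_neg hb hu.
rewrite /force_if; do 2 wstep; rewrite hval; wstep => [z|nz].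
  wstep; rewrite eF => fr; apply: (hQ _ qs).
  - by apply: queued_frame hq _ _ _ => //; rd.
  - by rewrite /=; lia.
  - exact: fr.
  right; split; [by rd| |by left].
  case=> [u0|mu]; first by rewrite u0 /= !orbT in z.
  by move: z; rewrite /marks in mu; rewrite orbA mu.
have mark : u = 0 \/ marks qs (nx u).
  move: nz; rewrite orbA -/(marks qs (nx u)); case: (marks _ _) => //=; first by right.
  by case: eqP => // /nx_eq1; left.
refine (@force_wp b (~~ d) _ _ root qs v _ _ hv _ _).
- by apply: queued_frame hq _ _ _ => //; rd.
- by rd.
- move=> S hS; apply: (Sv _ hS); case: mark => [|mu]; [by left|right].
  by case/orP: mu => [/(let: And4 h _ _ _ := hS in h)|/(hs _ hS)].
move=> s' qs' hq' ht' hR; rewrite eF => fr; apply: (hQ _ qs' hq' _ fr); first by move: ht'; rewrite /=; lia.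
case: hR => [h|[h1 h2 h3]]; [by left|by right; split].
Qed.

Lemma chain_inv A bd h a c l : chain A bd h ((a, c) :: l) ->
  [/\ A fOA h = a, A fOB h = c & chain A bd (A fNX h) l].
Proof. by move=> hc; inversion hc. Qed.

Lemma chain_eq0 A bd h l : chain A bd h l -> (h == 0) = (l == [::]).
Proof. by case=> // {}h a b l' /andP [h0 _] *; rewrite eqn0Ngt h0. Qed.

Lemma record_occ x a c : (x, (a, c)) \in rl -> (a = 0 \/ occ f a) /\ (c = 0 \/ occ f c).
Proof.
case/(records_clause fsz) => d df [h _].
have key y : y \in [:: nx x; a; c] -> y = 0 \/ occ f y.
  move=> hy; case: (eqVneq y 0) => [|/eqP y0]; [by left|right].
  by apply/occP; have [l ld ->] := h y hy y0; exists l => //; exists d.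
by split; apply: key; rewrite !inE eqxx ?orbT.
Qed.

Variable U : seq nat.
Hypotheses (uU : uniq U) (occU : forall x, occ f x -> x \in U).

Lemma pot_push qs v : occ f v -> ~~ A0 v -> v \notin qs ->
  pot rl U (marks qs) = weight rl v + pot rl U (marks (rcons qs v)).
Proof.
move=> ov nv nq; rewrite (pot_mark rl uU (occU ov)); last by rewrite /marks negb_or nv.
by congr (_ + _); apply: eq_pot => x; rewrite /marks mem_rcons inE orbAC -orbA orbCA orbA orbC orbA orbAC.
Qed.

(** A push moves the weight of a literal out of [pot]; it is held here until the literal is
    popped. *)
Definition pending k (qs : seq nat) := \sum_(x <- drop k qs) weight rl x.

Lemma sum_rcons (F : nat -> nat) t x : \sum_(y <- rcons t x) F y = \sum_(y <- t) F y + F x.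
Proof. by rewrite -cats1 big_cat big_seq1. Qed.

Lemma pot_pushed k qs qs' v : k <= size qs -> pushed qs qs' v ->
  pot rl U (marks qs') + pending k qs' = pot rl U (marks qs) + pending k qs.
Proof.
move=> hk [->|[-> nq nv ov]] //; rewrite (pot_push ov nv nq) /pending drop_rcons //.
by rewrite sum_rcons addnA addnC addnA.
Qed.

(* [rest] is the unvisited part of the record list of the last literal popped from the queue,
   [Sn] the set of records visited so far. *)
Record inprogress b root P qs k rest (Sn : nat * (nat * nat) -> Prop) s : Prop := {
  i_queued : queued b root qs s;
  i_cf : rg s (cf b) = 0;
  i_fin : rg s (fin b) = 0;
  i_qr : rg s (qr b) = k;
  i_k : k <= size qs;
  i_cur : chain (ar s) (size rl) (rg s (cur b)) rest;
  i_pc : pairclosed Sn (marks qs);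
  i_seen : forall r, Sn r -> marks qs r.1;
  i_old : forall x p, (x, p) \in rl -> A0 x -> Sn (x, p);
  i_cov : forall i p, i < k -> (nth 0 qs i, p) \in rl ->
    Sn (nth 0 qs i, p) \/ (i.+1 = k /\ p \in rest);
  i_rest : rest != [::] -> 0 < k /\ forall p, p \in rest -> (nth 0 qs k.-1, p) \in rl;
  i_pot : pot rl U (marks qs) + pending k qs + size rest <= P }.

(** Here [i] counts the calls of [advance]. While running, each lowers the fuel [P] by one; a call
    pushes at most two literals, hence [1 + 2 * i]. The call that merely detects the empty queue
    consumes no fuel, hence [P0.+1] in the last case. *)
Inductive side b root P0 i s : Prop :=
| side_run qs k rest Sn P of inprogress b root P qs k rest Sn s & P + i <= P0 & size qs <= 1 + 2 * i
| side_conf qs of queued b root qs s & rg s (cf b) = 1 & rg s (fin b) = 0 & no_ext f A0 root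
    & size qs <= 1 + 2 * i
| side_done qs of queued b root qs s & rg s (cf b) = 0 & rg s (fin b) = 1 & rclosed rl (marks qs)
    & pot rl U (marks qs) + i <= P0.+1 & size qs <= 1 + 2 * i.

Lemma nth_pushed qs qs' v i : pushed qs qs' v -> i < size qs -> nth 0 qs' i = nth 0 qs i.
Proof. by case=> [->|[-> _ _ _]] // h; rewrite nth_rcons h. Qed.

Lemma marks_pushed qs qs' v x : pushed qs qs' v -> marks qs x -> marks qs' x.
Proof. by move=> h /orP [hA|hq]; rewrite /marks; [rewrite hA|rewrite (pushed_sub h hq) orbT]. Qed.

Lemma fmods_force b d g : g \notin [:: 2; 3; 4; 5] -> g \notin fmods (force_if b d).
Proof. by apply: contra; case: b; rewrite /= !inE => /orP [] /eqP ->. Qed.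

Lemma visit_wp b (Q : st -> Prop) s root P P0 i qs k r rest Sn :
  inprogress b root P qs k (r :: rest) Sn s -> P + i <= P0 -> size qs <= 1 + 2 * i ->
  (forall s', side b root P0 i.+1 s' -> tm s' <= tm s + 400 -> Q s') ->
  wp (visit b) Q s.
Proof.
case: r => a c [hq hcf hfin hqr hk hcur hpc hseen hold hcov hrest hpot] hP hsz hQ.
have [ea ec hcur'] := chain_inv hcur.
have [k0 hr] := hrest isT; set x := nth 0 qs k.-1 in hr.
have hxr : (x, (a, c)) \in rl by apply: hr; rewrite mem_head.
have xq : x \in qs by apply: mem_nth; rewrite prednK.
have [oa oc] := record_occ hxr.
have hS S : ext_of root S -> ((a = 0 \/ S (nx a)) -> S c) /\ ((c = 0 \/ S (nx c)) -> S a).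
  by move=> hS; have Sx := q_sound hq hS xq; case: hS => _ _ _ rS; apply: rS hxr Sx.
rewrite /visit; do 3 wstep; wseq.
set s0 := setr (cur b) _ _.
have hq0 : queued b root qs s0 by apply: queued_frame hq _ _ _ => //; rewrite /s0; rd.
refine (@force_if_wp b false _ s0 root qs a c hq0 _ _ oa oc (fun S h => (hS S h).1) _).
- by rewrite /s0; rd.
- by rewrite /s0; rd.
move=> s1 qs1 hq1 ht1 [fr1 fa1] hR1.
refine (@force_if_wp b true _ s1 root qs1 c a hq1 _ _ oc oa (fun S h => (hS S h).2) _).
- by rewrite fr1; [rewrite /s0; rd|nb].
- by rewrite fr1; [rewrite /s0; rd|nb].
move=> s2 qs2 hq2 ht2 [fr2 fa2] hR2.
have et : tm s2 <= tm s + 400 by move: ht1 ht2; rewrite /s0 /=; lia.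
have [eqr ecur efin] : [/\ rg s2 (qr b) = k, rg s2 (cur b) = ar s 8 (rg s (cur b)) & rg s2 (fin b) = 0].
  by split; (rewrite fr2; [|nb]); (rewrite fr1; [|nb]); rewrite /s0; rd.
have ecf0 : rg s0 (cf b) = 0 by rewrite /s0; rd.
have hz : size qs2 <= 1 + 2 * i.+1 /\ size qs1 <= 1 + 2 * i.+1.
  have z1 : size qs1 <= (size qs).+1 by case: hR1 => [[_ ->]|[_ _ /pushed_size //]]; lia.
  by case: hR2 => [[_ ->]|[_ _ /pushed_size h]]; split; lia.
have [z2 z1] := hz.
apply: hQ et.
case: hR2 => [[[ecf hne] e2]|[ecf2 hm2 hp2]]; first exact: (side_conf _ hq2).
case: hR1 => [[[ecf hne] e1]|[ecf1 hm1 hp1]].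
  by apply: (side_conf _ hq2) => //; rewrite ecf2.
apply: (@side_run _ _ _ _ _ qs2 k rest (fun r => Sn r \/ r = (x, (a, c))) P.-1) => //; last first.
  by move: hpot hP => /=; lia.
have k1 : k <= size qs1 by apply: leq_trans hk _; case: hp1 => [->|[-> _ _ _]]; rewrite ?size_rcons.
have nth2 j : j < k -> nth 0 qs2 j = nth 0 qs j.
  by move=> hj; rewrite (nth_pushed hp2) ?(nth_pushed hp1) //; lia.
have Mx : marks qs x by rewrite /marks xq orbT.
have M12 y : marks qs y -> marks qs2 y by move=> /(marks_pushed hp1) /(marks_pushed hp2).
split=> //.
- by rewrite ecf2 ecf1.
- by apply: leq_trans k1 _; case: hp2 => [->|[-> _ _ _]]; rewrite ?size_rcons.
- rewrite ecur; apply: (chain_ext hcur') => // g j hg _.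
  have gn : g \notin [:: 2; 3; 4; 5] by move: hg; rewrite !inE => /or3P [] /eqP ->.
  by rewrite fa2 ?fa1 // fmods_force.
- apply: pairclosed_visit hpc hseen Mx M12 _ _.
    by move=> /hm1 /(marks_pushed hp2).
  move=> h; apply: hm2; case: h => [|h]; [by left|right].
  exact: marks_pushed hp1 h.
- by move=> r [/hseen /M12|->]; [|apply: M12].
- by move=> y p hp hA; left; apply: hold.
- move=> j p hj; rewrite nth2 // => hp; case: (hcov _ _ hj hp) => [|[ej]]; first by left; left.
  rewrite inE => /orP [/eqP ->|hp']; last by right.
  by left; right; rewrite /x -ej.
- by move=> _; split=> // p hp; rewrite nth2 ?prednK //; apply: hr; rewrite inE hp orbT.
- have h1 := pot_pushed hk hp1; have h2 := pot_pushed k1 hp2.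
  by rewrite h2 h1; move: hpot => /=; lia.
Qed.

Lemma queued_transfer b root qs s s' : queued b root qs s -> based (ar s') ->
  rg s' rOne = 1 -> rg s' (qw b) = rg s (qw b) ->
  ar s' (fQ b) =1 ar s (fQ b) -> ar s' (fV b) =1 ar s (fV b) -> queued b root qs s'.
Proof.
case=> h1 h2 h3 h4 h5 h6 h7 h8 h9 h10 hb e1 e2 eQ eV; split=> //; rewrite ?e2 // => i.
  by move=> hi; rewrite eQ h4.
by rewrite eV h5.
Qed.

Lemma inprogress_transfer b root P qs k rest Sn s s' : inprogress b root P qs k rest Sn s ->
  queued b root qs s' -> (forall r, r \in [:: cur b; qr b; cf b; fin b] -> rg s' r = rg s r) ->
  (forall g, g \notin [:: 2; 3; 4; 5] -> ar s' g =1 ar s g) ->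
  inprogress b root P qs k rest Sn s'.
Proof.
case=> h1 h2 h3 h4 h5 h6 h7 h8 h9 h10 h11 h12 hq er ea.
have [e1 e2 e3 e4] : [/\ rg s' (cur b) = rg s (cur b), rg s' (qr b) = rg s (qr b),
    rg s' (cf b) = rg s (cf b) & rg s' (fin b) = rg s (fin b)].
  by split; apply: er; rewrite !inE eqxx ?orbT.
split; rewrite ?e1 ?e2 ?e3 ?e4 //; apply: (chain_ext h6) => // g j hg _.
by apply: ea; move: hg; rewrite !inE => /or3P [] /eqP ->.
Qed.

Lemma side_transfer b root P0 i s s' : side b root P0 i s ->
  (forall qs, queued b root qs s -> queued b root qs s') ->
  (forall r, r \in [:: cur b; qr b; cf b; fin b] -> rg s' r = rg s r) ->
  (forall g, g \notin [:: 2; 3; 4; 5] -> ar s' g =1 ar s g) -> side b root P0 i s'.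
Proof.
move=> hs hq er ea.
have [e3 e4] : rg s' (cf b) = rg s (cf b) /\ rg s' (fin b) = rg s (fin b).
  by split; apply: er; rewrite !inE eqxx ?orbT.
case: hs => [qs k rest Sn P hi h1 h2|qs h1 h2 h3 h4 h5|qs h1 h2 h3 h4 h5 h6].
- by apply: (side_run _ h1 h2); apply: (inprogress_transfer hi (hq _ (i_queued hi)) er ea).
- by apply: (side_conf _ (hq _ h1)); rewrite ?e3 ?e4.
- by apply: (side_done (hq _ h1)); rewrite ?e3 ?e4.
Qed.

Lemma advance_wp b (Q : st -> Prop) s root P0 i : side b root P0 i s -> rg s (fin b) = 0 ->
  (forall s', side b root P0 i.+1 s' -> tm s' <= tm s + 500 ->
    frame (mods (advance b)) (fmods (advance b)) s s' -> Q s') ->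
  wp (advance b) Q s.
Proof.
move=> hs hfin hQ; refine (wp_frame_gen _) => F eF.
have {}hQ s' : side b root P0 i.+1 s' -> tm s' <= tm s + 500 -> F s' -> Q s'.
  by rewrite eF; apply: hQ.
clear eF; rewrite /advance; wstep.
case: hs => [qs k rest Sn P hi h1 h2|qs h1 h2 h3 h4 h5|qs _ _ h3]; last by rewrite hfin in h3.
- have [hq hcf _ hqr hk hcur hpc hseen hold hcov hrest hpot] := hi.
  rewrite hcf; wstep => // _.
  have hi' : inprogress b root P qs k rest Sn (tick (setr rE (0 + 0) s)).
    apply: (inprogress_transfer hi) => //.
      by apply: queued_frame hq _ _ _ => //; rd.
    by move=> r; rewrite !inE => /or4P [] /eqP ->; rd.
  case: rest hi hcur hcov hrest hpot hi' => [|r rest] hi hcur hcov hrest hpot hi'; last first.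
    wstep => [z|_].
      by have := chain_eq0 hcur; rewrite z.
    refine (@visit_wp b _ (tick (tick (setr rE (0 + 0) s))) root P P0 i qs k r rest Sn _ h1 h2 _).
      by apply: (inprogress_transfer hi') => //; apply: queued_frame (i_queued hi') _ _ _.
    move=> s' hs' ht' Fs'; apply: hQ => //; move: ht'; rewrite /=; lia.
  have z : rg s (cur b) = 0 by apply/eqP; rewrite (chain_eq0 hcur).
  wstep => [_|/(_ erefl) //]; wstep; rewrite (q_size hq); wstep => [ek|nk].
    have ek' : k = size qs by lia.
    wstep; apply: hQ; last by rewrite /=; lia.
    have rest0 := hpot; rewrite /pending ek' drop_size big_nil in rest0.
    apply: (@side_done _ _ _ _ _ qs) => //; try rd.
    + by apply: queued_frame hq _ _ _ => //; rd.
    + apply: (pairclosed_rclosed hpc) => x p hp /orP [hA|]; first exact: hold.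
      move=> xq; have := hcov (index x qs) p; rewrite ek' index_mem nth_index //.
      by case/(_ xq hp) => // [[]].
    + by move: rest0 h1 => /=; lia.
    + by lia.
  have lk : k < size qs by lia.
  have ex : ar s (fQ b) k = nth 0 qs k := q_nth hq lk.
  rewrite /pop; do 3 wstep.
  apply: hQ; last by rewrite /=; lia.
  have mk : nth 0 qs k \in qs by apply: mem_nth.
  (* Popping exchanges the weight of the literal, one more than the length of its list, for that
     list: one unit of fuel is spent. *)
  apply: (@side_run _ _ _ _ _ qs k.+1 (lst rl (nth 0 qs k)) Sn P.-1); last by lia.
    have hq' := q_base hq; split=> //; try rd.
    + by apply: queued_frame hq _ _ _ => //; rd.
    + by apply rg_ne; [nb|]; rewrite rg_eq ?(q_one hq) ?addn1.
    + by rewrite rg_eq; apply: (b_chains hq').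
    + move=> j p; rewrite ltnS leq_eqVlt => /orP [/eqP -> |hj] hp.
        by right; rewrite mem_lst.
      by case: (hcov _ _ hj hp) => [|[_]] //; left.
    + by move=> _; split=> // p; rewrite mem_lst.
    + by move: hpot; rewrite /pending (drop_nth 0 lk) big_cons /weight /=; lia.
  move: hpot; rewrite /pending (drop_nth 0 lk) big_cons /weight /=; lia.
- rewrite h2; wstep => // _; wstep; apply: hQ; last by rewrite /=; lia.
  apply: (@side_conf _ _ _ _ _ qs) => //; try rd; last by lia.
  by apply: queued_frame h1 _ _ _ => //; rd.
Qed.

End Verify.

(** * The race between the two values of a variable *)

Definition start b x :=
  Set_ (cur b) 0 ;; Set_ (qr b) 0 ;; Set_ (qw b) 1 ;; Set_ (cf b) 0 ;; Set_ (fin b) 0 ;;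
  Put (fV b) x rOne ;; Put (fQ b) rZ x.

(** A side in conflict idles while the other goes on; [rG] becomes 0 when a side has finished or
    both are in conflict. *)
Definition lockstep :=
  advance false ;; advance true ;; Add rE (fin false) (fin true) ;;
  Ifz rE (Ifz (cf false) (Set_ rG 1) (Ifz (cf true) (Set_ rG 1) (Set_ rG 0))) (Set_ rG 0).

Definition fill src dst v :=
  Set_ rI 0 ;; Sub rH (qw src) rI ;;
  While rH (Get rS (fQ src) rI ;; Put (fV dst) rS v ;; Add rI rI rOne ;; Sub rH (qw src) rI).

(** The losing table is cleared along its own queue and then receives the queue of the winner, so
    both tables agree again. The cost is linear in the two queues, hence in the number of rounds. *)
Definition commit b := fill (~~ b) (~~ b) rZ ;; fill b (~~ b) rOne.

Definition trial :=
  start false rX ;; start true rY ;; Set_ rG 1 ;; While rG lockstep ;;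
  Ifz (fin false) (Ifz (fin true) (Set_ rOK 0) (commit true)) (commit false).

(** If no record hangs on [rX], its negation occurs in no clause, and the literal is set outright. A
    trial would have to propagate that negation, but [fNG] is filled only for occurring literals and
    for 0. *)
Definition decide :=
  Get rX fLST rJ ;; Add rJ rJ rOne ;; Get rE (fV false) rX ;; Get rY fNG rX ;;
  Get rF (fV false) rY ;; Add rE rE rF ;;
  Ifz rE (Get rH fHD rX ;; Ifz rH (Put (fV false) rX rOne ;; Put (fV true) rX rOne) trial)
    (Set_ rE 0) ;;
  Ifz rOK (Set_ rT 0) (Sub rT rC rJ).

Definition solve := Set_ rJ 0 ;; Set_ rOK 1 ;; Sub rT rC rJ ;; While rT decide.

Section Verify.

Variables (R : nat) (inp : seq nat) (D : nat).
Local Notation wp := (wp R inp D).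
Variable f : seq (seq lit).
Hypothesis fsz : forall c, c \in f -> c != [::] /\ size (undup c) <= 3.
Local Notation rl := (records f).
Variable U : seq nat.
Hypotheses (uU : uniq U) (occU : forall x, occ f x -> x \in U).

Record solved (A0 : pred nat) s : Prop := {
  s_base : based f (ar s);
  s_one : rg s rOne = 1;
  s_zero : rg s rZ = 0;
  s_val : forall (b : bool) x, ar s (fV b) x = (A0 x || (x == 1));
  s_occ : forall x, A0 x -> occ f x;
  s_free : nxfree A0;
  s_closed : rclosed rl A0 }.

Section Trial.

Variable A0 : pred nat.

Lemma side_other b root P0 i s s' : side f A0 U (~~ b) root P0 i s ->
  frame (mods (advance b)) (fmods (advance b)) s s' -> side f A0 U (~~ b) root P0 i s'.
Proof.
move=> hs [fr fa].
have fa' g : g \notin [:: 2; 3; 4; 5] -> ar s' g =1 ar s g.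
  move=> hg; apply: fa; apply: contra hg.
  by case: (b) => /=; rewrite !inE; do ?[case/orP]; move=> /eqP ->.
apply: (side_transfer hs) => //.
- move=> qs hq; apply: (queued_transfer hq).
  + exact: based_ext (q_base hq) fa'.
  + by rewrite fr ?(q_one hq) //; nb.
  + by rewrite fr //; nb.
  + by move=> x; rewrite fa //; nb.
  + by move=> x; rewrite fa //; nb.
- by move=> r; rewrite !inE => /or4P [] /eqP ->; rewrite fr //; nb.
Qed.

Lemma start_wp b xr (Q : st -> Prop) s x : based f (ar s) -> rg s rOne = 1 -> rg s rZ = 0 ->
  (forall y, ar s (fV b) y = (A0 y || (y == 1))) -> nxfree A0 -> rclosed rl A0 ->
  (xr == rX) || (xr == rY) -> rg s xr = x -> occ f x -> ~~ A0 x -> ~~ A0 (nx x) ->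
  (forall s', side f A0 U b x (pot rl U A0) 0 s' -> rg s' (cf b) = 0 -> rg s' (fin b) = 0 ->
     frame (mods (start b xr)) (fmods (start b xr)) s s' -> tm s' <= tm s + 100 -> Q s') ->
  wp (start b xr) Q s.
Proof.
move=> hb h1 h0 hv [nf0 nf] hc hxr ex ox nx0 nnx hQ; refine (wp_frame_gen _) => F eF.
have xne r : 20 < r -> (xr == r) = false by case/orP: hxr => /eqP ->; lia.
rewrite /start; do 5 wstep; wseq.
eapply step_put; [|rd|].
  by do 5 (apply rg_ne; [by apply: xne; lia|]); exact: ex.
eapply step_put; [rd| |].
  by apply rg_seta; do 5 (apply rg_ne; [by apply: xne; lia|]); exact: ex.
rewrite eF => fr; apply: hQ fr _; try rd; last by rewrite /=; lia.
have x2 := occ_ge2 ox.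
(* [A0] being closed, the records of its literals count as visited from the start. *)
apply: (@side_run _ _ _ _ _ _ _ _ [:: x] 0 [::] (fun r => (r.1 \in A0) && (r \in rl)) (pot rl U A0)) => //; last by rewrite addn0.
split=> //; try rd.
- split=> //; try rd.
  + apply: (based_ext hb) => g hg y; rewrite /= /aupd.
    by case: (b) hg => hg; case: eqP hg => [->|_ hg] //=; case: eqP hg => [->|].
  + by case=> // _; rewrite /= /aupd; case: (b).
  + move=> y; rewrite inE; have := hv y; rewrite /= /aupd.
    by case: (b) => /= ->; case: (y == x); rewrite ?orbT.
  + by move=> y; rewrite inE => /eqP ->; rewrite ox.
  + split=> [|y]; first by rewrite inE; case/orP => [/nf0 //|/eqP]; lia.
    rewrite !inE; case: (eqVneq y x) => [->|_]; rewrite ?orbF ?orbT.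
      by move=> _; rewrite (negbTE nnx) /= => /eqP/nx_neq.
    move=> hy /orP [/(nf _ hy) //|/eqP e].
    by move: nnx; rewrite -e nxK hy.
  + by move=> S [_ Sx _ _] y; rewrite inE => /eqP ->.
  + by rewrite inE.
- by rewrite (_ : rg _ (cur b) = 0); [constructor|rd].
- move=> y a c /andP [Ay hr]; have [c1 c2] := hc _ _ _ hr Ay.
  have A0m z : A0 z -> marks A0 [:: x] z by rewrite /marks => ->.
  split=> [[e|[h|h]]|[e|[h|h]]]; apply: A0m.
  + by apply: c1; left.
  + by apply: c1; right; case/andP: h.
  + by apply: c1; right; case/andP: h.
  + by apply: c2; left.
  + by apply: c2; right; case/andP: h.
  + by apply: c2; right; case/andP: h.
- by move=> r /andP [Ar _]; rewrite /marks (_ : A0 r.1).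
- by move=> y p hr Ay; rewrite hr andbT.
- rewrite /pending drop0 big_seq1 addn0 addnC -[X in X <= _](pot_push uU occU ox nx0 (qs := [::])) //.
  by rewrite (@eq_pot _ _ _ A0) // => y; rewrite /marks orbF.
Qed.

Lemma lockstep_wp (Q : st -> Prop) s x y P0 i : side f A0 U false x P0 i s ->
  side f A0 U true y P0 i s -> rg s (fin false) = 0 -> rg s (fin true) = 0 ->
  (forall s', side f A0 U false x P0 i.+1 s' -> side f A0 U true y P0 i.+1 s' ->
    (if rg s' rG == 0 then [\/ rg s' (fin false) = 1, rg s' (fin true) = 1 |
        [/\ rg s' (fin false) = 0, rg s' (fin true) = 0, rg s' (cf false) <> 0 & rg s' (cf true) <> 0]]
     else [/\ rg s' (fin false) = 0, rg s' (fin true) = 0 &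
            rg s' (cf false) = 0 \/ rg s' (cf true) = 0]) ->
    tm s' <= tm s + 1100 -> Q s') ->
  wp lockstep Q s.
Proof.
move=> hx hy fx fy hQ; rewrite /lockstep; wseq.
refine (advance_wp _ _ _ fsz uU occU hx fx _) => s1 hx1 ht1 fr1; wseq.
have hy1 : side f A0 U true y P0 i s1 := @side_other false _ _ _ _ _ hy fr1.
have fy1 : rg s1 (fin true) = 0 by case: fr1 => ->.
refine (advance_wp _ _ _ fsz uU occU hy1 fy1 _) => s2 hy2 ht2 fr2.
have hx2 : side f A0 U false x P0 i.+1 s2 := @side_other true _ _ _ _ _ hx1 fr2.
have tr b root s' : side f A0 U b root P0 i.+1 s2 -> ar s' = ar s2 ->
    (forall r, r \notin [:: rE; rG] -> rg s' r = rg s2 r) -> side f A0 U b root P0 i.+1 s'.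
  move=> hs ea er; apply: (side_transfer hs) => [qs hq|r|g _]; last by rewrite ea.
    by apply: (queued_frame hq ea); apply: er; case: (b).
  by rewrite !inE => /or4P [] /eqP ->; apply: er; case: (b).
have fin01 b root : side f A0 U b root P0 i.+1 s2 ->
    rg s2 (fin b) = 0 \/ rg s2 (fin b) = 1.
  by case=> [qs k rest Sn P [] //|//|] *; [left|left|right].
have {}hQ s' g : ar s' = ar s2 -> (forall r, r \notin [:: rE; rG] -> rg s' r = rg s2 r) ->
    tm s' <= tm s2 + 70 -> rg s' rG = g ->
    (if g == 0 then [\/ rg s2 (fin false) = 1, rg s2 (fin true) = 1 |
        [/\ rg s2 (fin false) = 0, rg s2 (fin true) = 0, rg s2 (cf false) <> 0 & rg s2 (cf true) <> 0]]
     else [/\ rg s2 (fin false) = 0, rg s2 (fin true) = 0 &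
            rg s2 (cf false) = 0 \/ rg s2 (cf true) = 0]) -> Q s'.
  move=> ea er et eg hg; apply: hQ.
  - exact: tr hx2 ea er.
  - exact: tr hy2 ea er.
  - by rewrite eg !er.
  - by move: ht1 ht2; lia.
have er a c d : forall r, r \notin [:: rE; rG] -> rg (setr rG a (tick (tick (tick (setr rE c (d : st)))))) r = rg d r.
  by move=> r; rewrite !inE negb_or => /andP [/negbTE h1 /negbTE h2]; rewrite /= /upd h1 h2.
wstep; wstep => [z|nz].
  have [z0 z1] : rg s2 (fin false) = 0 /\ rg s2 (fin true) = 0 by lia.
  wstep => [c0|c0]; last wstep => [c1|c1]; wstep; refine (hQ _ _ _ _ _ _ _); try rd; try exact: er;
    try by [rewrite /=; lia].
  - by split=> //; left.
  - by rewrite /=; split=> //; right.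
  - by rewrite /=; constructor 3.
wstep; refine (hQ _ _ _ _ _ _ _); try rd; try by [rewrite /=; lia].
  move=> r; rewrite !inE negb_or => /andP [/negbTE h1 /negbTE h2]; by rewrite /= /upd h1 h2.
rewrite /=; case: (fin01 _ _ hx2) => e; last by constructor 1.
case: (fin01 _ _ hy2) => e'; last by constructor 2.
by case: nz; rewrite e e'.
Qed.

Lemma side_running b root P0 i s : side f A0 U b root P0 i s ->
  rg s (cf b) = 0 -> rg s (fin b) = 0 -> i <= P0.
Proof. by case=> [qs k rest Sn P _ h _|qs _ h _ _ _ h'|qs _ _ h _ _ _ _ h']; lia. Qed.

Definition stopped s := [\/ rg s (fin false) = 1, rg s (fin true) = 1 |
  [/\ rg s (fin false) = 0, rg s (fin true) = 0, rg s (cf false) <> 0 & rg s (cf true) <> 0]].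

Lemma race_wp (Q : st -> Prop) s x y P0 : side f A0 U false x P0 0 s ->
  side f A0 U true y P0 0 s -> rg s (fin false) = 0 -> rg s (fin true) = 0 ->
  rg s (cf false) = 0 -> rg s rG = 1 ->
  (forall s' i, side f A0 U false x P0 i s' -> side f A0 U true y P0 i s' -> stopped s' ->
    i <= P0.+1 -> tm s' <= tm s + 1200 * i + 10 -> Q s') ->
  wp (While rG lockstep) Q s.
Proof.
move=> hx hy fx fy cx eG hQ.
have tick_side b root s' i : side f A0 U b root P0 i s' -> side f A0 U b root P0 i (tick s').
  by move=> hs; apply: (side_transfer hs) => // qs hq; apply: queued_frame hq _ _ _.
pose I n s' := exists i, [/\ side f A0 U false x P0 i s', side f A0 U true y P0 i s',
  (if rg s' rG == 0 then stopped s' else [/\ rg s' (fin false) = 0, rg s' (fin true) = 0 &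
            rg s' (cf false) = 0 \/ rg s' (cf true) = 0]) &
  [/\ i <= P0.+1, tm s' <= tm s + 1200 * i & n = if rg s' rG == 0 then 0 else (P0 - i).+1]].
refine (@wp_while _ _ _ _ _ I _ P0.+1 _ _ _ _).
- by exists 0; rewrite eG /= subn0; split=> //; [split=> //; left|split=> //; lia].
- move=> n s' [i [h1 h2 + [h4 h5 _]]] z; rewrite z /= => h3.
  by apply: (hQ _ i (tick_side _ _ _ _ h1) (tick_side _ _ _ _ h2) h3 h4) => /=; lia.
move=> n s' [i [h1 h2 + [h4 h5 en]]] /eqP/negbTE nz; rewrite nz in en *; move=> [f1 f2 hc].
have iP : i <= P0.
  by case: hc => hc; [apply: (side_running h1 hc f1)|apply: (side_running h2 hc f2)].
refine (@lockstep_wp _ _ x y P0 i (tick_side _ _ _ _ h1) (tick_side _ _ _ _ h2) f1 f2 _) => s2 k1 k2 k3 k4.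
exists (if rg s2 rG == 0 then 0 else (P0 - i.+1).+1).
  rewrite en; case: ifP k3 => // _ [g1 g2 gc].
  have iP' : i.+1 <= P0.
    by case: gc => gc; [apply: (side_running k1 gc g1)|apply: (side_running k2 gc g2)].
  by lia.
by exists i.+1; split=> //; split=> //; move: k4; rewrite /=; lia.
Qed.

Lemma fill_wp src dst v (Q : st -> Prop) s qs c : (v == rZ) || (v == rOne) -> rg s v = c ->
  rg s rOne = 1 -> rg s (qw src) = size qs ->
  (forall i, i < size qs -> ar s (fQ src) i = nth 0 qs i) ->
  (forall s', (forall z, ar s' (fV dst) z = if z \in qs then c else ar s (fV dst) z) ->
     frame [:: rI; rH; rS] [:: fV dst] s s' -> tm s' <= tm s + 60 * size qs + 60 -> Q s') ->
  wp (fill src dst v) Q s.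
Proof.
move=> hv ev e1 eq hq hQ; rewrite /fill; do 2 wstep; rewrite subn0.
set s0 := setr rH _ _.
have fr0 : frame [:: rI; rH; rS] [:: fV dst] s s0.
  split=> // r; rewrite !inE !negb_or => /and3P [/negbTE h1 /negbTE h2 _].
  by rewrite /s0 /= /upd h1 h2.
pose I n s' := exists i, [/\ n = size qs - i, rg s' rI = i, i <= size qs, rg s' rH = size qs - i &
  [/\ forall z, ar s' (fV dst) z = if z \in take i qs then c else ar s (fV dst) z,
    frame [:: rI; rH; rS] [:: fV dst] s s' & tm s' <= tm s + 60 * i + 20]].
refine (@wp_while _ _ _ _ _ I _ (size qs) _ _ _ _).
- exists 0; rewrite subn0; split=> //; split=> //; [by move=> z; rewrite take0|rewrite /s0 /=; lia].
- move=> n s' [i [_ eI li eH [h1 h2 h3]]] z.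
  have ei : i = size qs by lia.
  rewrite ei take_size in h1; apply: hQ => //=; lia.
move=> n s' [i [en eI li eH [h1 h2 h3]]] nz.
have li' : i < size qs by lia.
have [fr fa] := h2.
have eS : ar s' (fQ src) i = nth 0 qs i by rewrite fa ?hq //; case: (src) (dst) => [] [].
have ev' : rg s' v = c by rewrite fr //; case/orP: hv => /eqP ->.
have e1' : rg s' rOne = 1 by rewrite fr.
have eq' : rg s' (qw src) = size qs by rewrite fr ?eq //; case: (src).
wstep; wseq.
eapply step_put; [rd| |].
  by apply rg_ne; [by case/orP: hv => /eqP ->|apply rg_tick; exact: ev'].
do 2 wstep.
exists (size qs - i.+1); first by lia.
exists i.+1; split=> //; first by rewrite /= /upd /= addn1.
- by rewrite rg_eq; lia.
split.
- move=> z; rewrite (take_nth 0 li') mem_rcons inE /= /aupd eqxx /= h1.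
  by case: eqP.
- apply: frame_trans h2 _; split=> [r|g].
    rewrite !inE !negb_or => /and3P [/negbTE g1 /negbTE g2 /negbTE g3].
    by rewrite /= /upd g1 g2 g3.
  by rewrite inE => /negbTE hg z; rewrite /= /aupd hg.
- by rewrite /=; lia.
Qed.

Lemma queue_of b root P0 i s : side f A0 U b root P0 i s ->
  exists2 qs, queued f A0 b root qs s & size qs <= 1 + 2 * i.
Proof. by case=> [qs k rest Sn P [hq] *|qs hq *|qs hq *]; exists qs. Qed.

Lemma commit_wp b (Q : st -> Prop) s root root' P0 i : side f A0 U b root P0 i s ->
  rg s (fin b) = 1 -> side f A0 U (~~ b) root' P0 i s -> rg s rZ = 0 ->
  (forall y, A0 y -> occ f y) ->
  (forall s' A1, solved A1 s' -> (forall y, A0 y -> A1 y) -> A1 root ->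
     pot rl U A1 + i <= P0.+1 -> frame (mods (commit b)) (fmods (commit b)) s s' ->
     tm s' <= tm s + 240 * i + 240 -> Q s') ->
  wp (commit b) Q s.
Proof.
move=> hs hfin hs' hz hocc hQ; refine (wp_frame_gen _) => F eF.
have [qs' hq' z'] := queue_of hs'.
have [qs [hq hc hp z]] : exists qs, [/\ queued f A0 b root qs s, rclosed rl (marks A0 qs),
    pot rl U (marks A0 qs) + i <= P0.+1 & size qs <= 1 + 2 * i].
  by case: hs => [qs k rest Sn P [_ _ e] *|qs _ _ e *|qs *]; [lia|lia|exists qs].
rewrite /commit; wseq.
refine (@fill_wp (~~ b) (~~ b) rZ _ _ qs' 0 isT hz (q_one hq') (q_size hq') (q_nth hq') _).
move=> s1 v1 [fr1 fa1] t1.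
have n1 i' : i' < size qs -> ar s1 (fQ b) i' = nth 0 qs i'.
  by move=> hi; rewrite fa1 ?(q_nth hq) //; case: (b).
refine (@fill_wp b (~~ b) rOne _ _ qs 1 isT _ _ _ n1 _).
- by rewrite fr1 ?(q_one hq).
- by rewrite fr1 ?(q_one hq).
- by rewrite fr1 ?(q_size hq) //; case: (b).
move=> s2 v2 [fr2 fa2] t2; rewrite eF => fr.
apply: (hQ _ (marks A0 qs)) => //; last by lia.
- split.
  + apply: (based_ext (q_base hq)) => g hg y; rewrite fa2 ?fa1 //.
      by apply: contra hg; case: (b); rewrite !inE => /eqP ->.
    by apply: contra hg; case: (b); rewrite !inE => /eqP ->.
  + by rewrite fr2 ?fr1 ?(q_one hq).
  + by rewrite fr2 ?fr1.
  + move=> b' y; case: (eqVneq b' b) => [->|nb'].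
      by rewrite fa2 ?fa1 ?(q_val hq) ?orbA //; case: (b).
    have -> : b' = ~~ b by case: (b') (b) nb' => [] [].
    rewrite v2 v1 /marks -orbA orbCA orbA; case: ifP => //= yq.
    case: ifP => yq'; last by rewrite (q_val hq') yq'.
    have /andP [oy nA] := q_occ hq' yq'.
    by rewrite (negbTE nA) /=; have := occ_ge2 oy; case: eqP => // ->.
  + by move=> y /orP [/hocc //|/(q_occ hq) /andP []].
  + exact: (q_free hq).
  + exact: hc.
- by move=> y; rewrite /marks => ->.
- by rewrite /marks (q_root hq) orbT.
Qed.

(** The potential drops by at least the number of rounds minus one. The rate 1600 exceeds the cost
    of a round, 1200, plus its share of the commit, 240; [K] absorbs the rest. *)
Definition progress K x y s s' := exists A1 : pred nat,
  [/\ solved A1 s', forall z, A0 z -> A1 z, A1 x || A1 y &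
      tm s' + 1600 * pot rl U A1 <= tm s + 1600 * pot rl U A0 + K].

Lemma trial_wp (Q : st -> Prop) s x y : solved A0 s -> rg s rX = x -> rg s rY = y -> y = nx x ->
  occ f x -> occ f y -> ~~ A0 x -> ~~ A0 y ->
  (forall s', rg s' rOK = rg s rOK /\ progress 4000 x y s s' \/
     [/\ rg s' rOK = 0, no_ext f A0 x, no_ext f A0 y & tm s' <= tm s + 1600 * pot rl U A0 + 4000] ->
     Q s') ->
  wp trial Q s.
Proof.
move=> [hb h1 h0 hv hocc hfree hcl] ex ey exy ox oy nAx nAy hQ.
have nny : ~~ A0 (nx y) by rewrite exy nxK.
have nnx : ~~ A0 (nx x) by rewrite -exy.
rewrite /trial; wseq.
refine (@start_wp false rX _ s x hb h1 h0 (hv false) hfree hcl isT ex ox nAx nnx _).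
move=> s1 hx1 cx1 fx1 [fr1 fa1] t1; wseq.
have hb1 : based f (ar s1) by apply: (based_ext hb) => g hg z; rewrite fa1 //; apply: contra hg; rewrite !inE => /orP [] /eqP ->.
have hv1 z : ar s1 (fV true) z = (A0 z || (z == 1)) by rewrite fa1 // hv.
refine (@start_wp true rY _ s1 y hb1 _ _ hv1 hfree hcl isT _ oy nAy nny _).
- by rewrite fr1.
- by rewrite fr1.
- by rewrite fr1.
move=> s2 hy2 cy2 fy2 [fr2 fa2] t2.
have hx2 : side f A0 U false x (pot rl U A0) 0 s2.
  apply: (side_transfer hx1).
  - move=> qs hq; apply: (queued_transfer hq).
    + apply: (based_ext (q_base hq)) => g hg z; rewrite fa2 //.
      by apply: contra hg; rewrite !inE => /orP [] /eqP ->.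
    + by rewrite fr2 ?(q_one hq).
    + by rewrite fr2.
    + by move=> z; rewrite fa2.
    + by move=> z; rewrite fa2.
  - by move=> r; rewrite !inE => /or4P [] /eqP ->; rewrite fr2.
  - by move=> g hg z; rewrite fa2 //; apply: contra hg; rewrite !inE => /orP [] /eqP ->.
have fx2 : rg s2 (fin false) = 0 by rewrite fr2.
have cx2 : rg s2 (cf false) = 0 by rewrite fr2.
wstep; set s3 := setr rG 1 s2.
have tr b root : side f A0 U b root (pot rl U A0) 0 s2 -> side f A0 U b root (pot rl U A0) 0 s3.
  move=> hs; apply: (side_transfer hs) => // [qs hq|r].
    by apply: queued_frame hq _ _ _ => //; rewrite /s3; case: (b).
  by rewrite !inE => /or4P [] /eqP ->; case: (b).
wseq; apply: wp_frame; refine (@race_wp _ s3 x y (pot rl U A0) (tr _ _ hx2) (tr _ _ hy2) fx2 fy2 cx2 erefl _).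
move=> s4 i hx4 hy4 hst hi t4 [fr4 _].
have t3 : tm s4 <= tm s + 1200 * i + 300 by move: t1 t2 t4; rewrite /s3 /=; clear; lia.
have eOK : rg s4 rOK = rg s rOK by rewrite fr4 // /s3 /= /upd /= fr2 // fr1.
have e0 : rg s4 rZ = 0 by rewrite fr4 // /s3 /= /upd /= fr2 // fr1.
have win s' A1 : solved A1 s' -> (forall z, A0 z -> A1 z) -> A1 x || A1 y ->
    pot rl U A1 + i <= (pot rl U A0).+1 -> rg s' rOK = rg s4 rOK ->
    tm s' <= tm s4 + 240 * i + 300 -> Q s'.
  move=> hs sub Ar hp eo t'; apply: hQ; left; split; first by rewrite eo.
  by exists A1; split=> //; move: t' t3 hp; clear; lia.
have tick_side b root s' : side f A0 U b root (pot rl U A0) i s' ->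
    side f A0 U b root (pot rl U A0) i (tick s').
  by move=> hs; apply: (side_transfer hs) => // qs hq; apply: queued_frame hq _ _ _.
have fin1 b root : side f A0 U b root (pot rl U A0) i s4 -> rg s4 (fin b) <> 0 ->
    rg s4 (fin b) = 1.
  by case=> [qs k rest Sn P [_ _ e] *|qs _ _ e *|qs *].
wstep => [z|nz]; last first.
  refine (@commit_wp false _ _ x y (pot rl U A0) i (tick_side _ _ _ hx4) (fin1 _ _ hx4 nz)
    (tick_side _ _ _ hy4) e0 hocc _).
  move=> s5 A1 hs5 sub Ax hp [fr5 _] t5; apply: (win _ A1) => //; first by rewrite Ax.
    by rewrite fr5.
  by move: t5; rewrite /=; clear; lia.
wstep => [z'|nz']; last first.
  refine (@commit_wp true _ _ y x (pot rl U A0) i (tick_side _ _ _ (tick_side _ _ _ hy4)) _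
    (tick_side _ _ _ (tick_side _ _ _ hx4)) e0 hocc _).
    exact: fin1 hy4 nz'.
  move=> s5 A1 hs5 sub Ay hp [fr5 _] t5; apply: (win _ A1) => //; first by rewrite Ay orbT.
    by rewrite fr5.
  by move: t5; rewrite /=; clear; lia.
case: hst => [e|e|[_ _ nx1 ny1]]; [by rewrite e in z|by rewrite e in z'|].
have ne b root : side f A0 U b root (pot rl U A0) i s4 -> rg s4 (cf b) <> 0 -> no_ext f A0 root.
  by case=> [qs k rest Sn P [_ e] *|qs *|qs _ e *].
wstep; apply: hQ; right; split; [by rd|exact: ne hx4 nx1|exact: ne hy4 ny1|].
by move: t3 hi; rewrite /=; clear; lia.
Qed.

Hypothesis refute : forall (M : pred nat) x, rclosed rl M -> nxfree M ->
  (forall y, M y -> occ f y) -> occ f x -> occ f (nx x) -> ~~ M x -> ~~ M (nx x) ->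
  no_ext f M x -> no_ext f M (nx x) -> ~ satisfiable f.

Lemma solved_transfer A1 s s' : solved A1 s -> ar s' = ar s -> rg s' rOne = rg s rOne ->
  rg s' rZ = rg s rZ -> solved A1 s'.
Proof. by case=> h1 h2 h3 h4 h5 h6 h7 ea e1 e2; split; rewrite ?ea ?e1 ?e2. Qed.

Lemma decide_wp (Q : st -> Prop) s j : solved A0 s -> rg s rJ = j -> j < size (flatten f) ->
  rg s rC = size (flatten f) -> rg s rOK = 1 ->
  (forall s', frame (mods decide) (fmods decide) s s' -> rg s' rJ = j.+1 ->
     [/\ rg s' rOK = 1, rg s' rT = rg s' rC - rg s' rJ &
        progress 4200 (ix (nth (0, false) (flatten f) j)) (nx (ix (nth (0, false) (flatten f) j))) s s'] \/
     [/\ rg s' rOK = 0, rg s' rT = 0, ~ satisfiable f & tm s' <= tm s + 1600 * pot rl U A0 + 4200] ->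
     Q s') ->
  wp decide Q s.
Proof.
move=> hs ej hj eC eOK hQ; refine (wp_frame_gen _) => F eF.
have [hb h1 h0 hv hocc hfree hcl] := hs.
set l := nth (0, false) (flatten f) j in hQ; set x := ix l in hQ.
have lf : l \in flatten f by apply: mem_nth.
have ox : occ f x by apply: map_f.
have x2 := occ_ge2 ox.
have ex : ar s fLST j = x by rewrite (b_lst hb hj) (nth_map (0, false)).
have en : ar s fNG x = nx x by apply: (b_neg hb); right.
have x1 : (x == 1) = false by apply/eqP/ix_neq1.
have nx1 : (nx x == 1) = false by apply/eqP => /nx_eq1 e; rewrite e in x2.
have tail s1 : rg s1 rJ = j.+1 -> rg s1 rC = size (flatten f) ->
    rg s1 rOK = 1 /\ progress 4150 x (nx x) s s1 \/
    [/\ rg s1 rOK = 0, ~ satisfiable f & tm s1 <= tm s + 1600 * pot rl U A0 + 4150] ->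
    wp (Ifz rOK (Set_ rT 0) (Sub rT rC rJ)) (fun s' => F s' -> Q s') s1.
  move=> eJ1 eC1 h; wstep => [z|nz]; wstep; rewrite eF => fr; apply: (hQ _ fr); try rd.
    case: h => [[e _]|[e ns t]]; first by rewrite e in z.
    right; split=> //; try rd; by move: t; rewrite /=; clear; lia.
  case: h => [[e [A1 [k1 k2 k3 k4]]]|[e _ _]]; last by rewrite e in nz.
  left; split; [by rd|by rewrite /= /upd /= eJ1 eC1|].
  by exists A1; split=> //; [apply: (solved_transfer k1)|move: k4; rewrite /=; clear; lia].
rewrite /decide; do 6 wstep; rewrite !hv x1 nx1 !orbF; wseq; wstep => [z|nz]; last first.
  wstep; apply: tail; [by rewrite /= /upd /= addn1|by rd|].
  left; split; first by rd.
  exists A0; split=> //.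
    by move: nz; case: (A0 x) (A0 (nx x)) => [] [].
  by rewrite /=; clear; lia.
have [nA nA'] : ~~ A0 x /\ ~~ A0 (nx x) by move: z; case: (A0 x) (A0 (nx x)) => [] [].
have hch := b_chains hb x.
wstep; wstep => [hz|hnz].
  have l0 : lst rl x = [::] by apply/eqP; rewrite -(chain_eq0 hch) hz.
  have nrec p : (x, p) \in rl -> False by rewrite -mem_lst l0.
  do 2 wstep; apply: tail; [by rewrite /= /upd /= addn1|by rd|].
  left; split; first by rd.
  exists (fun y => A0 y || (y == x)); split.
  - split=> //.
    + by apply: (based_ext hb) => g; rewrite !inE !negb_or => /and4P [/negbTE g2 /negbTE g3 _ _] y;
        rewrite /= /aupd g2 g3.
    + move=> b y; have := hv b y; rewrite /= /aupd.
      by case: b => /= ->; case: (y == x); rewrite ?orbT ?orbF.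
    + by move=> y /orP [/hocc //|/eqP ->].
    + case: hfree => f0 f1; split=> [/orP [//|/eqP e]|y]; first by rewrite -e in x2.
      case/orP=> [Ay|/eqP ->] /orP [|/eqP].
      * exact: f1 Ay.
      * by move=> e; rewrite -e nxK Ay in nA'.
      * by rewrite (negbTE nA').
      * exact: nx_neq.
    + move=> y a c hr /orP [Ay|/eqP e]; last by rewrite e in hr; case: (nrec _ hr).
      have [c1 c2] := hcl _ _ _ hr Ay; have [s1 s2] := records_sym hr.
      split=> [[e|/orP [An|/eqP e]]|[e|/orP [An|/eqP e]]]; rewrite ?c1 ?c2 //; auto.
      * by case: s1; rewrite e => /nrec.
      * by case: s2; rewrite e => /nrec.
  - by move=> y ->.
  - by rewrite eqxx orbT.
  - have : pot rl U (fun y => A0 y || (y == x)) <= pot rl U A0 by apply: pot_mono => y ->.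
    by rewrite /=; clear; lia.
have onx : occ f (nx x).
  have : lst rl x != [::] by rewrite -(chain_eq0 hch); apply/eqP.
  case el : (lst rl x) => [//|[a c] q] _.
  have hr : (x, (a, c)) \in rl by rewrite -mem_lst el mem_head.
  have [d df [h _]] := records_clause fsz hr.
  have [|l' l'd e] := h (nx x) (mem_head _ _); first by move=> e; rewrite -[x]nxK e in x1.
  by apply/occP; exists l' => //; exists d.
apply: wp_frame; refine (@trial_wp _ _ x (nx x) _ _ _ erefl ox onx nA nA' _).
- by apply: (solved_transfer hs).
- by rewrite /= /upd.
- by rewrite /= /upd.
move=> s1 h [fr _]; apply: tail.
- by rewrite fr // /= /upd /= addn1.
- by rewrite fr // /= /upd.
case: h => [[e [A1 [k1 k2 k3 k4]]]|[e n1 n2 t]]; [left|right].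
  split; first by rewrite e /= /upd.
  by exists A1; split=> //; move: k4; rewrite /=; clear; lia.
split=> //; first by apply: (refute hcl hfree hocc ox onx).
by move: t; rewrite /=; clear; lia.
Qed.

End Trial.
Hypothesis refute : forall (M : pred nat) x, rclosed rl M -> nxfree M ->
  (forall y, M y -> occ f y) -> occ f x -> occ f (nx x) -> ~~ M x -> ~~ M (nx x) ->
  no_ext f M x -> no_ext f M (nx x) -> ~ satisfiable f.

Definition decided (A1 : pred nat) j := forall i, i < j ->
  let x := ix (nth (0, false) (flatten f) i) in A1 x || A1 (nx x).

Lemma solve_wp (Q : st -> Prop) s : solved pred0 s -> rg s rC = size (flatten f) ->
  (forall s', frame (mods solve) (fmods solve) s s' ->
     rg s' rOK = 1 /\ (exists2 A1, solved A1 s' & decided A1 (size (flatten f))) \/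
     rg s' rOK = 0 /\ ~ satisfiable f ->
     tm s' <= tm s + 1600 * pot rl U pred0 + 4300 * size (flatten f) + 5000 -> Q s') ->
  wp solve Q s.
Proof.
move=> hs eC hQ; refine (wp_frame_gen _) => F eF; rewrite /solve; do 3 wstep.
rewrite subn0; set s0 := setr rT _ _; set N := size (flatten f) in eC hQ s0 *.
pose T := tm s + 1600 * pot rl U pred0.
pose I n s' := rg s' rC = N /\
  ((exists j A1, [/\ rg s' rOK = 1, rg s' rT = N - j, rg s' rJ = j, j <= N &
      [/\ n = N - j, solved A1 s', decided A1 j & tm s' + 1600 * pot rl U A1 <= T + 4300 * j + 100]]) \/
   [/\ n = 0, rg s' rT = 0, rg s' rOK = 0, ~ satisfiable f & tm s' <= T + 4300 * N + 4900]).
refine (@wp_while _ _ _ _ _ I _ N _ _ _ _).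
- split; first by rewrite /s0 /= /upd.
  left; exists 0, pred0; rewrite subn0; split=> //; split=> //.
    by apply: (solved_transfer hs); rewrite /s0 /= /upd.
  have -> : tm s0 = tm s + 30 by rewrite /s0 /= -!addnA.
  by rewrite /T; clear; lia.
- move=> n s' [_ [[j [A1 [h1 h2 h3 h4 [_ h5 h6 h7]]]]|[_ _ h1 h2 h3]]] z; rewrite eF => fr;
    apply: (hQ _ fr).
  + left; split=> //; exists A1; first by apply: (solved_transfer h5).
    by have -> : N = j by lia.
  + by move: h4 h7; rewrite /T /=; clear; lia.
  + by right.
  + by move: h3; rewrite /T /=; clear; lia.
move=> n s' [hC [[j [A1 [h1 h2 h3 h4 [hn h5 h6 h7]]]]|[_ h1 _ _ _]]] nz; last by rewrite h1 in nz.
have jN : j < N by lia.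
have h5' : solved A1 (tick s') by apply: (solved_transfer h5).
refine (decide_wp refute h5' h3 jN hC h1 _).
move=> s2 [fr _] eJ h; have eC2 : rg s2 rC = N by rewrite fr.
case: h => [[e1 e2 [A2 [k1 k2 k3 k4]]]|[e1 e2 ns t]].
  exists (N - j.+1); first by rewrite hn; lia.
  split=> //; left; exists j.+1, A2; split=> //; first by rewrite e2 eC2 eJ.
  split=> //; last by move: h7 k4; rewrite /=; clear; lia.
  move=> i; rewrite ltnS leq_eqVlt => /orP [/eqP -> //|hi].
  by case/orP: (h6 _ hi) => /k2 h; rewrite /= h ?orbT.
exists 0; first by lia.
split=> //; right; split=> //; move: h7 t jN; rewrite /=; clear; lia.
Qed.

End Verify.

(** * Output and the complete program *)

Notation nregs := 40.

(** As [rH] is [nregs] minus one, the truncated difference [rF] vanishes exactly when the cell of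
    the variable is a register; those values are left to the epilogue. *)
Definition output :=
  Set_ rJ 0 ;; Set_ rH 39 ;; Sub rT rC rJ ;;
  While rT (Get rV fLSV rJ ;; Add rX rV rV ;; Add rX rX rOne ;; Add rX rX rTwo ;;
    Get rE (fV false) rX ;; Add rY rV rOne ;; Sub rF rY rH ;;
    Ifz rF (Set_ rF 0) (Out rY rE) ;; Add rJ rJ rOne ;; Sub rT rC rJ).

(* The arrays are placed at nregs + (sum of the input), above every output cell. *)
Definition total :=
  Set_ rOne 1 ;; Set_ rI 0 ;; Set_ rD nregs ;; Sub rT rN rI ;;
  While rT (Inp rX rI ;; Add rD rD rX ;; Add rI rI rOne ;; Sub rT rN rI).

Definition main := parse ;; solve ;; Ifz rOK (Set_ rF 0) output.

Lemma total_wp inp D (Q : st -> Prop) s : rg s rN = size inp ->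
  (forall s', rg s' rD = nregs + sumn inp -> rg s' rN = size inp ->
     tm s' <= tm s + 60 * size inp + 60 -> Q s') ->
  wp nregs inp D total Q s.
Proof.
move=> eN hQ; rewrite /total; do 4 wstep; rewrite subn0.
pose I n s' := exists i, [/\ n = size inp - i, i <= size inp, rg s' rI = i, rg s' rT = size inp - i &
  [/\ rg s' rOne = 1, rg s' rN = size inp, rg s' rD = nregs + sumn (take i inp) &
      tm s' <= tm s + 60 * i + 40]].
refine (@wp_while _ _ _ _ _ I _ (size inp) _ _ _ _).
- exists 0; rewrite subn0 take0 addn0; split=> //; split=> //.
  by rewrite /=; clear; lia.
- move=> n s' [i [_ h1 h2 h3 [h4 h5 h6 h7]]] z.
  have ei : i = size inp by lia.
  rewrite ei take_size in h6; apply: hQ => //=.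
  by move: h7; rewrite ei /=; clear; lia.
move=> n s' [i [hn h1 h2 h3 [h4 h5 h6 h7]]] nz.
have hi : i < size inp by lia.
do 4 wstep; exists (size inp - i.+1); first by lia.
exists i.+1; split=> //; rewrite /= /upd /= ?addn1 //; split=> //.
  by rewrite (take_nth 0 hi) sumn_rcons addnA.
by move: h7; clear; lia.
Qed.

Section Verify.

Variables (inp : seq nat) (D : nat).
Local Notation wp := (wp nregs inp D).
Variable f : seq (seq lit).
Hypothesis einp : inp = enc f.
Hypothesis eD : D = nregs + sumn inp.
Hypothesis fsz : forall c, c \in f -> c != [::] /\ size (undup c) <= 3.

Lemma var_le_sum l : l \in flatten f -> l.1 <= sumn inp.
Proof.
case/flattenP => c cf lc; have : l.1 \in inp.
  rewrite einp; apply/flattenP; exists (enc_clause c); first exact: map_f.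
  rewrite inE; apply/orP; right; apply/flattenP; exists (enc_lit l); first exact: map_f.
  exact: mem_head.
elim: inp => //= y s' IH; rewrite inE => /orP [/eqP ->|/IH]; first exact: leq_addr.
by move/leq_trans; apply; apply: leq_addl.
Qed.

Lemma output_wp (Q : st -> Prop) s A1 : solved f A1 s -> rg s rTwo = 2 ->
  rg s rC = size (flatten f) ->
  (forall s', frame (mods output) (fmods output) s s' ->
     (forall l, l \in flatten f -> nregs <= l.1.+1 -> ou s' l.1.+1 = A1 (l.1 + l.1 + 3)) ->
     tm s' <= tm s + 150 * size (flatten f) + 60 -> Q s') ->
  wp output Q s.
Proof.
move=> hs e2 eC hQ; refine (wp_frame_gen _) => F eF; rewrite /output; do 3 wstep.
rewrite subn0; set s0 := setr rT _ _; set N := size (flatten f) in eC hQ s0 *.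
pose vr i := nth 0 [seq l.1 | l <- flatten f] i.
pose I n s' := exists j, [/\ n = N - j, j <= N, rg s' rJ = j, rg s' rT = N - j &
  [/\ rg s' rH = 39, rg s' rC = N, rg s' rTwo = 2, solved f A1 s' &
   (forall i, i < j -> nregs <= (vr i).+1 -> ou s' (vr i).+1 = A1 (vr i + vr i + 3)) /\
   tm s' <= tm s + 150 * j + 40]].
refine (@wp_while _ _ _ _ _ I _ N _ _ _ _).
- exists 0; rewrite subn0; split=> //; split=> //; last by rewrite /s0 /=; clear; split=> //; lia.
  by apply: (solved_transfer hs); rewrite /s0 /= /upd.
- move=> n s' [j [_ h1 h2 h3 [_ _ _ _ [h8 h9]]]] z.
  have ej : j = N by lia.
  rewrite eF => fr; apply: (hQ _ fr); last by move: h9; rewrite ej /=; clear; lia.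
  move=> l lf hl; have hi : index l (flatten f) < N by rewrite index_mem.
  have ev : vr (index l (flatten f)) = l.1 by rewrite /vr (nth_map (0, false)) ?nth_index.
  by have := h8 (index l (flatten f)); rewrite ev ej; apply.
move=> n s' [j [hn h1 h2 h3 [h4 h5 h6 h7 [h8 h9]]]] nz.
have jN : j < N by lia.
have ev : ar s' fLSV j = vr j := b_lsv (s_base h7) jN.
have e1 := s_one h7.
have vl : vr j <= sumn inp.
  by rewrite /vr (nth_map (0, false)) //; apply: var_le_sum; apply: mem_nth.
do 7 wstep.
have eval : ar s' (fV false) (vr j + vr j + 1 + 2) = A1 (vr j + vr j + 3).
  by rewrite (s_val h7) -addnA (_ : (_ == 1) = false) ?orbF //; lia.
rewrite eval.
have post s1 : rg s1 rJ = j -> rg s1 rOne = 1 -> rg s1 rC = N -> rg s1 rH = 39 -> rg s1 rTwo = 2 ->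
    ar s1 = ar s' -> rg s1 rZ = rg s' rZ -> 
    (forall i, i < j.+1 -> nregs <= (vr i).+1 -> ou s1 (vr i).+1 = A1 (vr i + vr i + 3)) ->
    tm s1 <= tm s' + 120 -> wp (Add rJ rJ rOne ;; Sub rT rC rJ)
      (fun s' => exists2 n', n' < n & I n' s') s1.
  move=> k1 k2 k3 k4 k5 k6 k7 k8 k9; do 2 wstep; exists (N - j.+1); first by lia.
  exists j.+1; split=> //; rewrite /= /upd /= ?addn1 //; split=> //.
    by apply: (solved_transfer h7); rewrite //= /upd /= k2 e1.
  by split=> //; move: h9 k9; clear; lia.
wseq; wstep => [z|nz'].
  wstep; apply: post; try rd; last by rewrite /=; clear; lia.
  move=> i; rewrite ltnS leq_eqVlt => /orP [/eqP ->|hi]; last exact: h8.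
  by move=> hv; move: z hv; clear; lia.
wseq; eapply step_out; [rd|rd|by move: nz' vl; rewrite eD; clear; lia|].
apply: post; try rd; last by rewrite /=; clear; lia.
move=> i; rewrite ltnS /= /upd addn1 => hi hv.
case: eqP => [[->] //|ne]; apply: h8 => //.
by move: hi; rewrite leq_eqVlt => /orP [/eqP e|//]; case: ne; rewrite e.
Qed.

Hypothesis refute : forall (M : pred nat) x, rclosed (records f) M -> nxfree M ->
  (forall y, M y -> occ f y) -> occ f x -> occ f (nx x) -> ~~ M x -> ~~ M (nx x) ->
  no_ext f M x -> no_ext f M (nx x) -> ~ satisfiable f.

Lemma size_flatten_enc (g : seq (seq lit)) : size (flatten g) + size g <= size (enc g).
Proof.
elim/last_ind: g => // g c IH; rewrite flatten_rcons size_cat size_rcons size_enc_rcons.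
by move: IH; clear; lia.
Qed.

Lemma size_records (g : seq (seq lit)) : size (records g) = 3 * size g.
Proof.
elim/last_ind: g => // g c IH; rewrite records_rcons size_cat IH size_rcons.
by case: (dd _) => [[a b] d] /=; clear; lia.
Qed.

Definition model (s : st) (A1 : pred nat) := [/\ rclosed (records f) A1, nxfree A1,
  forall c l, c \in f -> l \in c -> A1 (ix l) || A1 (nx (ix l)) &
  forall l, l \in flatten f -> ar s (fV false) (l.1 + l.1 + 3) = A1 (l.1 + l.1 + 3) /\
    (nregs <= l.1.+1 -> ou s l.1.+1 = A1 (l.1 + l.1 + 3))].

Lemma main_wp (Q : st -> Prop) s : (forall i j, ar s i j = 0) -> rg s rN = size inp ->
  (forall s', rg s' rOK = 1 /\ (exists A1 : pred nat, model s' A1) \/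
     rg s' rOK = 0 /\ ~ satisfiable f ->
     tm s' <= tm s + 5000 * 3 * (size inp).+1 -> Q s') ->
  wp main Q s.
Proof.
move=> ar0 eN hQ; rewrite /main; wseq.
refine (@parse_wp _ _ _ _ s f einp ar0 eN _) => s1 [hp [h1 h2 h0] hC hR] eN1 t1; wseq.
pose U := undup [seq ix l | l <- flatten f].
have occU x : occ f x -> x \in U by rewrite mem_undup.
have hs1 : solved f pred0 s1.
  split=> //.
  - split; [exact: p_chains hp| |exact: p_lst hp|exact: p_lsv hp].
    by move=> x [->|/mapP [l lf ->]]; [rewrite (p_neg0 hp)|apply: (p_neg hp)].
  - by move=> b x; exact: p_val hp b x.
have szU : size U <= size (flatten f) by rewrite -(size_map ix) size_undup.
have pU : pot (records f) U pred0 <= size (flatten f) + 3 * size f.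
  by rewrite -size_records; apply: leq_trans (pot_le _ _ (undup_uniq _)) _; rewrite leq_add2r.
have sz := size_flatten_enc f.
refine (@solve_wp _ _ _ f fsz U (undup_uniq _) occU refute _ s1 hs1 hC _).
move=> s2 [fr2 _] h t2.
have tb : tm s2 + 200 * size (flatten f) + 500 <= tm s + 5000 * 3 * (size inp).+1.
  by move: t1 t2 pU sz; rewrite einp; clear; lia.
wstep => [z|nz].
  wstep; apply: hQ; last by move: tb; rewrite /=; clear; lia.
  by case: h => [[e _]|[e ns]]; [rewrite e in z|right; split; [rd|]].
case: h => [[eOK [A1 hs2 hd]]|[e _]]; last by rewrite e in nz.
have ht : solved f A1 (tick s2) by apply: (solved_transfer hs2).
refine (@output_wp _ (tick s2) A1 ht _ _ _); try by rewrite /= fr2.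
move=> s3 [fr3 fa3] ho t3; apply: hQ; last by move: tb t3; rewrite /=; clear; lia.
left; split; first by rewrite fr3.
exists A1; split; [exact: s_closed hs2|exact: s_free hs2| |].
  move=> c l cf lc; have lf : l \in flatten f by apply/flattenP; exists c.
  have := hd (index l (flatten f)); rewrite index_mem nth_index //.
  by move/(_ lf).
move=> l lf; split; last exact: ho.
by rewrite fa3 //= (s_val hs2 false) (_ : (_ == 1) = false) ?orbF //; lia.
Qed.

End Verify.

(* The registers below [nregs] are in use during the run, so the values of the variables whose
   output cells they are can only be loaded at the end. *)
Definition load_value i := [:: IConst i (16 * (2 * i + 1) + 2); IAdd i i 0; ILoad i i].

(** Register [i] gets entry [2 * i + 1], that is [ix (i - 1, true)], of field 2. Register 0 holds
    [D] during the loads and the answer afterwards; [rOK] is tested first because the loads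
    overwrite it. The length is 121 = 3 + 3 * 39 + 1. *)
Definition epilogue pc :=
  [:: IConst 0 0; IJz rOK (pc + 121); IAdd 0 0 1] ++
  flatten [seq load_value i | i <- iota 1 39] ++ [:: IConst 0 1].

Lemma load_values p inp m D (rs : seq nat) pc : uniq rs -> (forall i, i \in rs -> 0 < i < nregs) ->
  nregs <= D -> m 0 = D -> code_at p pc (flatten [seq load_value i | i <- rs]) ->
  exists m', [/\ nsteps p inp (3 * size rs) (pc, m) = Some (pc + 3 * size rs, m'),
    forall i, i \in rs -> m' i = m (D + 16 * (2 * i + 1) + 2) &
    forall i, i \notin rs -> m' i = m i].
Proof.
move=> + + D40; elim: rs pc m => [|i rs IH] pc m.
  by move=> _ _ _ _; exists m; rewrite muln0 addn0.
move=> /andP [irs urs] hrs m0 /code_at_cons [n1] /code_at_cons [n2] /code_at_cons [n3] hc.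
have /andP [i0 i40] := hrs i (mem_head _ _).
set c := 16 * _ + 2 in n1.
pose a1 := upd m i c; pose a2 := upd a1 i (a1 i + a1 0); pose a3 := upd a2 i (a2 (a2 i)).
have ne0 : (0 == i) = false by lia.
have e3 x : a3 x = if x == i then m (D + c) else m x.
  rewrite /a3 /a2 /a1 /upd eqxx ne0 m0; case: eqP => // _.
  by rewrite (_ : (c + D == i) = false) 1?addnC //; lia.
have st : nsteps p inp 3 (pc, m) = Some (pc.+3, a3) by rewrite /= n1 /= n2 /= n3.
have hrs' j : j \in rs -> 0 < j < nregs by move=> hj; apply: hrs; rewrite inE hj orbT.
have [|m' [k1 k2 k3]] := IH pc.+3 a3 urs hrs' _ hc; first by rewrite e3 ne0.
exists m'; split.
- by rewrite (_ : 3 * _ = 3 + 3 * size rs) ?(nsteps_add st k1) ?mulnS // addnA addn3.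
- move=> j; rewrite inE; case: eqP => [->|_] /= hj.
    by rewrite k3 // e3 eqxx /c addnA.
  rewrite k2 // e3 (_ : (_ == i) = false) //.
  by move: i40 D40; clear; lia.
- move=> j; rewrite inE negb_or => /andP [/negbTE ne hj].
  by rewrite k3 // e3 ne.
Qed.

Lemma epilogue_correct p inp pc m D : code_at p pc (epilogue pc) -> nregs <= D -> m 1 = D ->
  exists k m', [/\ nsteps p inp k (pc, m) = Some (pc + 121, m'), k <= 121,
    m rOK = 0 -> m' 0 = 0 &
    m rOK <> 0 -> m' 0 = 1 /\
      forall v, m' v.+1 = if v.+1 < nregs then m (D + 16 * (v + v + 3) + 2) else m v.+1].
Proof.
rewrite /epilogue => /code_at_cat [h1 h2] D40 m1.
have {h1} [n1 /code_at_cons [n2 /code_at_cons [n3 _]]] := code_at_cons h1.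
have eOK : upd m 0 0 rOK = m rOK by [].
case: (eqVneq (m rOK) 0) => [z|nz].
  exists 2, (upd m 0 0); split=> //.
  by rewrite /= n1 /= n2 /= eOK z.
have {h2} [hl hr] := code_at_cat h2.
have st : nsteps p inp 3 (pc, m) = Some (pc + 3, upd (upd m 0 0) 0 (upd m 0 0 0 + upd m 0 0 1)).
  rewrite /= n1 /= n2 eOK (negbTE nz) /= n3; congr (Some (_, _)); clear; lia.
set a := upd _ 0 _ in st.
have ea x : a x = if x == 0 then D else m x by rewrite /a /upd; case: (x == 0); rewrite // m1.
have hi i : i \in iota 1 39 -> 0 < i < nregs by rewrite mem_iota; lia.
have [//|m' [k1 k2 k3]] := @load_values p inp a D (iota 1 39) (pc + 3) (iota_uniq _ _) hi D40 _ hl.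
rewrite size_iota in k1.
have [n4 _] := code_at_cons hr.
exists (3 + (3 * 39 + 1)), (upd m' 0 1); split=> //; last first.
- move=> _; split=> // v; rewrite {1}/upd /=.
  case: ifP => hv; last by rewrite k3 ?ea // mem_iota; lia.
  rewrite k2 ?ea; last by rewrite mem_iota; lia.
  by rewrite (_ : 2 * v.+1 + 1 = v + v + 3); [case: eqP => //; lia|lia].
- by move/eqP: nz.
apply: (nsteps_add st); apply: (nsteps_add k1).
have ec : pc + size [:: IConst 0 0; IJz rOK (pc + 121); IAdd 0 0 1] + 
  size (flatten [seq load_value i | i <- iota 1 39]) = pc + 3 + 3 * 39 by rewrite -!addnA.
by rewrite -ec /= n4; congr (Some (_, _)); rewrite ec; clear; lia.
Qed.

(** Register 0 starts with the input length, which is saved in [rN] before address computations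
    overwrite it. Between the two compiled phases [rD] is copied to register 1, where [addr] expects
    it. *)
Definition prog := [:: IConst 1 0; IAdd rN 0 1] ++ comp 2 total ++
  [:: IConst 0 0; IAdd 1 rD 0] ++ comp (4 + len total) main ++ epilogue (4 + len total + len main).

Lemma size_epilogue pc : size (epilogue pc) = 121. Proof. by []. Qed.

Lemma eq_sat f (a b : nat -> bool) :
  (forall l, l \in flatten f -> a l.1 = b l.1) -> sat f a = sat f b.
Proof.
move=> h; apply: eq_in_all => c cf; apply: eq_in_has => l lc.
by rewrite h //; apply/flattenP; exists c.
Qed.

Lemma layout (a b c d e : seq instr) (p := a ++ b ++ c ++ d ++ e) :
  [/\ code_at p 0 a, code_at p (size a) b, code_at p (size a + size b) c &
    code_at p (size a + size b + size c) d /\ code_at p (size a + size b + size c + size d) e].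
Proof.
have /code_at_cat [ha /code_at_cat [hb /code_at_cat [hc /code_at_cat [hd he]]]] : code_at p 0 p by [].
by split=> //; rewrite -?addnA.
Qed.

Lemma prog_correct f (fsz : forall c, c \in f -> c != [::] /\ size (undup c) <= 3)
  (refute : forall (M : pred nat) x, rclosed (records f) M -> nxfree M ->
    (forall y, M y -> occ f y) -> occ f x -> occ f (nx x) -> ~~ M x -> ~~ M (nx x) ->
    no_ext f M x -> no_ext f M (nx x) -> ~ satisfiable f) :
  exists k m, [/\ nsteps prog (enc f) k (init (enc f)) = Some (size prog, m),
    k <= 5000 * 4 * (size (enc f)).+1 &
    m 0 = 0 /\ ~ satisfiable f \/ m 0 = 1 /\ sat f (fun i => m i.+1 != 0)].
Proof.
set inp := enc f; set p := prog; pose D := nregs + sumn inp.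
have := layout [:: IConst 1 0; IAdd rN 0 1] (comp 2 total) [:: IConst 0 0; IAdd 1 rD 0]
  (comp (4 + len total) main) (epilogue (4 + len total + len main)).
rewrite -/prog -/p !size_comp (_ : size _ + _ + _ = 4 + len total); last by rewrite -addnA addnCA addnC.
case=> c1 + + [c4 c5]; rewrite -[size _]/2 => c2 c3.
have sz : size p = 4 + len total + len main + 121.
  by rewrite /p /prog 4!size_cat 2!size_comp size_epilogue; clear; rewrite -[size [:: IConst 1 0; _]]/2 -[size [:: IConst 0 0; _]]/2; lia.
clearbody p; have [n1 /code_at_cons [n2 _]] := code_at_cons c1.
pose s0 := St (fun r => if r == rN then size inp else 0) (fun _ _ => 0) (fun _ => 0) 0.
have st0 : nsteps p inp 2 (init inp) = Some (2, upd (upd (init inp).2 1 0) rN (size inp)).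
  by rewrite /= n1 /= n2 /= addn0.
have sim0 : sim nregs D false (upd (upd (init inp).2 1 0) rN (size inp)) s0.
  split=> [r|]; last split=> // _ r; rewrite /okr /upd /= => hr.
    by move: hr; clear; case: (r == rN) => //; case: r => [|[]].
  by move: hr; clear; case: r => [|[|[|[]]]].
have w0 : wp nregs inp D total (fun s => [/\ rg s rD = D, rg s rN = size inp &
    tm s <= 60 * size inp + 60]) s0.
  by refine (total_wp _ _) => // s h1 h2 h3; split.
have [k1 [m1 [s1 [st1 [sim1 [_ sim1']] [d1 e1 t1] le1]]]] :=
  comp_correct (R := nregs) isT c2 isT w0 sim0.
pose m2 := upd (upd m1 0 0) 1 D.
have st2 : nsteps p inp 2 (2 + len total, m1) = Some (4 + len total, m2).
  have [n3 /code_at_cons [n4 _]] := code_at_cons c3.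
  have e22 : upd m1 0 0 rD = D by rewrite -d1; exact: sim1 rD isT.
  by rewrite /= n3 /= n4 e22 [upd m1 0 0 0]/upd /= addn0.
(* The second phase starts from empty arrays: the first one left every cell from [nregs] on at zero,
   wherever [D] lies. *)
pose s2 := St (rg s1) (fun _ _ => 0) (fun _ => 0) (tm s1).
have sim2 : sim nregs D true m2 s2.
  have big a : nregs <= a -> m2 a = 0.
    by move=> ha; have := sim1' isT a ha; rewrite /m2 /upd; clear - ha; case: a ha => [|[]].
  split; last split=> // _.
    move=> r hr; rewrite /m2 /upd /= -sim1 //; move: hr; rewrite /okr => hr.
    by move: hr; clear; case: r => [|[]].
  split=> //.
    by move=> g i hg; rewrite big // /D -!addnA leq_addr.
  by move=> a /andP [ha _]; rewrite big.
have w2 : wp nregs inp D main (fun s => (rg s rOK = 1 /\ (exists A1 : pred nat, model f s A1) \/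
     rg s rOK = 0 /\ ~ satisfiable f) /\ tm s <= tm s1 + 5000 * 3 * (size inp).+1) s2.
  by refine (main_wp _ _ _ refute _ _ _) => // s h1 h2; split.
have [k3 [m3 [s3 [st3 [sim3 [/(_ isT) [one3 le3 ar3 ou3] _]] [h3 t3] le3']]]] :=
  comp_correct (R := nregs) (arr := true) isT c4 isT w2 sim2.
have [k4 [m4 [st4 le4 hz hnz]]] := epilogue_correct inp c5 le3 one3.
exists (2 + (k1 + (2 + (k3 + k4)))), m4; split.
- rewrite sz; apply: (nsteps_add st0); apply: (nsteps_add st1); apply: (nsteps_add st2).
  exact: nsteps_add st3 st4.
- by move: t1 le1 t3 le3' le4; rewrite /s2 /=; clear; lia.
have eOK := sim3 rOK isT.
case: h3 => [[ok [A1 [cl fr dec val]]]|[ok ns]]; last by left; rewrite hz ?eOK.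
right; have [] := hnz; first by rewrite eOK ok.
move=> -> out; split=> //; rewrite (@eq_sat f _ (fun v => A1 (v + v + 3))) //.
  exact: sat_of_rclosed.
move=> l lf; have [v1 v2] := val l lf; rewrite out; case: ifP => hl.
  by rewrite [D + _ + 2]/= ar3 // v1; case: (A1 _).
have h40 : nregs <= l.1.+1 by rewrite leqNgt hl.
rewrite ou3 ?v2 //; first by case: (A1 _).
by have := var_le_sum erefl lf; rewrite -/inp h40 /D; clear; lia.
Qed.

Theorem theorem8 :
  exists (prog : seq instr) (C : nat),
  forall (n : nat) (lt : rel 'I_n),
    irreflexive lt -> transitive lt ->
  forall (chi0 : {set W n} -> bool) (comp : {set W n} -> nat) (k : nat),
    (forall e e', is_edge lt e -> is_edge lt e' -> conflict lt e e' ->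
        chi0 e != chi0 e') ->
    (forall e e', is_edge lt e -> is_edge lt e' ->
        (comp e == comp e') = connect (conflict lt) e e') ->
    (forall e, is_edge lt e -> comp e < k) ->
    (forall i, i < k -> exists e, is_edge lt e /\ comp e = i) ->
  forall f : seq (seq lit), represents lt chi0 comp f ->
  exists (t : nat) (m : nat -> nat),
    [/\ t <= C * (size (enc f)).+1,
        run prog (enc f) t (init (enc f)) = Some m,
        (m 0 != 0 <-> satisfiable f) &
        (m 0 != 0 -> sat f (fun i => m i.+1 != 0))].
Proof.
exists prog, (5000 * 4) => n lt _ lt_tr chi0 comp k chi0P compP _ _ f frep.
have [t [m [st le res]]] := prog_correct (clause_size chi0P compP frep)
  (both_refuted lt_tr chi0P compP frep).
exists t, m; split=> //.
- by rewrite (run_nsteps st) // /step nth_default.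
- by case: res => [[-> ns]|[-> hs]]; split=> // _; exists (fun i => m i.+1 != 0).
- by case: res => [[-> _]|[_ hs]].
Qed.
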